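(* Let $H$ be a Hopf algebra over a field $k$ with bijective antipode. The assignments $A\mapsto H/HA^+$ and $C\mapsto {}^{\mathrm{co}\,C}H$ give mutually inverse bijections between (1) the set of right coideal dominion subalgebras $A$ of $H$ over which $H$ is left (respectively, right) flat, and (2) the set of left $H$-module factor coalgebras $C$ of $H$ with the property that each finite-dimensional left (respectively, right) $C$-comodule embeds as a $C$-subcomodule in a left (respectively, right) $H$-comodule.
   Context: $k$ is a field, $H$ a Hopf algebra over $k$ with comultiplication $\Delta$, counit $\varepsilon$; all tensor products without subscript are over $k$. A right coideal subalgebra of $H$ is a subalgebra $A\subset H$ with $\Delta(A)\subset A\otimes H$; put $A^+=A\cap\ker\varepsilon$. Then $HA^+$ is a left ideal and a coideal of $H$. A left $H$-module factor coalgebra of $H$ is a quotient $C=H/I$ where $I$ is both a coideal and a left ideal of $H$; $\pi:H\to C$ is the canonical surjection, $1_C=\pi(1)$, and ${}^{\mathrm{co}\,C}H=\{h\in H\mid(\pi\otimes\mathrm{id})\Delta(h)=1_C\otimes h\}$, which is a right coideal subalgebra of $H$. Takeuchi's correspondence consists of the two assignments $A\mapsto H/HA^+$ and $C\mapsto{}^{\mathrm{co}\,C}H$. The dominion of a subalgebra $A$ in $H$ is the subalgebra $\{h\in H\mid h\otimes1=1\otimes h\text{ in }H\otimes_AH\}$; $A$ is a dominion subalgebra if it coincides with its dominion in $H$. $H$ is left (right) flat over $A$ if it is flat as a left (right) $A$-module under multiplication in $H$. Every $H$-comodule is regarded as a $C$-comodule via $\pi$. *)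

(* Defs.v *)
From HB Require Import structures.
From mathcomp Require Import all_boot all_algebra.
From mathcomp Require Import boolp classical_sets functions.
From mathcomp.multinomials Require Import freeg.

Set Implicit Arguments.
Unset Strict Implicit.
Unset Printing Implicit Defensive.

Import GRing.Theory.

Local Open Scope classical_set_scope.
Local Open Scope ring_scope.
Local Open Scope quotient_scope.

Section QuotientModule.
Variables (R : nzRingType) (V : lmodType R).

Inductive span (S : set V) : set V :=
| span0 : span S 0
| spanD (a : R) (u v : V) : S u -> span S v -> span S (a *: u + v).

Lemma span_sub (S : set V) : S `<=` span S.
Proof. by move=> u Su; rewrite -[u]addr0 -[u]scale1r; apply: spanD => //; exact: span0. Qed.

Lemma span_linear (S : set V) (a : R) (u v : V) :
  span S u -> span S v -> span S (a *: u + v).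
Proof.
elim=> [|b x y Sx _ IH] Sv; first by rewrite scaler0 add0r.
by rewrite scalerDr scalerA -addrA; apply: spanD => //; exact: IH.
Qed.

Lemma span_ind_linear (S P : set V) : P 0 ->
    (forall a u v, P u -> P v -> P (a *: u + v)) -> S `<=` P -> span S `<=` P.
Proof. by move=> P0 PD SP u; elim=> // a x y Sx _ IH; apply: PD => //; exact: SP. Qed.

Lemma span_id (S : set V) : S 0 ->
    (forall a u v, S u -> S v -> S (a *: u + v)) -> span S = S.
Proof.
move=> S0 SD; apply/seteqP; split; last exact: span_sub.
exact: span_ind_linear.
Qed.

Lemma span_mono (S T : set V) : S `<=` span T -> span S `<=` span T.
Proof.
move=> ST; apply: span_ind_linear ST; first exact: span0.
by move=> *; exact: span_linear.
Qed.

Definition spanp (S : set V) : {pred V} := fun v => `[< span S v >].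

Lemma spanp_zmod_closed (S : set V) : zmod_closed (spanp S).
Proof.
split; first by apply/asboolP; exact: span0.
move=> u v /asboolP Su /asboolP Sv; apply/asboolP.
by rewrite addrC -scaleN1r; exact: span_linear.
Qed.

HB.instance Definition _ (S : set V) :=
  GRing.isZmodClosed.Build V (spanp S) (spanp_zmod_closed S).

(* V modulo the submodule generated by S; the wrapper keeps unification from
   unfolding the quotient. *)
Record qmod (S : set V) : Type := QMod { qval : Quotient.quot (spanp S) }.

HB.instance Definition _ (S : set V) := [isNew for @qval S].
HB.instance Definition _ (S : set V) := [Choice of qmod S by <:].

Definition qpi (S : set V) (v : V) : qmod S := QMod (\pi_(Quotient.quot (spanp S))%qT v).
Definition qrepr (S : set V) (x : qmod S) : V := repr (qval x).

Variable S : set V.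

Lemma qreprK : cancel (@qrepr S) (@qpi S).
Proof. by case=> x; rewrite /qpi /qrepr reprK. Qed.

Lemma qpiP (u v : V) : qpi S u = qpi S v <-> span S (u - v).
Proof.
have E := @Quotient.idealrBE V (spanp S) u v; split=> [[] /eqP|uv].
  by rewrite -E => /asboolP.
by congr QMod; apply/eqP; rewrite -E; apply/asboolP.
Qed.

Lemma span_scale (a : R) (u : V) : span S u -> span S (a *: u).
Proof. by move=> Su; rewrite -[_ *: _]addr0; apply: span_linear => //; exact: span0. Qed.

Lemma span_add (u v : V) : span S u -> span S v -> span S (u + v).
Proof. by rewrite -[u in span S (u + v)]scale1r; exact: span_linear. Qed.

Definition qadd (x y : qmod S) : qmod S := qpi S (qrepr x + qrepr y).
Definition qopp (x : qmod S) : qmod S := qpi S (- qrepr x).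
Definition qscale (a : R) (x : qmod S) : qmod S := qpi S (a *: qrepr x).

Lemma qreprP v : span S (qrepr (qpi S v) - v).
Proof. by apply/qpiP; rewrite qreprK. Qed.

Lemma qaddE u v : qadd (qpi S u) (qpi S v) = qpi S (u + v).
Proof. by apply/qpiP; rewrite opprD addrACA; apply: span_add; exact: qreprP. Qed.
Lemma qoppE v : qopp (qpi S v) = qpi S (- v).
Proof. by apply/qpiP; rewrite -opprD -[- (_ - _)]scaleN1r; apply/span_scale/qreprP. Qed.
Lemma qscaleE (a : R) (v : V) : qscale a (qpi S v) = qpi S (a *: v).
Proof. by apply/qpiP; rewrite -scalerBr; apply/span_scale/qreprP. Qed.

Lemma qaddA : associative qadd.
Proof. by move=> x y z; rewrite -[x]qreprK -[y]qreprK -[z]qreprK !qaddE addrA. Qed.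
Lemma qaddC : commutative qadd.
Proof. by move=> x y; rewrite /qadd addrC. Qed.
Lemma qadd0 : left_id (qpi S 0) qadd.
Proof. by move=> x; rewrite -[x]qreprK qaddE add0r. Qed.
Lemma qaddN : left_inverse (qpi S 0) qopp qadd.
Proof. by move=> x; rewrite -[x]qreprK qoppE qaddE addNr. Qed.

HB.instance Definition _ := GRing.isZmodule.Build (qmod S) qaddA qaddC qadd0 qaddN.

Lemma qpiD : {morph qpi S : u v / u + v}.
Proof. by move=> u v; rewrite -qaddE. Qed.

Lemma qscaleA a b x : qscale a (qscale b x) = qscale (a * b) x.
Proof. by rewrite -[x]qreprK !qscaleE scalerA. Qed.
Lemma qscale1 : left_id 1 qscale.
Proof. by move=> x; rewrite -[x]qreprK !qscaleE scale1r. Qed.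
Lemma qscaleDr : right_distributive qscale +%R.
Proof. by move=> a x y; rewrite -[x]qreprK -[y]qreprK -qpiD !qscaleE -qpiD scalerDr. Qed.
Lemma qscaleDl x : {morph qscale^~ x : a b / a + b}.
Proof. by move=> a b; rewrite -[x]qreprK !qscaleE -qpiD scalerDl. Qed.

HB.instance Definition _ := GRing.Zmodule_isLmodule.Build R (qmod S)
  qscaleA qscale1 qscaleDr qscaleDl.

Lemma qpi_is_linear : linear (qpi S).
Proof. by move=> a u v; rewrite qpiD -qscaleE. Qed.
HB.instance Definition _ := GRing.isLinear.Build R V (qmod S) *:%R (qpi S) qpi_is_linear.

Section Lift.
Variables (U : lmodType R) (f : {linear V -> U}).

(* On representatives; meaningful (and linear) when f vanishes on S. *)
Definition qlift (x : qmod S) : U := f (qrepr x).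

Hypothesis fS : forall s, S s -> f s = 0.

Lemma span_lift0 s : span S s -> f s = 0.
Proof. by elim=> [|a u v /fS fu _ IH]; rewrite ?linear0// linearP fu IH scaler0 addr0. Qed.

Lemma qliftE v : qlift (qpi S v) = f v.
Proof.
apply/eqP; rewrite -subr_eq0 -linearB; apply/eqP/span_lift0.
by apply/qpiP; rewrite qreprK.
Qed.

Lemma qlift_is_linear : linear qlift.
Proof. by move=> a x y; rewrite -[x]qreprK -[y]qreprK -linearP !qliftE linearP. Qed.
End Lift.

End QuotientModule.

Section FreeLift.
Variables (R : nzRingType) (K : choiceType) (M : lmodType R) (f : K -> M).

Lemma fglift_is_linear : linear (fglift f : {freeg K / R} -> M).
Proof.
have fB : {morph fglift f : x y / x - y} := @lift_is_additive R K M f.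
have fD : {morph fglift f : x y / x + y}.
  by move=> x y; rewrite -[in RHS](addrK y x) fB subrK.
have f0 : fglift f 0 = 0 by apply: (addrI (fglift f 0)); rewrite -fD !addr0.
have fsum (s : seq K) (F : K -> {freeg K / R}) :
    fglift f (\sum_(z <- s) F z) = \sum_(z <- s) fglift f (F z).
  by apply: big_morph.
move=> a x y; rewrite fD; congr (_ + _).
rewrite -[in RHS](freeg_sumE x) fsum scaler_sumr -[a *: x]/(fgscale a x) fsum.
by apply: eq_bigr => z _; rewrite !liftU scalerA.
Qed.

HB.instance Definition _ :=
  GRing.isLinear.Build R {freeg K / R} M *:%R (fglift f) fglift_is_linear.
End FreeLift.

Section Tensor.
Variables (k : fieldType) (V W : lmodType k).

Definition tgen (v : V) (w : W) : {freeg (V * W)%type / k} := << (v, w) >>.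

Variant tens_rel : set {freeg (V * W)%type / k} :=
| tens_rel_linl (a : k) (u v : V) (w : W) :
    tens_rel (tgen (a *: u + v) w - (a *: tgen u w + tgen v w))
| tens_rel_linr (a : k) (v : V) (w x : W) :
    tens_rel (tgen v (a *: w + x) - (a *: tgen v w + tgen v x)).

Definition tens : Type := qmod tens_rel.
HB.instance Definition _ := GRing.Lmodule.on tens.

Definition ptens (v : V) (w : W) : tens := qpi tens_rel (tgen v w).

Lemma ptensDl a u v w : ptens (a *: u + v) w = a *: ptens u w + ptens v w.
Proof.
transitivity (qpi tens_rel (a *: tgen u w + tgen v w)); last exact: linearP.
exact/qpiP/span_sub/tens_rel_linl.
Qed.

Lemma ptensDr a v w x : ptens v (a *: w + x) = a *: ptens v w + ptens v x.
Proof.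
transitivity (qpi tens_rel (a *: tgen v w + tgen v x)); last exact: linearP.
exact/qpiP/span_sub/tens_rel_linr.
Qed.

Lemma tens_span (t : tens) : span [set x | exists v w, x = ptens v w] t.
Proof.
rewrite -[t]qreprK -[qrepr t]freeg_sumE raddf_sum /=.
elim: (dom _) => [|[v w] s IH]; first by rewrite big_nil; exact: span0.
rewrite big_cons; set a := coeff _ _.
have -> : << a *g (v, w) >> = a *: tgen v w.
  by apply/eqP/freeg_eqP => z; rewrite coeffZ !coeffU mul1r.
rewrite linearZ /=; apply: spanD => //.
by exists v, w.
Qed.

Lemma tens_ind (P : tens -> Prop) : P 0 ->
  (forall a x y, P x -> P y -> P (a *: x + y)) ->
  (forall v w, P (ptens v w)) -> forall t, P t.
Proof.
move=> P0 PD Pp t; have := tens_span t.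
by apply: (@span_ind_linear _ _ _ P) => // _ [v [w ->]].
Qed.

Section Lift.
Variables (U : lmodType k).

Definition bilin (f : V -> W -> U) :=
  (forall a u v w, f (a *: u + v) w = a *: f u w + f v w) /\
  (forall a v w x, f v (a *: w + x) = a *: f v w + f v x).

(* On representatives; meaningful (and linear) when f is bilinear. *)
Definition tlift (f : V -> W -> U) (t : tens) : U :=
  qlift (fglift (fun p : V * W => f p.1 p.2)) t.

Lemma tlift_rel f : bilin f ->
  forall s, tens_rel s -> fglift (fun p : V * W => f p.1 p.2) s = 0.
Proof.
move=> [fl fr] s [a u v w|a v w x]; rewrite linearB linearP /= !liftU !scale1r /=.
  by rewrite fl subrr.
by rewrite fr subrr.
Qed.

Lemma tliftE f v w : bilin f -> tlift f (ptens v w) = f v w.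
Proof.
by move=> bf; rewrite /tlift qliftE; [rewrite /= liftU scale1r|exact: tlift_rel].
Qed.

Lemma tlift_is_linear f : bilin f -> linear (tlift f).
Proof. by move=> bf; apply: qlift_is_linear; exact: tlift_rel. Qed.

Lemma tens_linext (f g : tens -> U) : linear f -> linear g ->
  (forall v w, f (ptens v w) = g (ptens v w)) -> f =1 g.
Proof.
move=> fl gl fg; apply: tens_ind => // [|a x y fx fy]; last by rewrite fl gl fx fy.
have lin0 (h : tens -> U) : linear h -> h 0 = 0.
  move=> hl; have := hl 1 0 0; rewrite !scale1r addr0 => h0.
  by apply: (addrI (h 0)); rewrite addr0.
by rewrite !lin0.
Qed.
End Lift.

End Tensor.

Notation "V \ox W" := (tens V W) (at level 40, left associativity).
Notation "v \ot w" := (ptens v w) (at level 40, left associativity) : ring_scope.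

Section TensorMaps.
Variable k : fieldType.

Lemma linear_comb (U V : lmodType k) (c : k) (f g : U -> V) :
  linear f -> linear g -> linear (fun x => c *: f x + g x).
Proof.
by move=> fl gl a x y; rewrite fl gl !scalerDr !scalerA [c * a]mulrC addrACA.
Qed.

Lemma tens_ext (V W U : lmodType k) (f g : {linear V \ox W -> U}) :
  (forall v w, f (v \ot w) = g (v \ot w)) -> f =1 g.
Proof. by move=> fg; apply: tens_linext => //; exact: linearP. Qed.

Section Map.
Variables (V V' W W' : lmodType k) (f : {linear V -> V'}) (g : {linear W -> W'}).

Definition tmap : V \ox W -> V' \ox W' := tlift (fun v w => f v \ot g w).

Lemma tmap_bilin : bilin (fun v w => f v \ot g w).
Proof. by split=> *; rewrite linearP (ptensDl, ptensDr). Qed.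

Lemma tmapE v w : tmap (v \ot w) = f v \ot g w.
Proof. by rewrite /tmap tliftE //; exact: tmap_bilin. Qed.

Lemma tmap_is_linear : linear tmap.
Proof. exact/tlift_is_linear/tmap_bilin. Qed.
HB.instance Definition _ :=
  GRing.isLinear.Build k (V \ox W) (V' \ox W') *:%R tmap tmap_is_linear.
End Map.

Lemma tmap_id (V W : lmodType k) (t : V \ox W) : tmap idfun idfun t = t.
Proof. by move: t; apply: (tens_ext (g := idfun)) => v w /=; rewrite tmapE. Qed.

Lemma ptens_is_linear (V W : lmodType k) (v : V) : linear (ptens v : W -> V \ox W).
Proof. by move=> a w x; rewrite ptensDr. Qed.
HB.instance Definition _ (V W : lmodType k) (v : V) :=
  GRing.isLinear.Build k W (V \ox W) *:%R (ptens v) (ptens_is_linear v).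

Lemma tens_ext3 (V W X U : lmodType k) (f g : {linear (V \ox W) \ox X -> U}) :
  (forall v w x, f (v \ot w \ot x) = g (v \ot w \ot x)) -> f =1 g.
Proof.
move=> fg; apply: tens_ext => t x.
apply: (@tens_linext _ _ _ _ (fun t => f (t \ot x)) (fun t => g (t \ot x))) => //.
- by move=> a y z; rewrite ptensDl linearP.
- by move=> a y z; rewrite ptensDl linearP.
Qed.

Lemma ptens0l (V W : lmodType k) (w : W) : (0 : V) \ot w = 0.
Proof.
have := ptensDl 1 (0 : V) 0 w; rewrite !scale1r addr0 => h0.
by apply: (addrI (0 \ot w)); rewrite addr0.
Qed.

Lemma ptensBl (V W : lmodType k) (u v : V) (w : W) :
  (u - v) \ot w = u \ot w - v \ot w.
Proof. by rewrite addrC -scaleN1r ptensDl scaleN1r addrC. Qed.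

Lemma ptensZl (V W : lmodType k) a (v : V) (w : W) : (a *: v) \ot w = a *: (v \ot w).
Proof. by rewrite -[a *: v]addr0 ptensDl ptens0l addr0. Qed.

Section Assoc.
Variables (U V W : lmodType k).

Definition tassoc_r (w : W) : U \ox V -> U \ox (V \ox W) :=
  tlift (fun (u : U) (v : V) => u \ot (v \ot w)).

Definition tassoc : (U \ox V) \ox W -> U \ox (V \ox W) :=
  tlift (fun (x : U \ox V) (w : W) => tassoc_r w x).

Lemma tassoc_r_bilin (w : W) : bilin (fun (u : U) (v : V) => u \ot (v \ot w)).
Proof. by split=> *; rewrite ?(ptensDl, ptensDr). Qed.

Lemma tassoc_bilin : bilin (fun (x : U \ox V) (w : W) => tassoc_r w x).
Proof.
split=> [a x y w|a x w w']; first exact/(tlift_is_linear (tassoc_r_bilin w)).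
apply: (@tens_linext _ _ _ _ (tassoc_r (a *: w + w'))
    (fun x => a *: tassoc_r w x + tassoc_r w' x)) => [||u v].
- exact/tlift_is_linear/tassoc_r_bilin.
- by apply: linear_comb; exact/tlift_is_linear/tassoc_r_bilin.
- by rewrite /tassoc_r !(tliftE _ _ (tassoc_r_bilin _)) !ptensDr.
Qed.

Lemma tassocE (u : U) (v : V) (w : W) : tassoc (u \ot v \ot w) = u \ot (v \ot w).
Proof.
by rewrite /tassoc (tliftE _ _ tassoc_bilin) /tassoc_r (tliftE _ _ (tassoc_r_bilin w)).
Qed.

Lemma tassoc_is_linear : linear tassoc.
Proof. exact/tlift_is_linear/tassoc_bilin. Qed.
HB.instance Definition _ :=
  GRing.isLinear.Build k ((U \ox V) \ox W) (U \ox (V \ox W)) *:%R tassoc tassoc_is_linear.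

Definition tassocV : U \ox (V \ox W) -> (U \ox V) \ox W :=
  tlift (fun u y => tmap (ptens u) (idfun : W -> W) y).

Lemma tassocV_bilin : bilin (fun (u : U) y => tmap (ptens (u : U) : V -> _) (idfun : W -> W) y).
Proof.
split=> [a u v y|a u x y]; last exact: linearP.
apply: (@tens_linext _ _ _ _ (tmap (ptens (a *: u + v)) idfun)
  (fun y => a *: tmap (ptens u) idfun y + tmap (ptens v) idfun y)).
- exact: linearP.
- by apply: linear_comb; exact: linearP.
- by move=> b c; rewrite !tmapE /= !ptensDl.
Qed.

Lemma tassocVE (u : U) (v : V) (w : W) : tassocV (u \ot (v \ot w)) = u \ot v \ot w.
Proof. by rewrite /tassocV (tliftE _ _ tassocV_bilin) tmapE. Qed.

Lemma tassocV_is_linear : linear tassocV.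
Proof. exact/tlift_is_linear/tassocV_bilin. Qed.
HB.instance Definition _ :=
  GRing.isLinear.Build k (U \ox (V \ox W)) ((U \ox V) \ox W) *:%R tassocV tassocV_is_linear.

Lemma tassocK : cancel tassoc tassocV.
Proof.
apply: (tens_ext3 (f := _ \o _) (g := idfun)) => u v w /=.
by rewrite tassocE tassocVE.
Qed.
End Assoc.

Lemma tassoc_nat (U V W U' V' W' : lmodType k) (f : {linear U -> U'})
    (g : {linear V -> V'}) (h : {linear W -> W'}) x :
  tassoc (tmap (tmap f g) h x) = tmap f (tmap g h) (tassoc x).
Proof.
move: x; apply: (tens_ext3 (f := _ \o _) (g := _ \o _)) => u v w /=.
by rewrite !tmapE /= !tmapE !tassocE !tmapE /= tmapE.
Qed.

Section Unit.
Variable V : lmodType k.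

Definition tunitl : k^o \ox V -> V := tlift (fun (a : k^o) (v : V) => (a : k) *: v).
Definition tunitr : V \ox k^o -> V := tlift (fun (v : V) (a : k^o) => (a : k) *: v).

Lemma tunitl_bilin : bilin (fun (a : k^o) (v : V) => (a : k) *: v).
Proof.
split=> [a u v w|a v w x]; first by rewrite scalerDl scalerA.
by rewrite scalerDr !scalerA mulrC.
Qed.
Lemma tunitr_bilin : bilin (fun (v : V) (a : k^o) => (a : k) *: v).
Proof.
split=> [a u v w|a v w x]; last by rewrite scalerDl scalerA.
by rewrite scalerDr !scalerA mulrC.
Qed.

Lemma tunitlE a v : tunitl (a \ot v) = (a : k) *: v.
Proof. by rewrite /tunitl tliftE //; exact: tunitl_bilin. Qed.
Lemma tunitrE v a : tunitr (v \ot a) = (a : k) *: v.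
Proof. by rewrite /tunitr tliftE //; exact: tunitr_bilin. Qed.

Lemma tunitl_is_linear : linear tunitl.
Proof. exact/tlift_is_linear/tunitl_bilin. Qed.
HB.instance Definition _ :=
  GRing.isLinear.Build k (k^o \ox V) V *:%R tunitl tunitl_is_linear.
Lemma tunitr_is_linear : linear tunitr.
Proof. exact/tlift_is_linear/tunitr_bilin. Qed.
HB.instance Definition _ :=
  GRing.isLinear.Build k (V \ox k^o) V *:%R tunitr tunitr_is_linear.
End Unit.

Section Mul.
Variable A : algType k.

Definition mulmap : A \ox A -> A := tlift (fun a b => a * b).

Lemma mulmap_bilin : bilin (fun a b : A => a * b).
Proof.
split=> [a u v w|a v w x]; first by rewrite mulrDl scalerAl.
by rewrite mulrDr scalerAr.
Qed.
Lemma mulmapE a b : mulmap (a \ot b) = a * b.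
Proof. by rewrite /mulmap tliftE //; exact: mulmap_bilin. Qed.
Lemma mulmap_is_linear : linear mulmap.
Proof. exact/tlift_is_linear/mulmap_bilin. Qed.
HB.instance Definition _ :=
  GRing.isLinear.Build k (A \ox A) A *:%R mulmap mulmap_is_linear.

End Mul.

End TensorMaps.

HB.mixin Record isCoalgebra (k : fieldType) C of GRing.Lmodule k C := {
  comul : {linear C -> C \ox C};
  counit : {linear C -> k^o};
  comulA : forall c : C,
    tassoc (tmap comul idfun (comul c)) = tmap idfun comul (comul c);
  counitl : forall c : C, tunitl (tmap counit idfun (comul c)) = c;
  counitr : forall c : C, tunitr (tmap idfun counit (comul c)) = c
}.

#[short(type="coalgType")]
HB.structure Definition Coalgebra (k : fieldType) :=
  {C of isCoalgebra k C & GRing.Lmodule k C}.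

Section TensorMul.
Variables (k : fieldType) (A : algType k).

Definition lmul (a b : A) : A := a * b.
Lemma lmul_is_linear (a : A) : linear (lmul a).
Proof. by move=> c x y; rewrite /lmul mulrDr scalerAr. Qed.
Definition rmul (b a : A) : A := a * b.
Lemma rmul_is_linear (b : A) : linear (rmul b).
Proof. by move=> c x y; rewrite /rmul mulrDl scalerAl. Qed.
HB.instance Definition _ (b : A) :=
  GRing.isLinear.Build k A A *:%R (rmul b) (rmul_is_linear b).
Lemma lmulE a b : lmul a b = a * b. Proof. by []. Qed.
HB.instance Definition _ (a : A) :=
  GRing.isLinear.Build k A A *:%R (lmul a) (lmul_is_linear a).

Definition tmul (x y : A \ox A) : A \ox A :=
  tlift (fun a b => tmap (lmul a) (lmul b) y) x.

Lemma tmul_bilin y : bilin (fun a b => tmap (lmul a) (lmul b) y).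
Proof.
split=> [c u v w|c v u w].
  apply: (@tens_linext _ _ _ _ (tmap (lmul (c *: u + v)) (lmul w))
      (fun y => c *: tmap (lmul u) (lmul w) y + tmap (lmul v) (lmul w) y)).
  - exact: linearP.
  - by apply: linear_comb; exact: linearP.
  - by move=> p q; rewrite !tmapE /= !lmulE mulrDl -scalerAl ptensDl.
apply: (@tens_linext _ _ _ _ (tmap (lmul v) (lmul (c *: u + w)))
    (fun y => c *: tmap (lmul v) (lmul u) y + tmap (lmul v) (lmul w) y)).
- exact: linearP.
- by apply: linear_comb; exact: linearP.
- by move=> p q; rewrite !tmapE /= !lmulE mulrDl -scalerAl ptensDr.
Qed.

Lemma tmulE a b c d : tmul (a \ot b) (c \ot d) = (a * c) \ot (b * d).
Proof. by rewrite /tmul (tliftE _ _ (tmul_bilin _)) tmapE. Qed.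

Lemma tmul_ptensl a b y : tmul (a \ot b) y = tmap (lmul a) (lmul b) y.
Proof. by rewrite /tmul (tliftE _ _ (tmul_bilin _)). Qed.

Lemma tmul_linearl y : linear (tmul^~ y).
Proof. exact/tlift_is_linear/tmul_bilin. Qed.

Lemma tmul_linear0l y : tmul 0 y = 0.
Proof.
have := tmul_linearl y 1 0 0; rewrite !scale1r addr0 => h0.
by apply: (addrI (tmul 0 y)); rewrite addr0.
Qed.

Lemma tmul_linearr x : linear (tmul x).
Proof.
move=> c y z.
apply: (@tens_linext _ _ _ _ (tmul^~ (c *: y + z))
    (fun x => c *: tmul x y + tmul x z)).
- exact: tmul_linearl.
- by apply: linear_comb; exact: tmul_linearl.
- by move=> a b; rewrite !tmul_ptensl linearP.
Qed.

End TensorMul.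

HB.mixin Record isHopfAlgebra (k : fieldType) H
    of GRing.Algebra k H & Coalgebra k H := {
  comul1 : comul (1 : H) = 1 \ot 1;
  comulM : forall x y : H, comul (x * y) = tmul (comul x) (comul y);
  counit1 : counit (1 : H) = 1;
  counitM : forall x y : H, counit (x * y) = counit x * counit y :> k;
  antipode : {linear H -> H};
  antipodel : forall h : H,
    mulmap (tmap antipode idfun (comul h)) = (counit h : k)%:A;
  antipoder : forall h : H,
    mulmap (tmap idfun antipode (comul h)) = (counit h : k)%:A
}.

#[short(type="hopfAlgType")]
HB.structure Definition HopfAlgebra (k : fieldType) :=
  {H of isHopfAlgebra k H & GRing.Algebra k H & Coalgebra k H}.

Section Comodules.
Variables (k : fieldType) (C : coalgType k).

Definition right_comodule (V : lmodType k) (rho : {linear V -> V \ox C}) : Prop :=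
  (forall v, tassoc (tmap rho idfun (rho v)) = tmap idfun comul (rho v)) /\
  (forall v, tunitr (tmap idfun counit (rho v)) = v).

Definition left_comodule (V : lmodType k) (rho : {linear V -> C \ox V}) : Prop :=
  (forall v, tassoc (tmap comul idfun (rho v)) = tmap idfun rho (rho v)) /\
  (forall v, tunitl (tmap counit idfun (rho v)) = v).

End Comodules.

Section BalancedTensor.
Variable R : nzRingType.

Section Def.
Variables (M : lmodType R^c) (N : lmodType R).

Definition bgen (m : M) (n : N) : {freeg (M * N)%type / int} := << (m, n) >>.

(* A right R-module is a module over the converse ring R^c. *)
Variant btens_rel : set {freeg (M * N)%type / int} :=
| btens_rel_addl (m m' : M) (n : N) :
    btens_rel (bgen (m + m') n - (bgen m n + bgen m' n))
| btens_rel_addr (m : M) (n n' : N) :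
    btens_rel (bgen m (n + n') - (bgen m n + bgen m n'))
| btens_rel_bal (m : M) (r : R) (n : N) :
    btens_rel (bgen ((r : R^c) *: m) n - bgen m (r *: n)).

Definition btens : Type := qmod btens_rel.
HB.instance Definition _ := GRing.Zmodule.on btens.

Definition bptens (m : M) (n : N) : btens := qpi btens_rel (bgen m n).
End Def.

Definition btmap (M M' : lmodType R^c) (N N' : lmodType R)
    (f : {linear M -> M'}) (g : {linear N -> N'}) : btens M N -> btens M' N' :=
  qlift (fglift (fun p : M * N => bptens (f p.1) (g p.2) : qmod _)).

Definition flat_left_module (N : lmodType R) : Prop :=
  forall (M M' : lmodType R^c) (f : {linear M -> M'}),
    injective f -> injective (@btmap M M' N N f idfun).

Definition flat_right_module (M : lmodType R^c) : Prop :=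
  forall (N N' : lmodType R) (g : {linear N -> N'}),
    injective g -> injective (@btmap M M N N' idfun g).

End BalancedTensor.

(* the image of P (x) Q in V (x) W, for subspaces P of V and Q of W *)
Definition tens_sub (k : fieldType) (V W : lmodType k) (P : set V) (Q : set W) :
    set (V \ox W) :=
  span [set x | exists v w, [/\ P v, Q w & x = v \ot w]].

Section RightCoidealSubalgebras.
Variables (k : fieldType) (H : hopfAlgType k).

Definition right_coideal (A : {pred H}) : Prop :=
  forall a, a \in A -> tens_sub [set` A] setT (comul a).

Record rcoideal_subalg := RCoidealSubalg {
  rcs_pred :> {pred H};
  rcs_subalg : subalg_closed rcs_pred;
  rcs_coideal : right_coideal rcs_pred
}.

Definition left_ideal (I : {pred H}) : Prop :=
  0 \in I /\ forall a, {in I &, forall x y, a * x + y \in I}.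

Definition coideal (I : {pred H}) : Prop :=
  forall x, x \in I ->
    [set y + z | y in tens_sub [set` I] setT & z in tens_sub setT [set` I]] (comul x)
    /\ counit x = 0.

(* A left H-module factor coalgebra H / I is encoded by its kernel I; the
   coalgebra itself is [fc_type] below. *)
Record factor_coalg := FactorCoalg {
  fc_ker :> {pred H};
  fc_left_ideal : left_ideal fc_ker;
  fc_coideal : coideal fc_ker
}.

Lemma rcs_eq (A B : rcoideal_subalg) : rcs_pred A =i rcs_pred B -> A = B.
Proof.
case: A B => [A Aa Ac] [B Ba Bc] /= AB; have {}AB : A = B by exact/funext.
by subst B; congr RCoidealSubalg; exact: Prop_irrelevance.
Qed.

Lemma fc_eq (I J : factor_coalg) : fc_ker I =i fc_ker J -> I = J.
Proof.
case: I J => [I Ia Ic] [J Ja Jc] /= IJ; have {}IJ : I = J by exact/funext.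
by subst J; congr FactorCoalg; exact: Prop_irrelevance.
Qed.

End RightCoidealSubalgebras.

Definition as_left_module (k : fieldType) (H : hopfAlgType k)
  (A : rcoideal_subalg H) : Type := H.
Definition as_right_module (k : fieldType) (H : hopfAlgType k)
  (A : rcoideal_subalg H) : Type := H.

Section SubalgebraModules.
Variables (k : fieldType) (H : hopfAlgType k) (A : rcoideal_subalg H).
Local Notation as_left_module := (@as_left_module k H A).
Local Notation as_right_module := (@as_right_module k H A).

HB.instance Definition _ := GRing.isSubalgClosed.Build k H (rcs_pred A)
  (GRing.subalg_closed_semi (rcs_subalg A)).

Definition rcs_type : Type := {a : H | a \in rcs_pred A}.
HB.instance Definition _ := SubChoice.on rcs_type.
HB.instance Definition _ := [SubChoice_isSubAlgebra of rcs_type by <:].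

HB.instance Definition _ := GRing.Zmodule.on as_left_module.
HB.instance Definition _ := GRing.Zmodule.on as_right_module.

Definition left_act (a : rcs_type) (h : as_left_module) : as_left_module :=
  (val a : H) * (h : H).
Definition right_act (a : rcs_type^c) (h : as_right_module) : as_right_module :=
  (h : H) * (val (a : rcs_type) : H).

Lemma left_actA a b h : left_act a (left_act b h) = left_act (a * b) h.
Proof. by rewrite /left_act rmorphM mulrA. Qed.
Lemma left_act1 : left_id 1 left_act.
Proof. by move=> h; rewrite /left_act rmorph1 mul1r. Qed.
Lemma left_actDr : right_distributive left_act +%R.
Proof. by move=> a x y; rewrite /left_act mulrDr. Qed.
Lemma left_actDl h : {morph left_act^~ h : a b / a + b}.
Proof. by move=> a b; rewrite /left_act rmorphD mulrDl. Qed.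
HB.instance Definition _ := GRing.Zmodule_isLmodule.Build rcs_type as_left_module
  left_actA left_act1 left_actDr left_actDl.

Lemma right_actA a b h : right_act a (right_act b h) = right_act (a * b) h.
Proof. by rewrite /right_act [val (a * b)]rmorphM mulrA. Qed.
Lemma right_act1 : left_id 1 right_act.
Proof. by move=> h; rewrite /right_act [val 1]rmorph1 mulr1. Qed.
Lemma right_actDr : right_distributive right_act +%R.
Proof. by move=> a x y; rewrite /right_act mulrDl. Qed.
Lemma right_actDl h : {morph right_act^~ h : a b / a + b}.
Proof. by move=> a b; rewrite /right_act [val (a + b)]rmorphD mulrDr. Qed.
HB.instance Definition _ := GRing.Zmodule_isLmodule.Build rcs_type^c as_right_module
  right_actA right_act1 right_actDr right_actDl.

Definition left_flat : Prop := flat_left_module as_left_module.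
Definition right_flat : Prop := flat_right_module as_right_module.

Definition to_btens (x y : H) : btens as_right_module as_left_module :=
  bptens (x : as_right_module) (y : as_left_module).

Definition dominion : set H := [set h | to_btens h 1 = to_btens 1 h].

Definition dominion_subalgebra : Prop := dominion = [set` rcs_pred A].

End SubalgebraModules.

Section FactorCoalgebra.
Variables (k : fieldType) (H : hopfAlgType k) (C : factor_coalg H).

Definition fc_type : Type := qmod [set` fc_ker C].
HB.instance Definition _ := GRing.Lmodule.on fc_type.

Definition fc_pi : H -> fc_type := qpi [set` fc_ker C].
HB.instance Definition _ := GRing.Linear.on fc_pi.

Lemma fc_pi_eq0 x : x \in fc_ker C -> fc_pi x = 0.
Proof.
move=> Cx; rewrite -[RHS](linear0 fc_pi); apply/qpiP; rewrite subr0.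
exact: span_sub.
Qed.

Lemma fc_span : span [set` fc_ker C] = [set` fc_ker C].
Proof.
have [C0 CD] := fc_left_ideal C; apply: span_id => // a u v Cu Cv.
by rewrite /= -[u]mul1r scalerAl; exact: CD.
Qed.

Lemma fc_pi_eq x y : fc_pi x = fc_pi y <-> x - y \in fc_ker C.
Proof. by rewrite /fc_pi qpiP fc_span. Qed.

Lemma fc_pi_surj (c : fc_type) : exists h, c = fc_pi h.
Proof. by exists (qrepr c); rewrite /fc_pi qreprK. Qed.

Definition fc_comul : fc_type -> fc_type \ox fc_type :=
  qlift (tmap fc_pi fc_pi \o comul).
Definition fc_counit : fc_type -> k^o := qlift counit.

Lemma fc_comul_ker s : [set` fc_ker C] s -> (tmap fc_pi fc_pi \o comul) s = 0.
Proof.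
move=> Cs; have [[y Iy [z Iz yz]] _] := fc_coideal Cs.
rewrite /= -yz linearD /= (span_lift0 _ Iy) ?(span_lift0 _ Iz) ?addr0 //.
- by move=> _ [v [w [_ Cw ->]]]; rewrite /= tmapE /= (fc_pi_eq0 Cw) linear0.
- by move=> _ [v [w [Cv _ ->]]]; rewrite /= tmapE /= (fc_pi_eq0 Cv) ptens0l.
Qed.

Lemma fc_counit_ker s : [set` fc_ker C] s -> (counit : H -> k^o) s = 0.
Proof. by move=> Cs; have [_ ->] := fc_coideal Cs. Qed.

Lemma fc_comulE h : fc_comul (fc_pi h) = tmap fc_pi fc_pi (comul h).
Proof. exact: (qliftE fc_comul_ker). Qed.
Lemma fc_counitE h : fc_counit (fc_pi h) = counit h.
Proof. exact: (qliftE fc_counit_ker). Qed.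

Lemma fc_comul_is_linear : linear fc_comul.
Proof. exact: (qlift_is_linear fc_comul_ker). Qed.
HB.instance Definition _ := GRing.isLinear.Build k fc_type (fc_type \ox fc_type)
  *:%R fc_comul fc_comul_is_linear.
Lemma fc_counit_is_linear : linear fc_counit.
Proof. exact: (qlift_is_linear fc_counit_ker). Qed.
HB.instance Definition _ := GRing.isLinear.Build k fc_type k^o
  *:%R fc_counit fc_counit_is_linear.

Lemma fc_comulA c :
  tassoc (tmap fc_comul idfun (fc_comul c)) = tmap idfun fc_comul (fc_comul c).
Proof.
have [h ->] := fc_pi_surj c; rewrite fc_comulE.
transitivity (tmap fc_pi (tmap fc_pi fc_pi) (tassoc (tmap comul idfun (comul h)))).
  rewrite -tassoc_nat; congr tassoc; move: (comul h).
  apply: (tens_ext (f := _ \o _) (g := _ \o _)) => v w /=.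
  by rewrite !tmapE /= fc_comulE.
rewrite comulA; move: (comul h).
apply: (tens_ext (f := _ \o _) (g := _ \o _)) => v w /=.
by rewrite !tmapE /= fc_comulE.
Qed.

Lemma fc_counitl c : tunitl (tmap fc_counit idfun (fc_comul c)) = c.
Proof.
have [h ->] := fc_pi_surj c; rewrite fc_comulE -[in RHS](counitl h).
move: (comul h); apply: (tens_ext (f := _ \o (_ \o _)) (g := _ \o (_ \o _))) => v w /=.
by rewrite !tmapE /= !tunitlE fc_counitE linearZ.
Qed.

Lemma fc_counitr c : tunitr (tmap idfun fc_counit (fc_comul c)) = c.
Proof.
have [h ->] := fc_pi_surj c; rewrite fc_comulE -[in RHS](counitr h).
move: (comul h); apply: (tens_ext (f := _ \o (_ \o _)) (g := _ \o (_ \o _))) => v w /=.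
by rewrite !tmapE /= !tunitrE fc_counitE linearZ.
Qed.

HB.instance Definition _ :=
  isCoalgebra.Build k fc_type fc_comulA fc_counitl fc_counitr.

End FactorCoalgebra.

Section TensorKernel.
Variable k : fieldType.

Lemma span_functional (W : lmodType k) (U : set W) (w : W) : ~ span U w ->
  exists2 phi : {linear W -> k^o}, phi w = 1 & forall u, U u -> phi u = 0.
Proof.
move=> Uw.
have [F FP Ftot|A [PA Amax]] := @Zorn_bigcup W (fun X => ~ span (X `|` U) w).
  have chain v : span ((\bigcup_(X in F) X) `|` U) v ->
      span U v \/ exists2 X, F X & span (X `|` U) v.
    elim=> [|a u x [[Y FY Yu]|Uu] _ [Ux|[X FX Xx]]].
    - by left; exact: span0.
    - right; exists Y => //; apply: spanD; first by left; exact: Yu.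
      by apply: span_mono Ux => y Uy; apply: span_sub; right.
    - have [XY|YX] := Ftot _ _ FX FY.
        right; exists Y => //; apply: spanD; first by left.
        by apply: span_mono Xx => y [/XY|] ?; apply: span_sub; [left|right].
      by right; exists X => //; apply: spanD => //; left; exact: YX.
    - by left; exact: spanD.
    - by right; exists X => //; apply: spanD => //; right.
  by move=> /chain[//|[X FX]]; exact: FP.
set M := span (A `|` U).
have M0 : M 0 by exact: span0.
have MD a u v : M u -> M v -> M (a *: u + v) by exact: span_linear.
have ex v : exists c : k, M (v - c *: w).
  have [Mv|Mv] := pselect (M v); first by exists 0; rewrite scale0r subr0.
  have : ~ ~ span ((A `|` [set v]) `|` U) w.
    apply: Amax; split; first by move=> x; left.
    by move=> AvA; apply: Mv; apply: span_sub; left; apply: AvA; right.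
  move=> /contrapT wAv.
  have [c Mc] : exists c : k, M (w - c *: v).
    elim: wAv => [|a u x Su _ [c Mc]]; first by exists 0; rewrite scale0r subr0.
    case: Su => [[Au|->]|Uu].
    - exists c; rewrite -addrA; apply: MD => //; apply: span_sub; by left.
    - by exists (a + c); rewrite scalerDl opprD addrACA subrr add0r.
    - exists c; rewrite -addrA; apply: MD => //; apply: span_sub; by right.
  have c0 : c != 0 by apply/eqP => c0; apply: PA; rewrite c0 scale0r subr0 in Mc.
  exists c^-1; have := MD (- c^-1) _ _ Mc M0.
  by rewrite addr0 scalerBr scalerA mulNr mulVf// scaleN1r opprK scaleNr addrC.
have [phi phiP] : exists phi : W -> k^o, forall v, M (v - (phi v : k) *: w).
  by have [phi phiP] := choice ex; exists phi.
have uniq v (c : k) : M (v - c *: w) -> phi v = c.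
  move=> Mc; apply/eqP/negPn/negP => neq; apply: PA.
  have d0 : c - phi v != 0 by rewrite subr_eq0 eq_sym.
  have := MD (c - phi v)^-1 _ _ (MD (-1) _ _ Mc (phiP v)) M0.
  by rewrite addr0 scaleN1r opprB addrA subrK -scalerBl scalerA mulVf // scale1r.
have phi_lin : linear phi.
  move=> a u v; apply: uniq; rewrite scalerDl -scalerA.
  rewrite opprD addrACA -scalerBr; exact: MD.
pose phiL := GRing.isLinear.Build k W k^o *:%R phi phi_lin.
pose phi' : {linear W -> k^o} := HB.pack phi phiL.
exists phi'; first by apply: uniq; rewrite scale1r subrr.
by move=> u Uu; apply: uniq; rewrite scale0r subr0; apply: span_sub; right.
Qed.

Section Kernel.
Variables (V V' W : lmodType k) (F : {linear V -> V'}).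

Local Notation sumt s := (\sum_(p <- s) p.1 \ot p.2).

Lemma tens_sum (x : V \ox W) : exists s : seq (V * W), x = sumt s.
Proof.
elim/tens_ind: x => [|a x y [s ->] [t ->]|v w].
- by exists [::]; rewrite big_nil.
- exists ([seq (a *: p.1, p.2) | p <- s] ++ t); rewrite big_cat big_map /=.
  by rewrite scaler_sumr; congr (_ + _); apply: eq_bigr => p _; rewrite ptensZl.
- by exists [:: (v, w)]; rewrite big_seq1.
Qed.

Lemma tens_merge1 (v : V) (w : W) (s : seq (V * W)) : w \in unzip2 s ->
  exists2 t : seq (V * W), unzip2 t = unzip2 s & v \ot w + sumt s = sumt t.
Proof.
elim: s => //= -[v' w'] s IH; rewrite inE => /orP[/eqP ->|/IH[t ts e]] /=.
  exists ((v + v', w') :: s) => //; rewrite !big_cons addrA /=.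
  by rewrite -[v in RHS]scale1r ptensDl scale1r.
exists ((v', w') :: t); first by rewrite /= ts.
by rewrite !big_cons addrCA e.
Qed.

Lemma tens_merge (w : W) (s : seq (V * W)) : span [set` unzip2 s] w ->
  forall v : V,
  exists2 t : seq (V * W), unzip2 t = unzip2 s & v \ot w + sumt s = sumt t.
Proof.
elim=> [|a u x us _ IH] v; first by exists s; rewrite // linear0 add0r.
have [t ts e] := IH v.
have [|t' t't e'] := @tens_merge1 (a *: v) u t; first by rewrite ts.
exists t'; first by rewrite t't.
by rewrite -e' -e ptensDr ptensZl addrA.
Qed.

Lemma tens_ker (x : V \ox W) : tmap F idfun x = 0 ->
  tens_sub [set v | F v = 0] setT x.
Proof.
have [s ->] := tens_sum x; have [n] := ubnP (size s).
elim: n s => // n IH [|[v w] s] /=; first by rewrite big_nil => _ _; exact: span0.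
rewrite ltnS => sn.
have [us|nus] := pselect (span [set` unzip2 s] w).
  rewrite big_cons /=; have [t ts ->] := tens_merge us v.
  by apply: IH; rewrite -(size_map snd) -/unzip2 ts size_map.
have [phi phiw phi0] := span_functional nus.
rewrite big_cons linearD /= tmapE /= => Fx.
have Fs (t : seq (V * W)) : {subset t <= s} ->
    tunitr (tmap idfun phi (tmap F idfun (sumt t))) = 0.
  elim: t => [|p t IHt] ts; first by rewrite big_nil !linear0.
  rewrite big_cons !linearD /= IHt ?addr0; last first.
    by move=> q qt; apply: ts; rewrite inE qt orbT.
  rewrite !tmapE /= tunitrE phi0 ?scale0r //=.
  by apply/map_f/ts; rewrite mem_head.
have Fv : F v = 0.
  have := congr1 (fun y => tunitr (tmap idfun phi y)) Fx.
  by rewrite /= !linearD !linear0 /= Fs // tmapE tunitrE /= phiw scale1r addr0.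
rewrite -[v \ot w]scale1r; apply: spanD; first by exists v, w.
by apply: IH => //; rewrite -[RHS]Fx Fv ptens0l add0r.
Qed.
End Kernel.

End TensorKernel.

Section Assignments.
Variables (k : fieldType) (H : hopfAlgType k).

Section ToCoalgebra.
Variable A : rcoideal_subalg H.

Definition aug_gen : set H :=
  [set x | exists h a, [/\ a \in rcs_pred A, counit a = 0 & x = h * a]].

(* the left ideal H A^+ *)
Definition aug_ideal : {pred H} := fun x => `[< span aug_gen x >].

Lemma aug_ideal_left_ideal : left_ideal aug_ideal.
Proof.
split=> [|h x y /asboolP Ix /asboolP Iy]; apply/asboolP; first exact: span0.
rewrite -[h * x]scale1r; apply: span_linear => //.
elim: Ix => [|c u v [g [a [Aa a0 ->]]] _ IH]; first by rewrite mulr0; exact: span0.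
rewrite mulrDr -scalerAr; apply: spanD => //.
by exists (h * g), a; rewrite mulrA.
Qed.

Lemma comul_aug a : a \in rcs_pred A -> exists2 t,
  tens_sub [set b | b \in rcs_pred A /\ counit b = 0] setT t &
  comul a = t + 1 \ot a.
Proof.
have [A1 AD _] := rcs_subalg A; move=> /rcs_coideal At.
exists (comul a - 1 \ot a); last by rewrite subrK.
rewrite -[X in _ \ot X]counitl; move: (comul a) At.
apply: (@span_ind_linear _ _ _ (fun t : H \ox H => tens_sub _ setT
   (t - 1 \ot (tunitl (tmap counit idfun t))))).
- by rewrite !linear0 addr0; exact: span0.
- move=> c u v uP vP; rewrite !linearP addrACA -scalerDr.
  exact: span_linear.
- move=> _ [b [h [Ab _ ->]]]; rewrite tmapE tunitlE linearZ /= -ptensZl -ptensBl.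
  apply: span_sub; exists (b - (counit b : k)%:A), h; split=> //; split.
    by rewrite addrC -scaleNr; exact: AD.
  by rewrite linearB linearZ /= counit1 -[_ *: _]/(_ * _) mulr1 subrr.
Qed.

Lemma aug_ideal_coideal : coideal aug_ideal.
Proof.
move=> x /asboolP; elim=> [|c u v [h [a [Aa a0 ->]]] _ [[y Iy [z Iz yz]] v0]].
  split; last by rewrite linear0.
  by exists 0; [exact: span0|exists 0; [exact: span0|rewrite linear0 addr0]].
split; last by rewrite linearP /= counitM a0 mulr0 scaler0 add0r.
have [t tP at1] := comul_aug Aa.
exists (c *: tmul (comul h) t + y).
  apply: span_linear Iy; move: (comul h); apply: tens_ind => [|b p q Ip Iq|p q].
  - by rewrite (tmul_linear0l t); exact: span0.
  - by rewrite tmul_linearl; exact: span_linear.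
  - move: t tP {at1}; apply: (@span_ind_linear _ _ _ (fun t => tens_sub _ setT _)).
    + by rewrite tmul_ptensl linear0; exact: span0.
    + by move=> b r s Ir Is; rewrite tmul_linearr; exact: span_linear.
    + move=> _ [b [g [[Ab b0] _ ->]]]; rewrite tmulE; apply: span_sub.
      exists (p * b), (q * g); split=> //; apply/asboolP/span_sub.
      by exists p, b.
exists (c *: tmul (comul h) (1 \ot a) + z).
  apply: span_linear Iz; move: (comul h); apply: tens_ind => [|b p q Ip Iq|p q].
  - by rewrite (tmul_linear0l (1 \ot a)); exact: span0.
  - by rewrite tmul_linearl; exact: span_linear.
  - rewrite tmulE; apply: span_sub; exists (p * 1), (q * a); split=> //.
    by apply/asboolP/span_sub; exists q, a.
rewrite linearP /= comulM at1 -yz addrACA -scalerDr.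
by rewrite -[t in RHS]scale1r tmul_linearr scale1r.
Qed.

Definition quotient_coalg : factor_coalg H :=
  FactorCoalg aug_ideal_left_ideal aug_ideal_coideal.

End ToCoalgebra.

Section ToSubalgebra.
Variable C : factor_coalg H.
Local Notation pi := (@fc_pi k H C).

(* ^{co C} H *)
Definition coinvariant : {pred H} :=
  fun h => tmap pi idfun (comul h) == pi 1 \ot h.

Definition fc_lmul (a : H) : fc_type C -> fc_type C :=
  qlift ((pi : {linear H -> fc_type C}) \o lmul a).

Lemma fc_lmul_ker a s : [set` fc_ker C] s ->
  ((pi : {linear H -> fc_type C}) \o lmul a) s = 0.
Proof.
have [C0 CD] := fc_left_ideal C => Cs; apply: fc_pi_eq0.
by rewrite /= lmulE -[_ * _]addr0; exact: CD.
Qed.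
Lemma fc_lmulE a h : fc_lmul a (pi h) = pi (a * h).
Proof. exact: (qliftE (fc_lmul_ker a)). Qed.
Lemma fc_lmul_is_linear a : linear (fc_lmul a).
Proof. exact: (qlift_is_linear (fc_lmul_ker a)). Qed.
HB.instance Definition _ a := GRing.isLinear.Build k (fc_type C) (fc_type C)
  *:%R (fc_lmul a) (fc_lmul_is_linear a).

Lemma fc_tmul x y y' : tmap pi idfun y = tmap pi idfun y' ->
  tmap pi idfun (tmul x y) = tmap pi idfun (tmul x y').
Proof.
move=> yy'.
have key a b t : tmap pi idfun (tmap (lmul a) (lmul b) t) =
    tmap (fc_lmul a) (lmul b) (tmap pi idfun t).
  move: t; apply: (tens_ext (f := _ \o _) (g := _ \o _)) => v w /=.
  by rewrite !tmapE /= fc_lmulE.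
elim/tens_ind: x => [|a u v uP vP|a b].
- by rewrite !tmul_linear0l.
- by rewrite !tmul_linearl !linearP /= uP vP.
- by rewrite !tmul_ptensl !key yy'.
Qed.

Lemma coinvariant_subalg : subalg_closed coinvariant.
Proof.
split=> [|c u v /eqP cu /eqP cv|u v /eqP cu /eqP cv]; apply/eqP.
- by rewrite comul1 tmapE.
- by rewrite !linearP /= cu cv.
rewrite comulM (@fc_tmul _ _ (1 \ot v)); last by rewrite cv tmapE.
transitivity (tmap idfun (rmul v) (tmap pi idfun (comul u))); last first.
  by rewrite cu tmapE.
move: (comul u) => t; elim/tens_ind: t => [|a x y xP yP|a b].
- by rewrite tmul_linear0l !linear0.
- by rewrite tmul_linearl !linearP /= xP yP.
- by rewrite tmulE !tmapE /= mulr1.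
Qed.

Lemma coinvariant_coideal : right_coideal coinvariant.
Proof.
move=> h /eqP ch.
pose F : {linear H -> fc_type C \ox H} :=
  (tmap pi idfun \o comul) \- ptens (pi 1).
have -> : [set` coinvariant] = [set v | F v = 0].
  apply/seteqP; split=> v /=; first by move=> /eqP ->; rewrite subrr.
  by move/eqP; rewrite subr_eq0.
apply: tens_ker.
have -> : tmap F idfun (comul h) =
    tmap (tmap pi idfun \o comul) idfun (comul h) - tmap (ptens (pi 1)) idfun (comul h).
  move: (comul h).
  apply: (tens_ext (g := (_ : {linear _ -> _}) \- (_ : {linear _ -> _}))) => v w /=.
  by rewrite !tmapE /= ptensBl.
apply/eqP; rewrite subr_eq0; apply/eqP/(can_inj (@tassocK _ _ _ _)).
transitivity (pi 1 \ot comul h).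
  transitivity (tmap pi idfun (tassoc (tmap comul idfun (comul h)))).
    move: (comul h) => t;
    have -> : tmap (tmap pi idfun \o comul) idfun t =
        tmap (tmap pi idfun) idfun (tmap comul idfun t).
      move: t; apply: (tens_ext (g := _ \o _)) => v w /=.
      by rewrite !tmapE.
    rewrite tassoc_nat; move: (tassoc _).
    by apply: tens_ext => v w; rewrite /= !tmapE /= tmap_id.
  rewrite comulA.
  transitivity (tmap idfun comul (tmap pi idfun (comul h))).
    move: (comul h); apply: (tens_ext (f := _ \o _) (g := _ \o _)) => v w /=.
    by rewrite !tmapE.
  by rewrite ch tmapE.
move: (comul h); apply: (tens_ext (g := _ \o _)) => v w /=.
by rewrite tmapE /= tassocE.
Qed.

Definition coinvariants : rcoideal_subalg H :=
  RCoidealSubalg coinvariant_subalg coinvariant_coideal.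

End ToSubalgebra.

End Assignments.

Section EmbeddingProperty.
Variables (k : fieldType) (H : hopfAlgType k) (C : factor_coalg H).
Local Notation pi := (@fc_pi k H C).

(* Every finite-dimensional C-comodule V is a C-subcomodule of some H-comodule
   W, regarded as a C-comodule via pi. *)
Definition right_comodules_embed : Prop :=
  forall (V : vectType k) (rho : {linear V -> V \ox fc_type C}),
    right_comodule rho ->
    exists (W : lmodType k) (sigma : {linear W -> W \ox H}) (f : {linear V -> W}),
      [/\ right_comodule sigma, injective f &
          forall v, tmap idfun pi (sigma (f v)) = tmap f idfun (rho v)].

Definition left_comodules_embed : Prop :=
  forall (V : vectType k) (rho : {linear V -> fc_type C \ox V}),
    left_comodule rho ->
    exists (W : lmodType k) (sigma : {linear W -> H \ox W}) (f : {linear V -> W}),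
      [/\ left_comodule sigma, injective f &
          forall v, tmap pi idfun (sigma (f v)) = tmap idfun f (rho v)].

End EmbeddingProperty.

Definition mutually_inverse_bijections (T U : Type) (X : set T) (Y : set U)
    (f : T -> U) (g : U -> T) : Prop :=
  [/\ set_bij X Y f, set_bij Y X g,
      {in X, cancel f g} & {in Y, cancel g f}].

(* Main.v *)
(** Write [T] for the inverse of the antipode [S], and [C] for [H/HA^+].

    Since [x (x) y |-> pi(x_1) (x) x_2 y] identifies [H (x)_A H] with [C (x) H]
    (inverse: [pi(x) (x) y |-> x_1 (x) S(x_2) y]), the dominion of [A] is the
    algebra of coinvariants of [C].  So only three things remain: for [C] with
    the embedding property, [ker pi = H A^+] and [H] is flat over
    [A = coinvariants C]; and flatness of [H] over a dominion [A] yields the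
    embedding property.

    A finite-dimensional comodule [V] is a matrix [c] over [C] with
    [comul c_ij = sum_l c_il (x) c_lj], and it embeds in an [H]-comodule iff the
    cotensor product of [V] and [H] maps onto [V] under [id (x) eps].  If this
    always holds, apply it to a finite-dimensional subcomodule of [C] (resp. to
    one containing a given relation in [H^s]): the resulting elements of the
    cotensor product of [H] and [H] over [C], which is [H (x) A], write an
    element of [ker pi] as an element of [H A^+], and a relation over [A] as a
    consequence of relations with coefficients in [A]; the latter is the
    equational criterion of flatness.

    Conversely the cotensor product of [V] and [H] is the kernel of an
    [A]-linear map [V (x) H -> V (x) C (x) H].  By flatness, tensoring with [H]
    over [A] commutes with this kernel, and the element
    [v_0 (x) h_1 (x)_A S(h_2)] lies in the tensored kernel; applying the counit
    produces the lifting.  [T] exchanges the two sides. *)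

(* Tensor products are quotients of free modules, so no calculation starts from a basis. Elements
   are written as chosen finite sums, whose values are independent of the choice only for maps
   linear in each leg; dual functionals stand for linear independence.

   The counit condition on liftings is what undoes the antipode. If sum_i u_i (x) v_i lies in the
   cotensor product, then sum_i S(u_i2) v_i (x) u_i1 has coinvariant first legs, and multiplying its
   legs in reverse order gives sum_i eps(u_i) v_i. Prescribing the scalars eps(u_i) thus recovers
   any combination of the v_i.

   Flatness is used in dual form for the converse. A vector that is not attained is separated from
   the attained ones by a functional chi; a k-valued balanced form built from chi and eps kills the
   kernel, and flatness forces it to vanish on the test element, where its value is chi(v).

   H A^+ is only a left ideal, so multiplication by A on the left does not pass through pi. The
   inverse antipode repairs this at two points: the left equational criterion, and the passage from
   right flatness to liftings. *)
Require Import Defs.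
From mathcomp.multinomials Require Import freeg.
From HB Require Import structures.
From mathcomp Require Import all_boot all_algebra.
From mathcomp Require Import boolp classical_sets functions.


Set Implicit Arguments.
Unset Strict Implicit.
Unset Printing Implicit Defensive.

Import GRing.Theory.

Local Open Scope classical_set_scope.
Local Open Scope ring_scope.

Local Notation span := Defs.span.

(** * Linear functions and finite sums of pure tensors *)

Section Lin.
Variable k : fieldType.

(* A constant head for [lin_tac] to match; [linear] is only a notation. *)
Definition lin (U V : lmodType k) (f : U -> V) : Prop := linear f.

Lemma lin_pack (U V : lmodType k) (f : U -> V) :
  lin f -> exists g : {linear U -> V}, forall x, g x = f x.
Proof.
move=> fl; pose fL := GRing.isLinear.Build k U V *:%R f fl.
by exists (HB.pack f fL : {linear U -> V}).
Qed.

Definition linear_of (U V : lmodType k) (f : U -> V) (fl : lin f) : {linear U -> V} :=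
  sval (cid (lin_pack fl)).

Lemma linear_ofE (U V : lmodType k) (f : U -> V) (fl : lin f) x : linear_of fl x = f x.
Proof. exact: svalP (cid (lin_pack fl)) x. Qed.

Lemma lin_sumE (U V : lmodType k) (f : U -> V) (I : Type) (r : seq I) (F : I -> U) :
  lin f -> f (\sum_(i <- r) F i) = \sum_(i <- r) f (F i).
Proof.
by move=> fl; rewrite -(linear_ofE fl) linear_sum; apply: eq_bigr => i _; rewrite linear_ofE.
Qed.

Lemma lin0E (U V : lmodType k) (f : U -> V) : lin f -> f 0 = 0.
Proof. by move=> fl; rewrite -(linear_ofE fl) linear0. Qed.

Lemma linZE (U V : lmodType k) (f : U -> V) a x : lin f -> f (a *: x) = a *: f x.
Proof. by move=> fl; rewrite -!(linear_ofE fl) linearZ. Qed.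

Lemma linBE (U V : lmodType k) (f : U -> V) x y : lin f -> f (x - y) = f x - f y.
Proof. by move=> fl; rewrite -!(linear_ofE fl) linearB. Qed.

Lemma lin_linear (U V : lmodType k) (f : {linear U -> V}) : lin f.
Proof. exact: linearP. Qed.

Lemma lin_id (U : lmodType k) : lin (fun x : U => x).
Proof. by []. Qed.

Lemma lin_comp (U V W : lmodType k) (g : V -> W) (f : U -> V) :
  lin g -> lin f -> lin (fun x => g (f x)).
Proof. by move=> gl fl a u v; rewrite fl gl. Qed.

Lemma lin_scale (U V : lmodType k) (c : k) (f : U -> V) :
  lin f -> lin (fun x => c *: f x).
Proof. by move=> fl a u v; rewrite fl scalerDr !scalerA mulrC. Qed.

Lemma lin_scalel (U V : lmodType k) (f : U -> k^o) (w : V) :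
  lin f -> lin (fun x => (f x : k) *: w).
Proof. by move=> fl a u v; rewrite fl scalerDl scalerA. Qed.

Lemma lin_add (U V : lmodType k) (f g : U -> V) :
  lin f -> lin g -> lin (fun x => f x + g x).
Proof. by move=> fl gl a u v; rewrite fl gl scalerDr addrACA. Qed.

Lemma lin_opp (U V : lmodType k) (f : U -> V) : lin f -> lin (fun x => - f x).
Proof. by move=> fl a u v; rewrite fl opprD scalerN. Qed.

Lemma lin_sum (U V : lmodType k) (I : Type) (r : seq I) (F : I -> U -> V) :
  (forall i, lin (F i)) -> lin (fun x => \sum_(i <- r) F i x).
Proof.
by move=> Fl a u v; rewrite scaler_sumr -big_split; apply: eq_bigr => i _; exact: Fl.
Qed.

Lemma lin_mull (U : lmodType k) (A : algType k) (a : A) (f : U -> A) :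
  lin f -> lin (fun x => a * f x).
Proof. by move=> fl c u v; rewrite fl mulrDr scalerAr. Qed.

Lemma lin_mulr (U : lmodType k) (A : algType k) (a : A) (f : U -> A) :
  lin f -> lin (fun x => f x * a).
Proof. by move=> fl c u v; rewrite fl mulrDl scalerAl. Qed.

Lemma lin_ptensl (U V W : lmodType k) (w : W) (f : U -> V) :
  lin f -> lin (fun x => f x \ot w).
Proof. by move=> fl c u v; rewrite fl ptensDl. Qed.

Lemma lin_ptensr (U V W : lmodType k) (w : W) (f : U -> V) :
  lin f -> lin (fun x => w \ot f x).
Proof. by move=> fl c u v; rewrite fl ptensDr. Qed.

Lemma bilinP (U V W : lmodType k) (f : U -> V -> W) :
  (forall v, lin (f^~ v)) -> (forall u, lin (f u)) -> bilin f.
Proof. by move=> fl fr; split=> a u v w; [exact: fl|exact: fr]. Qed.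

Definition tseq (V W : lmodType k) (t : V \ox W) : seq (V * W) := sval (cid (tens_sum t)).

Lemma tseqE (V W : lmodType k) (t : V \ox W) : t = \sum_(p <- tseq t) p.1 \ot p.2.
Proof. exact: svalP (cid (tens_sum t)). Qed.

(** A Sweedler sum over [t]. Its value depends on the chosen decomposition unless [F] is linear in
    each argument, when [tsum_lift] identifies it with the induced map. Linearity is therefore
    demanded only where the tensor itself is rewritten. *)
Definition tsum (V W U : lmodType k) (t : V \ox W) (F : V -> W -> U) : U :=
  \sum_(p <- tseq t) F p.1 p.2.

Lemma tsum_lift (V W U : lmodType k) (F : V -> W -> U) (t : V \ox W) :
  (forall w, lin (F^~ w)) -> (forall v, lin (F v)) -> tsum t F = tlift F t.
Proof.
move=> Fl Fr; have bF := bilinP Fl Fr.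
rewrite [in RHS](tseqE t) (lin_sumE _ _ (tlift_is_linear bF)).
by apply: eq_bigr => p _; rewrite /= tliftE.
Qed.

Lemma eq_tsum (V W U : lmodType k) (F G : V -> W -> U) (t : V \ox W) :
  (forall v w, F v w = G v w) -> tsum t F = tsum t G.
Proof. by move=> FG; apply: eq_bigr => p _; exact: FG. Qed.

Lemma tsumK (V W : lmodType k) (t : V \ox W) : tsum t (fun v w => v \ot w) = t.
Proof. by rewrite [RHS]tseqE. Qed.

Lemma lin_tsum (V W U X : lmodType k) (F : V -> W -> U) (f : X -> V \ox W) :
  (forall w, lin (F^~ w)) -> (forall v, lin (F v)) -> lin f ->
  lin (fun x => tsum (f x) F).
Proof.
move=> Fl Fr fl a u v; rewrite !tsum_lift // fl.
exact: (tlift_is_linear (bilinP Fl Fr)).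
Qed.

Lemma lin_tsumr (V W U X : lmodType k) (F : X -> V -> W -> U) (t : V \ox W) :
  (forall v w, lin (fun x => F x v w)) -> lin (fun x => tsum t (F x)).
Proof. by move=> Fl; apply: lin_sum. Qed.

Lemma tsum_ptens (V W U : lmodType k) (F : V -> W -> U) v w :
  (forall w, lin (F^~ w)) -> (forall v, lin (F v)) -> tsum (v \ot w) F = F v w.
Proof. by move=> Fl Fr; rewrite tsum_lift // tliftE //; exact: bilinP. Qed.

Lemma tsum_sum (V W U : lmodType k) (I : Type) (r : seq I) (t : I -> V \ox W)
    (F : V -> W -> U) : (forall w, lin (F^~ w)) -> (forall v, lin (F v)) ->
  tsum (\sum_(i <- r) t i) F = \sum_(i <- r) tsum (t i) F.
Proof. by move=> Fl Fr; exact: (lin_sumE _ _ (lin_tsum Fl Fr (@lin_id _))). Qed.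

Lemma tsum_tsum (V W V' W' U : lmodType k) (t : V \ox W) (G : V -> W -> V' \ox W')
    (F : V' -> W' -> U) : (forall w, lin (F^~ w)) -> (forall v, lin (F v)) ->
  tsum (tsum t G) F = tsum t (fun v w => tsum (G v w) F).
Proof. by move=> Fl Fr; rewrite tsum_sum. Qed.

Lemma lin_tsumE (V W U X : lmodType k) (f : U -> X) (F : V -> W -> U) (t : V \ox W) :
  lin f -> f (tsum t F) = tsum t (fun v w => f (F v w)).
Proof. by move=> fl; rewrite /tsum lin_sumE. Qed.

Lemma linear_tsum (V W U X : lmodType k) (f : {linear U -> X}) (F : V -> W -> U) (t : V \ox W) :
  f (tsum t F) = tsum t (fun v w => f (F v w)).
Proof. exact: (lin_tsumE _ _ (lin_linear f)). Qed.

Lemma tsum_exchange (V W V' W' U : lmodType k) (t : V \ox W) (t' : V' \ox W')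
    (F : V -> W -> V' -> W' -> U) :
  tsum t (fun v w => tsum t' (F v w)) = tsum t' (fun v' w' => tsum t (fun v w => F v w v' w')).
Proof. by rewrite /tsum exchange_big. Qed.

Lemma tmap_tsum (V W V' W' : lmodType k) (f : {linear V -> V'}) (g : {linear W -> W'})
    (t : V \ox W) : tmap f g t = tsum t (fun v w => f v \ot g w).
Proof. by rewrite {1}[t]tseqE linear_sum; apply: eq_bigr => p _; rewrite /= tmapE. Qed.

Lemma ptens_tsuml (V W X Y : lmodType k) (F : V -> W -> X) (t : V \ox W) (y : Y) :
  tsum t F \ot y = tsum t (fun v w => F v w \ot y).
Proof. exact: (lin_tsumE _ _ (lin_ptensl y (@lin_id X))). Qed.

Lemma ptens_tsumr (V W X Y : lmodType k) (F : V -> W -> X) (t : V \ox W) (y : Y) :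
  y \ot tsum t F = tsum t (fun v w => y \ot F v w).
Proof. exact: (lin_tsumE _ _ (lin_ptensr y (@lin_id X))). Qed.

Lemma tassoc_tsum (V W X : lmodType k) (t : V \ox W) (x : X) :
  tassoc (t \ot x) = tsum t (fun v w => v \ot (w \ot x)).
Proof.
rewrite -{1}[t]tsumK ptens_tsuml linear_tsum.
by apply: eq_tsum => v w; rewrite /= tassocE.
Qed.

Lemma lin_ext (V W U : lmodType k) (f g : V \ox W -> U) : lin f -> lin g ->
  (forall v w, f (v \ot w) = g (v \ot w)) -> f =1 g.
Proof. exact: tens_linext. Qed.

End Lin.

(** Linearity facts about particular maps are supplied as local hypotheses; this is the purpose of
    the many [have lp := lin_fc_pi C] in the proofs below. *)
Ltac lin_hyp := match goal with h : context [lin] |- _ => solve [apply: h] end.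

(* The value of a constant function; the binder name is chosen not to occur, so
   that [constr:] fails on a function that depends on its argument. *)
Ltac const_of f := lazymatch f with (fun lin_x => ?c) => constr:(c) end.

Ltac lin_app :=
  match goal with
  | |- lin (fun lin_x => ?g (@?f lin_x)) =>
      let g' := constr:(g) in
      first [lazymatch f with (fun x => x) => idtac end; change (lin g')
            | apply: (@lin_comp _ _ _ _ g' f)]
  | |- lin (fun lin_x => ?g (@?f lin_x) ?b) =>
      let g' := constr:(g) in let b' := constr:(b) in
      apply: (@lin_comp _ _ _ _ (fun z => g' z b') f)
  | |- lin (fun lin_x => ?g (@?f lin_x) ?b ?c) =>
      let g' := constr:(g) in let b' := constr:(b) in let c' := constr:(c) in
      apply: (@lin_comp _ _ _ _ (fun z => g' z b' c') f)
  end.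

Ltac lin_step := lazymatch goal with
  | |- forall _, _ => let x := fresh "x" in move=> x
  | |- lin (fun x => x) => exact: lin_id
  | |- lin (fun x => tsum (@?t x) _) =>
      first [let t' := const_of t in apply: lin_tsumr | apply: lin_tsum]
  | |- lin (fun x => @bigop.body _ _ _ _ _) => apply: lin_sum
  | |- lin (fun x => - @?f x) => apply: lin_opp
  | |- lin (fun x => @?f x + @?g x) => apply: lin_add
  | |- lin ( *%R ?a) => apply: (lin_mull a (@lin_id _ _))
  | |- lin (ptens ?a) => apply: (lin_ptensr a (@lin_id _ _))
  | |- lin (fun x => @?f x * @?g x) =>
      first [let g' := const_of g in apply: lin_mulr | apply: lin_mull]
  | |- lin (fun x => @?f x \ot @?g x) =>
      first [let g' := const_of g in apply: lin_ptensl | apply: lin_ptensr]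
  | |- lin (fun x => @?f x *: @?g x) =>
      first [let g' := const_of g in apply: lin_scalel | apply: lin_scale]
  | |- lin _ => first [exact: lin_linear | lin_hyp | lin_app]
  end.
Ltac lin_tac := solve [cbv beta; repeat (lin_step; cbv beta)].

Local Notation sw c := (tsum (comul c)).

(** * The coalgebra axioms for Sweedler sums *)

Section SweedlerSums.
Variables (k : fieldType) (C : coalgType k).
Implicit Types (c : C) (U : lmodType k).

Lemma sw_coassoc U (F : C -> C -> C -> U) c :
  (forall b d, lin (fun a => F a b d)) -> (forall a d, lin (fun b => F a b d)) ->
  (forall a b, lin (F a b)) ->
  sw c (fun a b => sw a (fun a1 a2 => F a1 a2 b)) = sw c (fun a b => sw b (F a)).
Proof.
move=> F1 F2 F3.
pose G (t : C \ox (C \ox C)) := tsum t (fun a s => tsum s (F a)).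
have Gl : lin G by rewrite /G; lin_tac.
have GE x t : G (x \ot t) = tsum t (F x) by rewrite /G tsum_ptens //; lin_tac.
have := congr1 G (comulA c); rewrite !tmap_tsum !linear_tsum.
rewrite !(lin_tsumE _ _ Gl) => E.
transitivity (sw c (fun a b => G (tassoc (comul a \ot b)))).
  apply: eq_tsum => a b; rewrite -[comul a in RHS]tsumK.
  rewrite (lin_tsumE _ _ (lin_ptensl b (@lin_id _ _))) linear_tsum.
  rewrite (lin_tsumE _ _ Gl); apply: eq_tsum => a1 a2.
  by rewrite /= tassocE GE tsum_ptens.
rewrite [LHS]E; apply: eq_tsum => a b; exact: GE.
Qed.

Lemma sw_counitl U (F : C -> U) c : lin F -> sw c (fun a b => (counit a : k) *: F b) = F c.
Proof.
move=> Fl; rewrite -[in RHS](counitl c) tmap_tsum !linear_tsum.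
by rewrite lin_tsumE //; apply: eq_tsum => a b; rewrite /= tunitlE linZE.
Qed.

Lemma sw_counitr U (F : C -> U) c : lin F -> sw c (fun a b => (counit b : k) *: F a) = F c.
Proof.
move=> Fl; rewrite -[in RHS](counitr c) tmap_tsum !linear_tsum.
by rewrite lin_tsumE //; apply: eq_tsum => a b; rewrite /= tunitrE linZE.
Qed.

End SweedlerSums.

(** * Hopf algebras in Sweedler notation *)

Section Hopf.
Variables (k : fieldType) (H : hopfAlgType k).
Implicit Types (x y h : H) (U : lmodType k).
Local Notation eps h := (counit h : k).
Local Notation S := (@antipode k H).

Lemma sw1 U (F : H -> H -> U) :
  (forall b, lin (F^~ b)) -> (forall a, lin (F a)) -> sw 1 F = F 1 1.
Proof. by move=> Fl Fr; rewrite comul1 tsum_ptens. Qed.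

Lemma tmul_tsum (s t : H \ox H) :
  tmul s t = tsum s (fun a b => tsum t (fun c d => (a * c) \ot (b * d))).
Proof.
rewrite -{1}[s]tsumK (lin_tsumE _ _ (@tmul_linearl _ _ t)); apply: eq_tsum => a b.
by rewrite tmul_ptensl tmap_tsum.
Qed.

Lemma swM U (F : H -> H -> U) x y :
  (forall b, lin (F^~ b)) -> (forall a, lin (F a)) ->
  sw (x * y) F = sw x (fun a b => sw y (fun c d => F (a * c) (b * d))).
Proof.
move=> Fl Fr; rewrite comulM tmul_tsum tsum_tsum //; apply: eq_tsum => a b.
by rewrite tsum_tsum //; apply: eq_tsum => c d; rewrite tsum_ptens.
Qed.

Lemma sw_antipodel U (F : H -> U) h : lin F -> sw h (fun a b => F (S a * b)) = eps h *: F 1.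
Proof.
move=> Fl; rewrite -(linZE _ _ Fl) -antipodel tmap_tsum linear_tsum.
by rewrite lin_tsumE //; apply: eq_tsum => a b; rewrite /= mulmapE.
Qed.

Lemma sw_antipoder U (F : H -> U) h : lin F -> sw h (fun a b => F (a * S b)) = eps h *: F 1.
Proof.
move=> Fl; rewrite -(linZE _ _ Fl) -antipoder tmap_tsum linear_tsum.
by rewrite lin_tsumE //; apply: eq_tsum => a b; rewrite /= mulmapE.
Qed.

Lemma antipode1 : S 1 = 1.
Proof.
have := @sw_antipodel H (fun a => a) 1 (@lin_id _ _).
by rewrite sw1 ?mulr1 ?counit1 ?scale1r //; lin_tac.
Qed.

Lemma counit_antipode h : counit (S h) = counit h.
Proof.
have := @sw_antipodel k^o counit h (lin_linear _).
rewrite counit1 /GRing.scale /= mulr1 => <-.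
rewrite -[LHS](sw_counitr (F := fun x => counit (S x))); last by lin_tac.
by apply: eq_tsum => a b; rewrite counitM mulrC.
Qed.

(** Uniqueness of convolution inverses: S(x_1 y_1) x_2 y_2 S(y_3) S(x_3) collapses to S(y) S(x) when
    its left part is cancelled, and to S(x y) when its right part is. *)
Lemma antipodeM x y : S (x * y) = S y * S x.
Proof.
transitivity (sw x (fun a b => sw y (fun c d =>
    sw (a * c) (fun u v => S u * v * (S d * S b))))); last first.
  transitivity (sw x (fun a b => sw y (fun c d => eps a *: (eps c *: (S d * S b : H))))).
    apply: eq_tsum => a b; apply: eq_tsum => c d.
    rewrite (sw_antipodel (F := fun z => z * (S d * S b))); last by lin_tac.
    by rewrite mul1r counitM scalerA.
  rewrite -[RHS](sw_counitl (F := fun x => S y * S x)); last by lin_tac.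
  apply: eq_tsum => a b; rewrite -(lin_tsumE _ _ (lin_scale _ (@lin_id _ _))).
  by rewrite (sw_counitl (F := fun y => S y * S b)); last by lin_tac.
transitivity (sw x (fun a b => sw y (fun c d => sw a (fun a1 a2 => sw c (fun c1 c2 =>
    S (a1 * c1) * (a2 * c2) * (S d * S b)))))); last first.
  apply: eq_tsum => a b; apply: eq_tsum => c d; rewrite swM //; lin_tac.
transitivity (sw x (fun a b => sw a (fun a1 a2 => sw y (fun c d => sw c (fun c1 c2 =>
    S (a1 * c1) * (a2 * c2) * (S d * S b)))))); last first.
  by apply: eq_tsum => a b; rewrite tsum_exchange.
rewrite sw_coassoc; try lin_tac.
transitivity (sw x (fun a b => S (a * y) * (eps b)%:A)).
  rewrite -[LHS](sw_counitr (F := fun x => S (x * y))); last by lin_tac.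
  by apply: eq_tsum => a b; rewrite -scalerAr mulr1.
apply: eq_tsum => a b; rewrite -(sw_antipoder (F := fun z => z)); last by lin_tac.
rewrite (lin_tsumE _ _ (lin_mull _ (@lin_id _ _))); apply: eq_tsum => b1 b2.
rewrite sw_coassoc; try lin_tac.
rewrite -{1}[y](sw_counitr (F := fun y => y)); last by lin_tac.
rewrite [X in S X](lin_tsumE _ _ (lin_mull a (@lin_id _ _))) linear_tsum.
rewrite (lin_tsumE _ _ (lin_mulr (b1 * S b2) (@lin_id _ _))); apply: eq_tsum => c d.
transitivity (S (a * c) * b1 * (eps d)%:A * S b2).
  by rewrite -[in RHS]scalerAr mulr1 -[in LHS]scalerAr linearZ /= -!scalerAl mulrA.
rewrite -(sw_antipoder (F := fun z => z)); last by lin_tac.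
rewrite (lin_tsumE _ _ (lin_mull _ (@lin_id _ _))) (lin_tsumE _ _ (lin_mulr _ (@lin_id _ _))).
by apply: eq_tsum => d1 d2; rewrite !mulrA.
Qed.

(** Both h |-> comul (S h) and h |-> S(h_2) (x) S(h_1) are convolution inverses of [comul]. The
    middle term is comul (S(h_1) h_2) (S(h_4) (x) S(h_3)); [G d u v] is [F] evaluated at (u (x) v)
    (S(d_2) (x) S(d_1)). *)
Lemma sw_antipode U (F : H -> H -> U) h :
  (forall b, lin (F^~ b)) -> (forall a, lin (F a)) ->
  sw (S h) F = sw h (fun a b => F (S b) (S a)).
Proof.
move=> Fl Fr.
pose G d u v := sw d (fun e f => F (u * S f) (v * S e)).
have G1 u v : lin (fun d => G d u v) by rewrite /G; lin_tac.
have G2 d v : lin (fun u => G d u v) by rewrite /G; lin_tac.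
have G3 d u : lin (fun v => G d u v) by rewrite /G; lin_tac.
transitivity (sw h (fun a b => sw b (fun c d => sw (S a * c) (G d)))); last first.
  rewrite -(sw_coassoc (F := fun a c d => sw (S a * c) (G d))); try lin_tac.
  transitivity (sw h (fun a b => eps a *: G b 1 1)); last first.
    rewrite (sw_counitl (F := fun b => G b 1 1)); last by lin_tac.
    by apply: eq_tsum => a b; rewrite !mul1r.
  apply: eq_tsum => a b.
  rewrite (sw_antipodel (F := fun z => sw z (G b))); last by lin_tac.
  by rewrite sw1.
rewrite -[LHS](sw_counitr (F := fun z => sw (S z) F)); last by lin_tac.
apply: eq_tsum => a b; rewrite (lin_tsumE _ _ (lin_scale _ (@lin_id _ _))).
transitivity (sw b (fun c d => sw (S a) (fun p q => sw c (fun c1 c2 => G d (p * c1) (q * c2)))));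
  last by apply: eq_tsum => c d; rewrite swM.
rewrite tsum_exchange; apply: eq_tsum => p q.
rewrite (sw_coassoc (F := fun c1 c2 d => G d (p * c1) (q * c2))); try lin_tac.
transitivity (sw b (fun c d => F (p * (c * S d)) q)).
  by rewrite (sw_antipoder (F := fun z => F (p * z) q)) ?mulr1 //; lin_tac.
apply: eq_tsum => c d; rewrite /G.
rewrite -(sw_coassoc (F := fun c2 e f => F (p * c * S f) (q * c2 * S e))); try lin_tac.
rewrite -[LHS](sw_counitl (F := fun d => F (p * (c * S d)) q)); last by lin_tac.
apply: eq_tsum => x f.
transitivity (sw x (fun c2 e => F (p * c * S f) (q * (c2 * S e)))).
  rewrite (sw_antipoder (F := fun z => F (p * c * S f) (q * z))); last by lin_tac.
  by rewrite mulr1 mulrA.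
by apply: eq_tsum => c2 e; rewrite mulrA.
Qed.

Section Inverse.
Variables (T : H -> H).
Hypotheses (ST : cancel T S) (TS : cancel S T).

Lemma lin_antipodeV : lin T.
Proof. by move=> a u v; apply: (can_inj TS); rewrite linearP /= !ST. Qed.

Lemma antipodeVM x y : T (x * y) = T y * T x.
Proof. by apply: (can_inj TS); rewrite antipodeM !ST. Qed.

Lemma counit_antipodeV h : counit (T h) = counit h.
Proof. by rewrite -counit_antipode ST. Qed.

Lemma sw_antipodeV U (F : H -> H -> U) h :
  (forall b, lin (F^~ b)) -> (forall a, lin (F a)) ->
  sw (T h) F = sw h (fun a b => F (T b) (T a)).
Proof.
have Tl := lin_antipodeV; move=> Fl Fr; rewrite -{2}[h]ST sw_antipode; try lin_tac.
by apply: eq_tsum => a b; rewrite !TS.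
Qed.

Lemma sw_antipodeVl U (F : H -> U) h : lin F -> sw h (fun a b => F (T b * a)) = eps h *: F 1.
Proof.
have Tl := lin_antipodeV; move=> Fl.
rewrite -counit_antipodeV -(sw_antipoder (T h) Fl) sw_antipodeV; try lin_tac.
by apply: eq_tsum => a b; rewrite ST.
Qed.

End Inverse.
End Hopf.

(** * The cotensor product over a factor coalgebra *)

Lemma aug_gen_span (k : fieldType) (H : hopfAlgType k) (A : rcoideal_subalg H) (h a : H) :
  a \in rcs_pred A -> span (aug_gen A) (h * a - (counit a : k) *: h).
Proof.
move=> aA; apply: span_sub; exists h, (a - ((counit a : k))%:A); split.
- by have [A1 AD _] := rcs_subalg A; rewrite addrC -scaleNr; exact: AD.
- by rewrite linearB linearZ /= counit1 -[_ *: _]/(_ * _) mulr1 subrr.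
- by rewrite mulrBr -scalerAr mulr1.
Qed.

Section FactorLemmas.
Variables (k : fieldType) (H : hopfAlgType k) (C : factor_coalg H).
Implicit Types (a b h : H) (U : lmodType k).
Local Notation eps h := (counit h : k).
Local Notation S := (@antipode k H).
Local Notation pi := (@fc_pi k H C).
Local Notation A := (coinvariants C).

Lemma lin_fc_pi : lin pi.
Proof. exact: (linearP (fc_pi C)). Qed.

Lemma lin_fc_lmul (c : fc_type C) : lin (fun a => fc_lmul a c).
Proof.
have [h ->] := fc_pi_surj c => s a b.
by rewrite !fc_lmulE mulrDl -scalerAl (linearP (fc_pi C)).
Qed.

Lemma lin_fc_lmulr h : lin (@fc_lmul k H C h).
Proof. exact: fc_lmul_is_linear. Qed.

Lemma coinvP a : a \in A <-> sw a (fun x y => pi x \ot y) = pi 1 \ot a.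
Proof.
have E := tmap_tsum pi idfun (comul a).
by split=> [/eqP|h]; [rewrite E|apply/eqP; rewrite E].
Qed.

Lemma coinv_sw U (F : fc_type C -> H -> U) a :
  (forall y, lin (F^~ y)) -> (forall x, lin (F x)) ->
  a \in A -> sw a (fun x y => F (pi x) y) = F (pi 1) a.
Proof.
move=> Fl Fr /coinvP aA; rewrite -(tsum_ptens (pi 1) a Fl Fr) -aA tsum_tsum //.
by apply: eq_tsum => x y; rewrite tsum_ptens.
Qed.

(** The counit on the second leg of the coinvariance equation gives [pi a] = eps(a) [pi 1], and the
    left action of H on C does the rest. *)
Lemma coinv_pi h a : a \in A -> pi (h * a) = eps a *: pi h.
Proof.
move=> aA; have Lr := lin_fc_lmulr; have Ll := lin_fc_pi.
have lc : lin (@counit k H) by exact: lin_linear.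
rewrite -[X in _ *: pi X]mulr1 -[in RHS]fc_lmulE.
rewrite -[RHS](coinv_sw (F := fun c y => eps y *: fc_lmul h c) _ _ aA); try lin_tac.
rewrite -[LHS](sw_counitr (F := fun a => pi (h * a))); last by lin_tac.
by apply: eq_tsum => x y; rewrite fc_lmulE.
Qed.

Section Cotensor.
Variables (n : nat) (u v : 'I_n -> H) (c : 'I_n -> 'I_n -> fc_type C).
Hypothesis uc : forall i, sw (u i) (fun x y => x \ot pi y) = \sum_j u j \ot c j i.
Hypothesis vc : forall i, sw (v i) (fun x y => pi x \ot y) = \sum_j c i j \ot v j.

(** By [uc] and [vc] both sides equal the double sum of F(u_j, c_ji, v_i). This is the statement
    that sum_i u_i (x) v_i lies in the cotensor product of H and H over C. *)
Lemma cotensor_exchange U (F : H -> fc_type C -> H -> U) :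
  (forall y z, lin (fun x => F x y z)) -> (forall x z, lin (fun y => F x y z)) ->
  (forall x y, lin (F x y)) ->
  \sum_i sw (u i) (fun x y => F x (pi y) (v i)) = \sum_i sw (v i) (fun x y => F (u i) (pi x) y).
Proof.
move=> F1 F2 F3; have Ll := lin_fc_pi.
transitivity (\sum_i \sum_j F (u j) (c j i) (v i)).
  apply: eq_bigr => i _.
  transitivity (tsum (sw (u i) (fun x y => x \ot pi y)) (fun x y => F x y (v i))).
    by rewrite tsum_tsum //; apply: eq_tsum => x y; rewrite tsum_ptens.
  rewrite uc tsum_sum //.
  by apply: eq_bigr => j _; rewrite tsum_ptens.
rewrite exchange_big; apply: eq_bigr => i _.
transitivity (tsum (sw (v i) (fun x y => pi x \ot y)) (F (u i))); last first.
  by rewrite tsum_tsum //; apply: eq_tsum => x y; rewrite tsum_ptens.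
by rewrite vc tsum_sum //; apply: eq_bigr => j _; rewrite tsum_ptens.
Qed.

(* The isomorphism of the cotensor product of H and H over C with H (x) A. *)
Lemma cotensor_coinv :
  tens_sub [set` A] setT (\sum_i sw (u i) (fun x y => (S y * v i) \ot x)).
Proof.
have Ll := lin_fc_pi; have Lm := lin_fc_lmul; have Lr := lin_fc_lmulr.
(* The coinvariants are the kernel of [D], so by exactness of the tensor product over k ([tens_ker])
   it is enough that [D] (x) id kills the sum. *)
pose D : {linear H -> fc_type C \ox H} := (tmap pi idfun \o comul) \- ptens (pi 1).
have -> : [set` rcs_pred A] = [set a | D a = 0].
  apply/seteqP; split=> a /=; first by move=> /eqP ->; rewrite subrr.
  by move/eqP; rewrite subr_eq0.
apply: tens_ker; rewrite (lin_sumE _ _ (lin_linear _)).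
transitivity (\sum_i (sw (u i) (fun x y => sw (S y * v i) (fun p q => pi p \ot q) \ot x) -
    sw (u i) (fun x y => pi 1 \ot (S y * v i) \ot x))).
  apply: eq_bigr => i _; rewrite linear_tsum /= -sumrB.
  by apply: eq_bigr => p _; rewrite tmapE /= ptensBl tmap_tsum.
rewrite sumrB; apply/eqP; rewrite subr_eq0; apply/eqP.
(* Once comul (S y) is split, the left-hand side is a trilinear expression in u_i and the two legs
   of the coaction of v_i. The exchange replaces the C-leg of v_i by that of u_i, where S(u_3) u_4
   cancels and leaves [pi 1]. *)
pose F x c d := sw x (fun x' y => sw y (fun y1 y2 =>
   fc_lmul (S y2) c \ot (S y1 * d) \ot x')) : (fc_type C \ox H) \ox H.
transitivity (\sum_i sw (v i) (fun x y => F (u i) (pi x) y)).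
  apply: eq_bigr => i _; rewrite /F tsum_exchange; apply: eq_tsum => x y.
  rewrite swM; try lin_tac.
  rewrite sw_antipode; try lin_tac.
  rewrite (lin_tsumE _ _ (lin_ptensl x (@lin_id _ _))) tsum_exchange; apply: eq_tsum => a b.
  rewrite (lin_tsumE _ _ (lin_ptensl x (@lin_id _ _))); apply: eq_tsum => y1 y2.
  by rewrite fc_lmulE.
rewrite -cotensor_exchange; [|rewrite /F; lin_tac..].
apply: eq_bigr => i _; rewrite /F.
rewrite (sw_coassoc (F := fun x' y z => sw y (fun y1 y2 =>
  fc_lmul (S y2) (pi z) \ot (S y1 * v i) \ot x'))); try lin_tac.
apply: eq_tsum => x y.
rewrite (sw_coassoc (F := fun y1 y2 z =>
  fc_lmul (S y2) (pi z) \ot (S y1 * v i) \ot x)); try lin_tac.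
rewrite -[RHS](sw_counitr (F := fun y => pi 1 \ot (S y * v i) \ot x)); last by lin_tac.
apply: eq_tsum => a b.
rewrite -(sw_antipodel (F := fun z => pi z \ot (S a * v i) \ot x)); last by lin_tac.
by apply: eq_tsum => b1 b2; rewrite fc_lmulE.
Qed.

(** The map a (x) h |-> h a - eps(a) h sends A (x) H into H A^+. On S(u_2) v (x) u_1 it gives u_1
    S(u_2) v - eps(u_2) eps(v) u_1, that is eps(u) v - eps(v) u. *)
Lemma cotensor_aug :
  span (aug_gen A) (\sum_i (eps (u i) *: v i - eps (v i) *: u i)).
Proof.
have lc : lin (@counit k H) by exact: lin_linear.
have -> : \sum_i (eps (u i) *: v i - eps (v i) *: u i) =
    tsum (\sum_i sw (u i) (fun x y => (S y * v i) \ot x)) (fun a h => h * a - eps a *: h).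
  rewrite tsum_sum; try lin_tac.
  apply: eq_bigr => i _; rewrite tsum_tsum; try lin_tac.
  transitivity (sw (u i) (fun x y => x * S y * v i) -
     sw (u i) (fun x y => eps y *: (eps (v i) *: x))).
    rewrite (sw_antipoder (F := fun z => z * v i)); last by lin_tac.
    by rewrite (sw_counitr (F := fun x => eps (v i) *: x)) ?mul1r //; lin_tac.
  rewrite -sumrB; apply: eq_bigr => p _; rewrite tsum_ptens; try lin_tac.
  by rewrite mulrA counitM counit_antipode scalerA.
move: cotensor_coinv; set t := (\sum_i _).
have Fl : lin (fun t => tsum t (fun a h : H => h * a - eps a *: h)) by lin_tac.
apply: (@span_ind_linear _ _ _ (fun t => span (aug_gen A) (tsum t (fun a h : H => h * a - eps a *: h)))).
- by rewrite (lin0E Fl); exact: span0.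
- by move=> a x y ? ?; rewrite Fl; exact: span_linear.
- move=> _ [a [h [aA _ ->]]]; rewrite tsum_ptens; try lin_tac.
  exact: aug_gen_span.
Qed.

End Cotensor.
End FactorLemmas.

(** * Finiteness of comodules and comatrices *)

Section DualFamilies.
Variable k : fieldType.

(** Linear independence of a finite family, in the form in which it is used: the dual functionals
    are what slices a tensor. *)
Definition has_dual (V : lmodType k) n (v : 'I_n -> V) : Prop :=
  exists f : 'I_n -> {linear V -> k^o}, forall i j, f i (v j) = (i == j)%:R.

Lemma has_dual0 (V : lmodType k) (v : 'I_0 -> V) : has_dual v.
Proof.
have no (i : 'I_0) : False by case: i.
by exists (fun i => False_rect _ (no i)) => i; case: (no i).
Qed.

Lemma sum_delta (V : lmodType k) n (i : 'I_n) (v : 'I_n -> V) :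
  \sum_j (i == j)%:R *: v j = v i.
Proof.
rewrite (bigD1 i) //= eqxx scale1r big1 ?addr0 // => j ji.
by rewrite eq_sym (negPf ji) scale0r.
Qed.

Lemma span_family (V : lmodType k) n (v : 'I_n -> V) x :
  span [set v i | i in setT] x -> exists a : 'I_n -> k, x = \sum_i a i *: v i.
Proof.
elim=> [|a _ y [i _ <-] _ [b ->]].
  by exists (fun=> 0); rewrite big1 // => i _; rewrite scale0r.
exists (fun j => a * (i == j)%:R + b j).
under [RHS]eq_bigr do rewrite scalerDl -scalerA.
by rewrite big_split /= -scaler_sumr sum_delta.
Qed.

(** If no member lies in the span of the others, each can be separated from that span by a
    functional, which gives the dual family one member at a time. *)
Lemma has_dualVdep (V : lmodType k) n (v : 'I_n.+1 -> V) : has_dual v \/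
  exists i (a : 'I_n -> k), v i = \sum_j a j *: v (lift i j).
Proof.
have [[i vi]|nspan] := pselect (exists i, span [set v (lift i j) | j in setT] (v i)).
  by right; exists i; exact: span_family vi.
left; have ex i : exists f : {linear V -> k^o}, forall j, f (v j) = (i == j)%:R.
  have [|f f1 f0] := @span_functional _ _ [set v (lift i j) | j in setT] (v i).
    by move=> vi; apply: nspan; exists i.
  exists f => j; case: (unliftP i j) => [j' ->|->]; last by rewrite eqxx.
  by rewrite f0 ?(negPf (neq_lift _ _)) //; exists j'.
by have [f fP] := choice ex; exists f.
Qed.

(** Induction on the number of summands: a member of either family that depends on the others can be
    absorbed into them, which shortens the expression. *)
Lemma tens_dual_families (V W : lmodType k) (t : V \ox W) :
  exists n (v : 'I_n -> V) (w : 'I_n -> W),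
    [/\ t = \sum_i v i \ot w i, has_dual v & has_dual w].
Proof.
have [s ->] := tens_sum t.
have : exists v w, \sum_(p <- s) p.1 \ot p.2 = \sum_(i < size s) v i \ot w i.
  by exists (fun i => (tnth (in_tuple s) i).1), (fun i => (tnth (in_tuple s) i).2);
     rewrite big_tnth.
move: (\sum_(p <- s) _) (size s) => {s}{}t n.
elim: n t => [|n IH] t [v [w ->]].
  by exists 0, v, w; split=> //; exact: has_dual0.
have split_sum i : \sum_j v j \ot w j = v i \ot w i + \sum_j v (lift i j) \ot w (lift i j).
  by rewrite (bigD1_ord i).
have [dv|[i [a vi]]] := has_dualVdep v; last first.
  apply: IH; exists (fun j => v (lift i j)), (fun j => a j *: w i + w (lift i j)).
  rewrite (split_sum i) vi (lin_sumE _ _ (lin_ptensl (w i) (@lin_id _ _))) -big_split /=.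
  by apply: eq_bigr => j _; rewrite ptensDr ptensZl.
have [dw|[i [a wi]]] := has_dualVdep w; first by exists n.+1, v, w.
apply: IH; exists (fun j => a j *: v i + v (lift i j)), (fun j => w (lift i j)).
rewrite (split_sum i) wi (lin_sumE _ _ (lin_ptensr (v i) (@lin_id _ _))) -big_split /=.
by apply: eq_bigr => j _; rewrite ptensDl linearZ.
Qed.

Lemma slicel (V W U : lmodType k) n (v : 'I_n -> V) (w : 'I_n -> W)
    (f : 'I_n -> {linear V -> k^o}) (g : W -> U) i :
  (forall i j, f i (v j) = (i == j)%:R) -> lin g ->
  tsum (\sum_j v j \ot w j) (fun x y => (f i x : k) *: g y) = g (w i).
Proof.
move=> fv gl; rewrite tsum_sum; try lin_tac.
rewrite -[RHS](sum_delta i (fun j => g (w j))); apply: eq_bigr => j _.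
by rewrite tsum_ptens ?fv //; lin_tac.
Qed.

Lemma slicer (V W U : lmodType k) n (v : 'I_n -> V) (w : 'I_n -> W)
    (f : 'I_n -> {linear W -> k^o}) (g : V -> U) i :
  (forall i j, f i (w j) = (i == j)%:R) -> lin g ->
  tsum (\sum_j v j \ot w j) (fun x y => (f i y : k) *: g x) = g (v i).
Proof.
move=> fw gl; rewrite tsum_sum; try lin_tac.
rewrite -[RHS](sum_delta i (fun j => g (v j))); apply: eq_bigr => j _.
by rewrite tsum_ptens ?fw //; lin_tac.
Qed.

End DualFamilies.

(** * Finite-dimensional comodules as matrices, and local finiteness *)

Section Comatrix.
Variables (k : fieldType) (C : coalgType k).

(** These equations say at once that e_i |-> sum_j e_j (x) c_ji is a right coaction and that e_i |->
    sum_j c_ij (x) e_j is a left one, so that a single notion serves both sides. *)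
Definition comatrix n (c : 'I_n -> 'I_n -> C) : Prop :=
  (forall i j, comul (c i j) = \sum_l c i l \ot c l j) /\
  (forall i j, (counit (c i j) : k) = (i == j)%:R).

Lemma right_comatrix (W : lmodType k) (rho : {linear W -> W \ox C}) n (y : 'I_n -> W)
    (c : 'I_n -> 'I_n -> C) : right_comodule rho -> has_dual y ->
  (forall i, rho (y i) = \sum_j y j \ot c j i) -> comatrix c.
Proof.
move=> [rhoA rho1] [f fy] rhoy; split=> i j.
  have := congr1 (fun t => tsum t (fun w s => (f i w : k) *: s)) (rhoA (y j)).
  rewrite /= rhoy !linear_sum /=.
  under eq_bigr do rewrite tmapE /= rhoy (lin_sumE _ _ (lin_ptensl _ (@lin_id _ _))) linear_sum.
  under [X in _ = tsum X _]eq_bigr do rewrite tmapE /=.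
  rewrite (slicel _ _ fy (@lin_id _ _)) => <-.
  rewrite tsum_sum; try lin_tac.
  apply: eq_bigr => l _; rewrite -(slicel (fun m => c m l) i fy (lin_ptensl (c l j) (@lin_id _ _))).
  rewrite !tsum_sum; try lin_tac.
  by apply: eq_bigr => m _; rewrite /= tassocE !tsum_ptens //; lin_tac.
have := congr1 (f i) (rho1 (y j)); rewrite rhoy !linear_sum /= fy => <-.
rewrite -[LHS](sum_delta i (fun l => counit (c l j))); apply: eq_bigr => l _.
by rewrite /= tmapE tunitrE linearZ /= fy; exact: mulrC.
Qed.

Lemma left_comatrix (W : lmodType k) (rho : {linear W -> C \ox W}) n (y : 'I_n -> W)
    (c : 'I_n -> 'I_n -> C) : left_comodule rho -> has_dual y ->
  (forall i, rho (y i) = \sum_j c i j \ot y j) -> comatrix c.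
Proof.
move=> [rhoA rho1] [f fy] rhoy; split=> i j.
  pose G (t : C \ox (C \ox W)) := tsum t (fun a s => tsum s (fun b w => (f j w : k) *: (a \ot b))).
  have Gl : lin G by rewrite /G; lin_tac.
  have := congr1 G (rhoA (y i)).
  rewrite rhoy !linear_sum /= !(lin_sumE _ _ Gl).
  have -> : \sum_l G (tassoc (tmap comul idfun (c i l \ot y l))) = comul (c i j).
    rewrite -[RHS](sum_delta j (fun l => comul (c i l))); apply: eq_bigr => l _.
    rewrite tmapE /= -[comul (c i l) in LHS]tsumK.
    rewrite ptens_tsuml linear_tsum.
    rewrite (lin_tsumE _ _ Gl) -[comul (c i l) in RHS]tsumK.
    rewrite (lin_tsumE _ _ (lin_scale _ (@lin_id _ _))); apply: eq_tsum => a b.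
    by rewrite /= tassocE /G !tsum_ptens ?fy //; lin_tac.
  move=> ->; apply: eq_bigr => l _; rewrite tmapE /= rhoy /G tsum_ptens; try lin_tac.
  by rewrite (slicer _ _ fy (lin_ptensr _ (@lin_id _ _))).
have := congr1 (f j) (rho1 (y i)); rewrite rhoy !linear_sum /= fy eq_sym => <-.
rewrite -[LHS](sum_delta j (fun l => counit (c i l))); apply: eq_bigr => l _.
by rewrite /= tmapE tunitlE linearZ /= fy; exact: mulrC.
Qed.

(** Local finiteness inside the kernel of [p], which the second hypothesis makes stable under the
    coaction. The first legs of a shortest expression of rho(x) span a subcomodule containing x,
    with coefficients eps(d_i); since the second legs [d] are independent, (p (x) id) (rho x) = 0
    forces p(y_i) = 0. *)
Lemma right_finiteness (W V : lmodType k) (rho : {linear W -> W \ox C}) (p : {linear W -> V}) x :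
  right_comodule rho -> (forall w, p w = 0 -> tmap p idfun (rho w) = 0) -> p x = 0 ->
  exists n (y : 'I_n -> W) (c : 'I_n -> 'I_n -> C) (a : 'I_n -> k),
    [/\ comatrix c, forall i, p (y i) = 0, forall i, rho (y i) = \sum_j y j \ot c j i &
        x = \sum_i a i *: y i].
Proof.
move=> rhoP kp px; have [rhoA rho1] := rhoP.
have [n [y [d [rhox yd [f fd]]]]] := tens_dual_families (rho x).
pose c i j := tsum (comul (d i)) (fun a b => (f j b : k) *: a).
have rhoy i : rho (y i) = \sum_j y j \ot c j i.
  (* Coassociativity at [x] with the last leg cut by [f i]: the left side reduces to [rho (y i)],
     the right side to the expansion with coefficients [c]. *)
  pose G (t : W \ox (C \ox C)) := tsum t (fun w s => tsum s (fun a b => (f i b : k) *: (w \ot a))).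
  have Gl : lin G by rewrite /G; lin_tac.
  have := congr1 G (rhoA x); rewrite rhox !linear_sum /= !(lin_sumE _ _ Gl).
  have -> : \sum_j G (tassoc (tmap rho idfun (y j \ot d j))) = rho (y i).
    rewrite -[RHS](sum_delta i (fun l => rho (y l))); apply: eq_bigr => l _.
    rewrite tmapE /= -[rho (y l) in LHS]tsumK.
    rewrite ptens_tsuml linear_tsum.
    rewrite (lin_tsumE _ _ Gl) -[rho (y l) in RHS]tsumK.
    rewrite (lin_tsumE _ _ (lin_scale _ (@lin_id _ _))); apply: eq_tsum => w a.
    by rewrite /= tassocE /G !tsum_ptens ?fd //; lin_tac.
  move=> ->; apply: eq_bigr => j _; rewrite tmapE /= /G tsum_ptens; try lin_tac.
  rewrite /c ptens_tsumr.
  by apply: eq_tsum => a b; rewrite linearZ.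
exists n, y, c, (fun i => (counit (d i) : k)); split=> //.
- exact: right_comatrix rhoP yd rhoy.
- move=> i; have := kp x px; rewrite rhox linear_sum /=.
  under eq_bigr do rewrite tmapE /=.
  move=> E; have := slicer (fun j => p (y j)) i fd (@lin_id _ _).
  by rewrite E => <-; rewrite (lin0E (f := fun t => tsum t _)) //; lin_tac.
- rewrite -[LHS](rho1 x) rhox !linear_sum; apply: eq_bigr => i _.
  by rewrite /= tmapE tunitrE.
Qed.

Lemma left_finiteness (W V : lmodType k) (rho : {linear W -> C \ox W}) (p : {linear W -> V}) x :
  left_comodule rho -> (forall w, p w = 0 -> tmap idfun p (rho w) = 0) -> p x = 0 ->
  exists n (y : 'I_n -> W) (c : 'I_n -> 'I_n -> C) (a : 'I_n -> k),
    [/\ comatrix c, forall i, p (y i) = 0, forall i, rho (y i) = \sum_j c i j \ot y j &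
        x = \sum_i a i *: y i].
Proof.
move=> rhoP kp px; have [rhoA rho1] := rhoP.
have [n [d [y [rhox [f fd] yd]]]] := tens_dual_families (rho x).
pose c i j := tsum (comul (d j)) (fun a b => (f i a : k) *: b).
have rhoy i : rho (y i) = \sum_j c i j \ot y j.
  pose G (t : C \ox (C \ox W)) := tsum t (fun a s => (f i a : k) *: s).
  have Gl : lin G by rewrite /G; lin_tac.
  have := congr1 G (rhoA x); rewrite rhox !linear_sum /= !(lin_sumE _ _ Gl).
  have -> : \sum_j G (tmap idfun rho (d j \ot y j)) = rho (y i).
    rewrite -[RHS](sum_delta i (fun l => rho (y l))); apply: eq_bigr => l _.
    by rewrite tmapE /= /G tsum_ptens ?fd //; lin_tac.
  move=> <-; apply: eq_bigr => j _; rewrite tmapE /= -[comul (d j)]tsumK.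
  rewrite [in LHS]ptens_tsuml linear_tsum.
  rewrite (lin_tsumE _ _ Gl) /c ptens_tsuml.
  apply: eq_tsum => a b.
  by rewrite /= tassocE /G tsum_ptens ?ptensZl //; lin_tac.
exists n, y, c, (fun i => (counit (d i) : k)); split=> //.
- exact: left_comatrix rhoP yd rhoy.
- move=> i; have := kp x px; rewrite rhox linear_sum /=.
  under eq_bigr do rewrite tmapE /=.
  move=> E; have := slicel (fun j => p (y j)) i fd (@lin_id _ _).
  by rewrite E => <-; rewrite (lin0E (f := fun t => tsum t _)) //; lin_tac.
- rewrite -[LHS](rho1 x) rhox !linear_sum; apply: eq_bigr => i _.
  by rewrite /= tmapE tunitlE.
Qed.

End Comatrix.

(** * Embeddings and liftings *)

Section Cofree.
Variables (k : fieldType) (C : coalgType k) (V : lmodType k).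

Definition left_cofree : {linear C \ox V -> C \ox (C \ox V)} :=
  @tassoc k C C V \o tmap comul idfun.

Lemma left_cofreeE c v : left_cofree (c \ot v) = sw c (fun a b => a \ot (b \ot v)).
Proof. by rewrite /= tmapE /= tassoc_tsum. Qed.

Lemma left_cofree_comodule : left_comodule left_cofree.
Proof.
split.
  apply: lin_ext; [lin_tac|lin_tac|] => c v; rewrite left_cofreeE.
  rewrite 2!linear_tsum linear_tsum.
  transitivity (sw c (fun a b => sw a (fun a1 a2 => a1 \ot (a2 \ot (b \ot v))))).
    by apply: eq_tsum => a b; rewrite /= tmapE /= tassoc_tsum.
  rewrite sw_coassoc; try lin_tac.
  by apply: eq_tsum => a b; rewrite [RHS]tmapE left_cofreeE ptens_tsumr.
apply: lin_ext; [lin_tac|lin_tac|] => c v; rewrite left_cofreeE 2!linear_tsum.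
rewrite -[RHS](sw_counitl (F := fun h => h \ot v)); last by lin_tac.
by apply: eq_tsum => a b; rewrite /= tmapE tunitlE.
Qed.

Definition right_cofree : {linear V \ox C -> (V \ox C) \ox C} :=
  @tassocV k V C C \o tmap idfun comul.

Lemma right_cofreeE v c : right_cofree (v \ot c) = sw c (fun a b => (v \ot a) \ot b).
Proof.
rewrite /= tmapE /= -{1}[comul c]tsumK ptens_tsumr linear_tsum.
by apply: eq_tsum => a b; rewrite /= tassocVE.
Qed.

Lemma right_cofree_comodule : right_comodule right_cofree.
Proof.
split.
  apply: lin_ext; [lin_tac|lin_tac|] => v c; rewrite right_cofreeE.
  rewrite 2!linear_tsum linear_tsum.
  transitivity (sw c (fun a b => sw a (fun a1 a2 => (v \ot a1) \ot (a2 \ot b)))).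
    apply: eq_tsum => a b; rewrite -[LHS]/(tassoc (tmap right_cofree idfun (v \ot a \ot b))).
    rewrite tmapE right_cofreeE ptens_tsuml linear_tsum.
    by apply: eq_tsum => a1 a2; rewrite /= tassocE.
  rewrite sw_coassoc; try lin_tac.
  by apply: eq_tsum => a b; rewrite /= tmapE /= -{2}[comul b]tsumK ptens_tsumr.
apply: lin_ext; [lin_tac|lin_tac|] => v c; rewrite right_cofreeE 2!linear_tsum.
rewrite -[RHS](sw_counitr (F := fun h => v \ot h)); last by lin_tac.
by apply: eq_tsum => a b; rewrite /= tmapE tunitrE.
Qed.
End Cofree.

Section Embedding.
Variables (k : fieldType) (H : hopfAlgType k) (C : factor_coalg H).
Local Notation pi := (@fc_pi k H C).

(** The family [x] is an element sum_i e_i (x) x_i of the cotensor product of H with the right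
    comodule e_j |-> sum_i e_i (x) c_ij, and its image under the counit is e_l. The definition thus
    expresses surjectivity onto each basis vector. *)
Definition left_liftable : Prop := forall n (c : 'I_n -> 'I_n -> fc_type C), comatrix c ->
  forall l, exists x : 'I_n -> H,
    (forall i, sw (x i) (fun a b => pi a \ot b) = \sum_j c i j \ot x j) /\
    (forall i, (counit (x i) : k) = (i == l)%:R).

Definition right_liftable : Prop := forall n (c : 'I_n -> 'I_n -> fc_type C), comatrix c ->
  forall l, exists x : 'I_n -> H,
    (forall i, sw (x i) (fun a b => a \ot pi b) = \sum_j x j \ot c j i) /\
    (forall i, (counit (x i) : k) = (i == l)%:R).

Section Standard.
Variables (n : nat).
Local Notation V := 'rV[k]_n.
Local Notation e := (fun i : 'I_n => delta_mx 0 i : V).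

Lemma lin_coord (U : lmodType k) (w : U) i : lin (fun v : V => v 0 i *: w).
Proof. by move=> a u v; rewrite !mxE scalerDl scalerA. Qed.

Lemma row_basis (v : V) : v = \sum_i v 0 i *: e i.
Proof. exact: row_sum_delta. Qed.

Lemma row_linext (U : lmodType k) (f g : V -> U) : lin f -> lin g ->
  (forall i, f (e i) = g (e i)) -> f =1 g.
Proof.
move=> fl gl fg v; rewrite (row_basis v) !lin_sumE //.
by apply: eq_bigr => i _; rewrite !linZE // fg.
Qed.

Lemma coord_delta (U : lmodType k) (w : 'I_n -> U) i : \sum_j e i 0 j *: w j = w i.
Proof.
rewrite -[RHS](sum_delta i w); apply: eq_bigr => j _.
by rewrite mxE eqxx /= eq_sym.
Qed.

(** The l-th coordinate form carried to [W] along [f]: injectivity keeps f(e_l) out of the span of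
    the other f(e_i), so a functional separates them. *)
Lemma row_functional (W : lmodType k) (f : {linear V -> W}) l : injective f ->
  exists g : {linear W -> k^o}, forall i, g (f (e i)) = (i == l)%:R.
Proof.
move=> fi; have [|g gl g0] := @span_functional _ _ [set f (e i) | i in [set i | i != l]] (f (e l)).
  move=> sl; have : exists2 v : V, v 0 l = 0 & f v = f (e l).
    elim: sl => [|a _ w [i il <-] _ [v v0 <-]].
      by exists 0; rewrite ?linear0 ?mxE.
    exists (a *: e i + v); last by rewrite linearP.
    by rewrite !mxE v0 addr0 eqxx /= eq_sym (negPf il) mulr0.
  by move=> [v v0 /fi vl]; move: v0; rewrite vl mxE !eqxx /=; apply/eqP; exact: oner_neq0.
exists g => i; case: eqVneq => [->//|il].
by apply: g0; exists i.
Qed.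
End Standard.

Lemma vect_dual_basis (V : vectType k) : exists n (e : 'I_n -> V) (f : 'I_n -> {linear V -> k^o}),
  (forall i j, f i (e j) = (i == j)%:R) /\ forall v, v = \sum_i (f i v : k) *: e i.
Proof.
have cl i : lin (fun v : V => coord (vbasis {:V}) i v : k^o) by move=> *; exact: linearP.
exists (\dim {:V}), (fun i => (vbasis {:V})`_i), (fun i => linear_of (cl i)); split=> [i j|v].
  by rewrite linear_ofE coord_free ?(basis_free (vbasisP _)) // eq_sym.
rewrite [LHS](coord_vbasis (memvf v)).
by apply: eq_bigr => i _; rewrite linear_ofE.
Qed.

(** The liftings are matrix coefficients of the ambient H-comodule: with [g] extending the l-th
    coordinate, x_i = (id (x) g) (sigma (f e_i)), and eps(x_i) = g(f(e_i)) by the counit axiom. *)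
Lemma left_embed_liftable : left_comodules_embed C -> left_liftable.
Proof.
move=> emb n c [cA c1] l.
pose rhof (v : 'rV[k]_n) := \sum_i v 0 i *: \sum_j c i j \ot (delta_mx 0 j : 'rV[k]_n).
have rhol : lin rhof by apply: lin_sum => i; exact: lin_coord.
have rhoe i : linear_of rhol (delta_mx 0 i) = \sum_j c i j \ot (delta_mx 0 j : 'rV[k]_n).
  by rewrite linear_ofE /rhof coord_delta.
have rhoP : left_comodule (linear_of rhol).
  split; apply: row_linext => [||i]; try by lin_tac.
  - rewrite rhoe !linear_sum /=.
    under eq_bigr do rewrite tmapE /= cA (lin_sumE _ _ (lin_ptensl _ (@lin_id _ _))) linear_sum.
    rewrite exchange_big; apply: eq_bigr => j _.
    by rewrite tmapE /= rhoe linear_sum; apply: eq_bigr => m _; rewrite /= tassocE.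
  - rewrite rhoe !linear_sum /= -[RHS](sum_delta i (fun j => delta_mx 0 j)).
    by apply: eq_bigr => j _; rewrite tmapE tunitlE /= c1.
have [W [sigma [f [[sA s1] fi fs]]]] := emb _ _ rhoP.
have [g gf] := row_functional l fi.
pose x i := tsum (sigma (f (delta_mx 0 i))) (fun h w => (g w : k) *: h).
exists x; split=> i.
  pose G (t : H \ox (H \ox W)) := tsum t (fun a s => tsum s (fun b w => (g w : k) *: (pi a \ot b))).
  have Gl : lin G by rewrite /G; have := lin_fc_pi C => lp; lin_tac.
  pose G' (t : fc_type C \ox W) := tsum t (fun c w => c \ot tsum (sigma w) (fun b w => (g w : k) *: b)).
  have G'l : lin G' by rewrite /G'; lin_tac.
  (* [G'] coacts once more on the [W] leg and cuts it by [g]. Applied to the two sides of the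
     colinearity of [f], it gives the matrix equation from rho, and the coaction of x_i from sigma
     by coassociativity. *)
  transitivity (G' (tmap idfun f (linear_of rhol (delta_mx 0 i)))); last first.
    rewrite rhoe linear_sum (lin_sumE _ _ G'l); apply: eq_bigr => j _.
    by rewrite /= tmapE /= /G' tsum_ptens //; lin_tac.
  rewrite -fs.
  have lp := lin_fc_pi C.
  have -> t : G' (tmap pi idfun t) = G (tmap idfun sigma t).
    apply: (@lin_ext _ _ _ _ (fun t => G' (tmap pi idfun t)) (fun t => G (tmap idfun sigma t))).
    - lin_tac.
    - lin_tac.
    move=> h w /=; rewrite !tmapE /= /G /G' !tsum_ptens; try lin_tac.
    rewrite ptens_tsumr; apply: eq_tsum => a b.
    by rewrite linearZ.
  rewrite -sA.
  rewrite /x tsum_lift; try lin_tac.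
  set t := sigma _; rewrite -tsum_lift; try lin_tac.
  apply: (@lin_ext _ _ _ _ (fun t => sw (tsum t (fun h w => (g w : k) *: h)) (fun a b => pi a \ot b))
    (fun t => G (tassoc (tmap comul idfun t)))).
  - lin_tac.
  - lin_tac.
  move=> h w /=; rewrite tmapE /= tsum_ptens; try lin_tac.
  rewrite tassoc_tsum (lin_tsumE _ _ Gl) linearZ /=.
  rewrite (linZE (f := fun t => tsum t (fun a b => pi a \ot b))); last by lin_tac.
  rewrite (lin_tsumE _ _ (lin_scale _ (@lin_id _ _))); apply: eq_tsum => a b.
  by rewrite /G !tsum_ptens //; lin_tac.
rewrite -[RHS]gf -[X in g X]s1.
have -> t : tunitl (tmap counit idfun t) = tsum t (fun h w => (counit h : k) *: w).
  by rewrite tmap_tsum linear_tsum; apply: eq_tsum => a b; rewrite /= tunitlE.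
rewrite /x (lin_tsumE _ _ (lin_linear counit)) (lin_tsumE _ _ (lin_linear g)).
by apply: eq_bigr => p _; rewrite !linearZ /=; exact: mulrC.
Qed.

(** [V] embeds in the cofree comodule H (x) V by e_i |-> sum_l x_li (x) e_l, where x_l lifts the
    l-th basis vector. The counit conditions make eps (x) id a left inverse, and the lifting
    equations are colinearity. *)
Lemma left_liftable_embed : left_liftable -> left_comodules_embed C.
Proof.
move=> lift V rho rhoP; have lp := lin_fc_pi C.
have [n [e [f [fe ve]]]] := vect_dual_basis V.
have de : has_dual e by exists f.
pose c i j := tsum (rho (e i)) (fun a v => f j v *: a).
have rhoe i : rho (e i) = \sum_j c i j \ot e j.
  have -> : rho (e i) = tsum (rho (e i)) (fun a v => \sum_j @ptens k (fc_type C) V (f j v *: a) (e j)).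
    rewrite -[LHS]tsumK; apply: eq_tsum => a v; rewrite {1}[v]ve linear_sum.
    by apply: eq_bigr => j _; rewrite linearZ ptensZl.
  rewrite [LHS]/tsum exchange_big; apply: eq_bigr => j _.
  by rewrite /c ptens_tsuml.
have cP := left_comatrix rhoP de rhoe.
have [x xP] := choice (lift _ _ cP).
pose ff (v : V) : H \ox V := \sum_i (f i v : k) *: \sum_l @ptens k H V (x l i) (e l).
have fl : lin ff by rewrite /ff; lin_tac.
have ffe i : ff (e i) = \sum_l x l i \ot e l.
  rewrite /ff -[RHS](sum_delta i (fun i => \sum_l x l i \ot e l)).
  by apply: eq_bigr => j _; rewrite fe eq_sym.
exists (H \ox V), (left_cofree H V), (linear_of fl); split; first exact: left_cofree_comodule.
- move=> v w; rewrite !linear_ofE => E.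
  have K u : tunitl (tmap counit idfun (ff u)) = u.
    rewrite {1}[u]ve (lin_sumE _ _ fl) !linear_sum [RHS]ve; apply: eq_bigr => i _.
    rewrite linZE // !linearZ /= ffe; congr (_ *: _); rewrite !linear_sum.
    rewrite -[RHS](sum_delta i (fun j => e j)); apply: eq_bigr => l _.
    by rewrite /= tmapE tunitlE; have [_ ->] := xP l.
  by rewrite -[v]K E K.
- have G1 : lin (fun v => tmap pi idfun (left_cofree H V (linear_of fl v))) by lin_tac.
  have G2 : lin (fun v => tmap idfun (linear_of fl) (rho v)) by lin_tac.
  move=> v; rewrite [v]ve (lin_sumE _ _ G1) (lin_sumE _ _ G2); apply: eq_bigr => i _.
  rewrite (linZE _ _ G1) (linZE _ _ G2); congr (_ *: _).
  rewrite rhoe linear_ofE ffe !linear_sum.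
  transitivity (\sum_l \sum_j c i j \ot (x l j \ot e l)).
    apply: eq_bigr => l _; rewrite [left_cofree _ _ _]left_cofreeE linear_tsum.
    have [xl _] := xP l.
    transitivity (tsum (sw (x l i) (fun a b => pi a \ot b)) (fun a b => a \ot (b \ot e l))).
      rewrite tsum_tsum; try lin_tac.
      by apply: eq_tsum => a b; rewrite /= tmapE tsum_ptens //; lin_tac.
    rewrite xl tsum_sum; try lin_tac.
    by apply: eq_bigr => j _; rewrite tsum_ptens //; lin_tac.
  rewrite exchange_big; apply: eq_bigr => j _.
  by rewrite /= tmapE /= linear_ofE ffe linear_sum.
Qed.

End Embedding.

Section RightEmbedding.
Variables (k : fieldType) (H : hopfAlgType k) (C : factor_coalg H).
Local Notation pi := (@fc_pi k H C).

Lemma right_embed_liftable : right_comodules_embed C -> right_liftable C.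
Proof.
move=> emb n c [cA c1] l.
pose rhof (v : 'rV[k]_n) := \sum_i v 0 i *: \sum_j (delta_mx 0 j : 'rV[k]_n) \ot c j i.
have rhol : lin rhof by apply: lin_sum => i; exact: lin_coord.
have rhoe i : linear_of rhol (delta_mx 0 i) = \sum_j (delta_mx 0 j : 'rV[k]_n) \ot c j i.
  by rewrite linear_ofE /rhof coord_delta.
have rhoP : right_comodule (linear_of rhol).
  split; apply: row_linext => [||i]; try by lin_tac.
  - rewrite rhoe !linear_sum /=.
    under [RHS]eq_bigr do rewrite tmapE /= cA linear_sum.
    rewrite exchange_big; apply: eq_bigr => j _.
    rewrite tmapE /= rhoe (lin_sumE _ _ (lin_ptensl _ (@lin_id _ _))) linear_sum.
    by apply: eq_bigr => m _; rewrite /= tassocE.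
  - rewrite rhoe !linear_sum /= -[RHS](sum_delta i (fun j => delta_mx 0 j)).
    by apply: eq_bigr => j _; rewrite tmapE tunitrE /= c1 eq_sym.
have [W [sigma [f [[sA s1] fi fs]]]] := emb _ _ rhoP.
have [g gf] := row_functional l fi.
pose x i := tsum (sigma (f (delta_mx 0 i))) (fun w h => (g w : k) *: h).
have lp := lin_fc_pi C.
exists x; split=> i.
  pose G (t : W \ox (H \ox H)) := tsum t (fun w s => (g w : k) *: tsum s (fun a b => a \ot pi b)).
  have Gl : lin G by rewrite /G; lin_tac.
  pose G' (t : W \ox fc_type C) := tsum t (fun w c => tsum (sigma w) (fun v a => (g v : k) *: (a \ot c))).
  have G'l : lin G' by rewrite /G'; lin_tac.
  transitivity (G' (tmap f idfun (linear_of rhol (delta_mx 0 i)))); last first.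
    rewrite rhoe linear_sum (lin_sumE _ _ G'l); apply: eq_bigr => j _.
    rewrite /= tmapE /= /G' tsum_ptens; try lin_tac.
    by rewrite /x ptens_tsuml; apply: eq_tsum => v a; rewrite ptensZl.
  rewrite -fs.
  have -> t : G' (tmap idfun pi t) = G (tassoc (tmap sigma idfun t)).
    move: t; apply: lin_ext; [lin_tac|lin_tac|] => w h /=.
    rewrite !tmapE /= /G' tsum_ptens; try lin_tac.
    rewrite tassoc_tsum (lin_tsumE _ _ Gl); apply: eq_tsum => v a.
    by rewrite /G !tsum_ptens //; lin_tac.
  rewrite sA.
  rewrite /x tsum_lift; try lin_tac.
  set t := sigma _; rewrite -tsum_lift; try lin_tac.
  apply: (@lin_ext _ _ _ _ (fun t => sw (tsum t (fun w h => (g w : k) *: h)) (fun a b => a \ot pi b))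
    (fun t => G (tmap idfun comul t))); [lin_tac|lin_tac|] => w h /=.
  rewrite tmapE /G !tsum_ptens /=; try lin_tac.
  by rewrite linearZ /= (linZE (f := fun t => tsum t (fun a b => a \ot pi b))) //; lin_tac.
rewrite -[RHS]gf -[X in g X]s1.
have -> t : tunitr (tmap idfun counit t) = tsum t (fun w h => (counit h : k) *: w).
  by rewrite tmap_tsum linear_tsum; apply: eq_tsum => a b; rewrite /= tunitrE.
rewrite /x (lin_tsumE _ _ (lin_linear counit)) (lin_tsumE _ _ (lin_linear g)).
by apply: eq_bigr => p _; rewrite !linearZ /=; exact: mulrC.
Qed.

Lemma right_liftable_embed : right_liftable C -> right_comodules_embed C.
Proof.
move=> lift V rho rhoP; have lp := lin_fc_pi C.
have [n [e [f [fe ve]]]] := vect_dual_basis V.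
have de : has_dual e by exists f.
pose c j i := tsum (rho (e i)) (fun v a => f j v *: a).
have rhoe i : rho (e i) = \sum_j e j \ot c j i.
  have -> : rho (e i) = tsum (rho (e i)) (fun v a => \sum_j @ptens k V (fc_type C) (e j) (f j v *: a)).
    rewrite -[LHS]tsumK; apply: eq_tsum => v a; rewrite {1}[v]ve (lin_sumE _ _ (lin_ptensl _ (@lin_id _ _))).
    by apply: eq_bigr => j _; rewrite linearZ ptensZl.
  rewrite [LHS]/tsum exchange_big; apply: eq_bigr => j _.
  by rewrite /c ptens_tsumr.
have cP := right_comatrix rhoP de rhoe.
have [x xP] := choice (lift _ _ cP).
pose ff (v : V) : V \ox H := \sum_i (f i v : k) *: \sum_l @ptens k V H (e l) (x l i).
have fl : lin ff by rewrite /ff; lin_tac.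
have ffe i : ff (e i) = \sum_l e l \ot x l i.
  rewrite /ff -[RHS](sum_delta i (fun i => \sum_l e l \ot x l i)).
  by apply: eq_bigr => j _; rewrite fe eq_sym.
exists (V \ox H), (right_cofree H V), (linear_of fl); split; first exact: right_cofree_comodule.
- move=> v w; rewrite !linear_ofE => E.
  have K u : tunitr (tmap idfun counit (ff u)) = u.
    rewrite {1}[u]ve (lin_sumE _ _ fl) !linear_sum [RHS]ve; apply: eq_bigr => i _.
    rewrite linZE // !linearZ /= ffe; congr (_ *: _); rewrite !linear_sum.
    rewrite -[RHS](sum_delta i (fun j => e j)); apply: eq_bigr => l _.
    by rewrite /= tmapE tunitrE; have [_ ->] := xP l.
  by rewrite -[v]K E K.
- have G1 : lin (fun v => tmap idfun pi (right_cofree H V (linear_of fl v))) by lin_tac.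
  have G2 : lin (fun v => tmap (linear_of fl) idfun (rho v)) by lin_tac.
  move=> v; rewrite [v]ve (lin_sumE _ _ G1) (lin_sumE _ _ G2); apply: eq_bigr => i _.
  rewrite (linZE _ _ G1) (linZE _ _ G2); congr (_ *: _).
  rewrite rhoe linear_ofE ffe !linear_sum.
  transitivity (\sum_l \sum_j e l \ot x l j \ot c j i).
    apply: eq_bigr => l _; rewrite [right_cofree _ _ _]right_cofreeE linear_tsum.
    have [xl _] := xP l.
    transitivity (tsum (sw (x l i) (fun a b => a \ot pi b)) (fun a b => e l \ot a \ot b)).
      rewrite tsum_tsum; try lin_tac.
      by apply: eq_tsum => a b; rewrite /= tmapE tsum_ptens //; lin_tac.
    rewrite xl tsum_sum; try lin_tac.
    by apply: eq_bigr => j _; rewrite tsum_ptens //; lin_tac.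
  rewrite exchange_big; apply: eq_bigr => j _.
  by rewrite /= tmapE /= linear_ofE ffe (lin_sumE _ _ (lin_ptensl _ (@lin_id _ _))).
Qed.

End RightEmbedding.

(** * From liftings to equations *)

Section Powers.
Variables (k : fieldType) (s : nat) (U : lmodType k).
Implicit Types (w : {ffun 'I_s -> U}) (u : U).

Definition ffinj (j : 'I_s) (u : U) : {ffun 'I_s -> U} := [ffun i => (i == j)%:R *: u].

Lemma lin_ffinj j : lin (ffinj j).
Proof. by move=> a u v; apply/ffunP => i; rewrite !ffunE scalerDr !scalerA mulrC. Qed.

Lemma lin_ffproj j : lin (fun w => w j).
Proof. by move=> a u v; rewrite !ffunE. Qed.

Lemma ffinjE i j u : ffinj j u i = (i == j)%:R *: u.
Proof. by rewrite ffunE. Qed.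

Lemma ff_sum w : w = \sum_j ffinj j (w j).
Proof.
apply/ffunP => i; rewrite sum_ffunE -[LHS](sum_delta i w).
by apply: eq_bigr => j _; rewrite ffinjE.
Qed.

Lemma ff_linext (V : lmodType k) (f g : {ffun 'I_s -> U} -> V) : lin f -> lin g ->
  (forall j u, f (ffinj j u) = g (ffinj j u)) -> f =1 g.
Proof.
move=> fl gl fg w; rewrite (ff_sum w) !lin_sumE //.
by apply: eq_bigr => j _; rewrite fg.
Qed.

Variable D : coalgType k.

(** The coaction on the direct sum of [s] copies of [U]. A relation among [s] elements of H is a
    kernel element of a linear map on the s-th power of H, and local finiteness is applied there. *)
Definition right_pow (rho : U -> U \ox D) w :=
  \sum_j tsum (rho (w j)) (fun v a => ffinj j v \ot a).

Definition left_pow (rho : U -> D \ox U) w :=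
  \sum_j tsum (rho (w j)) (fun a v => a \ot ffinj j v).

Lemma lin_right_pow (rho : {linear U -> U \ox D}) : lin (right_pow rho).
Proof. by rewrite /right_pow; have i := lin_ffinj; have p := lin_ffproj; lin_tac. Qed.

Lemma lin_left_pow (rho : {linear U -> D \ox U}) : lin (left_pow rho).
Proof. by rewrite /left_pow; have i := lin_ffinj; have p := lin_ffproj; lin_tac. Qed.

Lemma right_pow_inj (rho : {linear U -> U \ox D}) j u :
  right_pow rho (ffinj j u) = tsum (rho u) (fun v a => ffinj j v \ot a).
Proof.
rewrite -[RHS](sum_delta j (fun j => tsum (rho u) (fun v a => ffinj j v \ot a))).
apply: eq_bigr => i _; rewrite ffinjE eq_sym linearZ.
have Fi := lin_ffinj i.
by rewrite (linZE (f := fun t => tsum t (fun v a => ffinj i v \ot a))) //; lin_tac.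
Qed.

Lemma left_pow_inj (rho : {linear U -> D \ox U}) j u :
  left_pow rho (ffinj j u) = tsum (rho u) (fun a v => a \ot ffinj j v).
Proof.
rewrite -[RHS](sum_delta j (fun j => tsum (rho u) (fun a v => a \ot ffinj j v))).
apply: eq_bigr => i _; rewrite ffinjE eq_sym linearZ.
have Fi := lin_ffinj i.
by rewrite (linZE (f := fun t => tsum t (fun a v => a \ot ffinj i v))) //; lin_tac.
Qed.

Lemma right_pow_proj (rho : {linear U -> U \ox D}) (j : 'I_s) w :
  tsum (right_pow rho w) (fun v a => (v : {ffun _ -> _}) j \ot a) = rho (w j).
Proof.
have p := lin_ffproj j.
rewrite tsum_sum; try lin_tac.
rewrite -[RHS](sum_delta j (fun i => rho (w i))); apply: eq_bigr => i _.
rewrite tsum_tsum; try lin_tac.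
rewrite -[X in _ = _ *: X]tsumK (lin_tsumE _ _ (lin_scale _ (@lin_id _ _))).
by apply: eq_tsum => v a; rewrite tsum_ptens ?ffinjE ?ptensZl //; lin_tac.
Qed.

Lemma left_pow_proj (rho : {linear U -> D \ox U}) (j : 'I_s) w :
  tsum (left_pow rho w) (fun a v => a \ot (v : {ffun _ -> _}) j) = rho (w j).
Proof.
have p := lin_ffproj j.
rewrite tsum_sum; try lin_tac.
rewrite -[RHS](sum_delta j (fun i => rho (w i))); apply: eq_bigr => i _.
rewrite tsum_tsum; try lin_tac.
rewrite -[X in _ = _ *: X]tsumK (lin_tsumE _ _ (lin_scale _ (@lin_id _ _))).
by apply: eq_tsum => v a; rewrite tsum_ptens ?ffinjE ?linearZ //; lin_tac.
Qed.

Lemma right_pow_comodule (rho : {linear U -> U \ox D}) :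
  right_comodule rho -> right_comodule (linear_of (lin_right_pow rho)).
Proof.
move=> [rA r1]; have Fi := lin_ffinj; split; apply: ff_linext; try lin_tac; move=> j u.
  rewrite linear_ofE right_pow_inj !linear_tsum.
  pose G (t : U \ox (D \ox D)) := tsum t (fun v a => ffinj j v \ot a).
  have Gl : lin G by rewrite /G; lin_tac.
  transitivity (G (tassoc (tmap rho idfun (rho u)))).
    rewrite -{2}[rho u]tsumK !linear_tsum (lin_tsumE _ _ Gl); apply: eq_tsum => v a.
    rewrite /= !tmapE /= linear_ofE right_pow_inj ptens_tsuml linear_tsum tassoc_tsum.
    rewrite (lin_tsumE _ _ Gl); apply: eq_tsum => v' b.
    by rewrite /= tassocE /G tsum_ptens //; lin_tac.
  rewrite rA -{1}[rho u]tsumK linear_tsum (lin_tsumE _ _ Gl); apply: eq_tsum => v a.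
  by rewrite /= !tmapE /= /G tsum_ptens //; lin_tac.
rewrite linear_ofE right_pow_inj !linear_tsum -[X in _ = ffinj j X]r1 tmap_tsum linear_tsum.
rewrite (lin_tsumE _ _ (Fi j)); apply: eq_tsum => v a.
by rewrite /= tmapE !tunitrE (linZE _ _ (Fi j)).
Qed.

Lemma left_pow_comodule (rho : {linear U -> D \ox U}) :
  left_comodule rho -> left_comodule (linear_of (lin_left_pow rho)).
Proof.
move=> [rA r1]; have Fi := lin_ffinj; split; apply: ff_linext; try lin_tac; move=> j u.
  rewrite linear_ofE left_pow_inj !linear_tsum.
  pose G (t : D \ox (D \ox U)) := tsum t (fun a t => a \ot tsum t (fun b v => b \ot ffinj j v)).
  have Gl : lin G by rewrite /G; lin_tac.
  transitivity (G (tmap idfun rho (rho u))).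
    rewrite -rA -{2}[rho u]tsumK !linear_tsum (lin_tsumE _ _ Gl); apply: eq_tsum => a v.
    rewrite /= !tmapE /= !tassoc_tsum (lin_tsumE _ _ Gl); apply: eq_tsum => b c.
    by rewrite /G !tsum_ptens //; lin_tac.
  rewrite -{1}[rho u]tsumK linear_tsum (lin_tsumE _ _ Gl); apply: eq_tsum => a v.
  by rewrite /= !tmapE /= linear_ofE left_pow_inj /G tsum_ptens //; lin_tac.
rewrite linear_ofE left_pow_inj !linear_tsum -[X in _ = ffinj j X]r1 tmap_tsum linear_tsum.
rewrite (lin_tsumE _ _ (Fi j)); apply: eq_tsum => a v.
by rewrite /= tmapE !tunitlE (linZE _ _ (Fi j)).
Qed.

End Powers.

(** * Tensors with first legs in a right coideal subalgebra *)

Section CoidealSub.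
Variables (k : fieldType) (H : hopfAlgType k) (A : rcoideal_subalg H).

Lemma tens_sub_linext (U : lmodType k) (f g : H \ox H -> U) t : lin f -> lin g ->
  (forall a h, a \in rcs_pred A -> f (a \ot h) = g (a \ot h)) ->
  tens_sub [set` rcs_pred A] setT t -> f t = g t.
Proof.
move=> fl gl fg; apply: (@span_ind_linear _ _ _ (fun t => f t = g t)).
- by rewrite !lin0E.
- by move=> a u v fu fv; rewrite fl gl fu fv.
- by move=> _ [a [h [aA _ ->]]]; exact: fg.
Qed.

Lemma sw_coideal (U : lmodType k) (F G : H -> H -> U) a :
  (forall y, lin (F^~ y)) -> (forall x, lin (F x)) ->
  (forall y, lin (G^~ y)) -> (forall x, lin (G x)) ->
  (forall x y, x \in rcs_pred A -> F x y = G x y) ->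
  a \in rcs_pred A -> sw a F = sw a G.
Proof.
move=> Fl Fr Gl Gr FG /rcs_coideal.
apply: (tens_sub_linext (f := fun t => tsum t F) (g := fun t => tsum t G)); try lin_tac.
by move=> x y xA; rewrite !tsum_ptens // FG.
Qed.

Lemma tens_sub_slice (f : {linear H -> k^o}) t :
  tens_sub [set` rcs_pred A] setT t -> tsum t (fun a h => (f h : k) *: a) \in rcs_pred A.
Proof.
have [A1 AD _] := rcs_subalg A.
have A0 : 0 \in rcs_pred A by rewrite -(subrr 1) addrC -scaleN1r; exact: AD.
have Fl : lin (fun t => tsum t (fun a h : H => (f h : k) *: a)) by lin_tac.
apply: (@span_ind_linear _ _ _ (fun t => tsum t (fun a h : H => (f h : k) *: a) \in rcs_pred A)).
- by rewrite (lin0E Fl).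
- by move=> c u v uA vA; rewrite Fl; exact: AD.
- move=> _ [a [h [aA _ ->]]]; rewrite tsum_ptens; try lin_tac.
  by rewrite -[_ *: _]addr0; exact: AD.
Qed.

(** The z_j are gathered in one tensor over the s-th power of H, which yields a single independent
    family [h] for all of them. Slicing with the functionals dual to [h] shows that the coefficients
    stay in A. *)
Lemma tens_sub_family s (z : 'I_s -> H \ox H) :
  (forall j, tens_sub [set` rcs_pred A] setT (z j)) ->
  exists m (d : 'I_s -> 'I_m -> H) (h : 'I_m -> H),
    [/\ forall j l, d j l \in rcs_pred A, forall j, z j = \sum_l d j l \ot h l & has_dual h].
Proof.
move=> zA; have Fi := @lin_ffinj k s H; have p := @lin_ffproj k s H.
have [m [v [h [zv _ hd]]]] := tens_dual_families
  (\sum_j tsum (z j) (fun a b => ffinj j a \ot b)).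
have zE j : z j = \sum_l v l j \ot h l.
  transitivity (tsum (\sum_j tsum (z j) (fun a b => ffinj j a \ot b))
     (fun w b => (w : {ffun _ -> _}) j \ot b)); last first.
    rewrite zv tsum_sum; try lin_tac.
    by apply: eq_bigr => l _; rewrite tsum_ptens //; lin_tac.
  rewrite tsum_sum; try lin_tac.
  rewrite -[LHS](sum_delta j z); apply: eq_bigr => i _; rewrite tsum_tsum; try lin_tac.
  rewrite -[X in _ *: X]tsumK (lin_tsumE _ _ (lin_scale _ (@lin_id _ _))).
  by apply: eq_tsum => a b; rewrite tsum_ptens ?ffinjE ?ptensZl //; lin_tac.
exists m, (fun j l => v l j), h; split=> // j l.
have [f fh] := hd.
by rewrite -(slicer (fun l => v l j) l fh (@lin_id _ _)) -zE; exact: tens_sub_slice.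
Qed.

(* (a (x) q) |-> a_1 (x) q a_2 *)
Lemma tens_sub_twist t : tens_sub [set` rcs_pred A] setT t ->
  tens_sub [set` rcs_pred A] setT (tsum t (fun a q => sw a (fun x y => x \ot (q * y)))).
Proof.
have Fl : lin (fun t : H \ox H => tsum t (fun a q => sw a (fun x y => x \ot (q * y)))) by lin_tac.
apply: (@span_ind_linear _ _ _ (fun t => tens_sub _ _ (tsum t (fun a q => sw a (fun x y => x \ot (q * y)))))).
- by rewrite (lin0E Fl); exact: span0.
- by move=> c u v uA vA; rewrite Fl; exact: span_linear.
- move=> _ [a [q [aA _ ->]]]; rewrite tsum_ptens; try lin_tac.
  move: (comul a) (rcs_coideal aA).
  have Gl : lin (fun t : H \ox H => tsum t (fun x y => x \ot (q * y))) by lin_tac.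
  apply: (@span_ind_linear _ _ _ (fun t => tens_sub _ _ (tsum t (fun x y => x \ot (q * y))))).
  + by rewrite (lin0E Gl); exact: span0.
  + by move=> c u v uA vA; rewrite Gl; exact: span_linear.
  + move=> _ [x [y [xA _ ->]]]; rewrite tsum_ptens; try lin_tac.
    by apply: span_sub; exists x, (q * y).
Qed.

End CoidealSub.

(** * The coactions of C on H, and the kernel of [pi] *)

Section Coactions.
Variables (k : fieldType) (H : hopfAlgType k) (C : factor_coalg H).
Local Notation eps h := (counit h : k).
Local Notation pi := (@fc_pi k H C).
Local Notation A := (coinvariants C).

Definition right_coact : {linear H -> H \ox fc_type C} := tmap idfun pi \o comul.
Definition left_coact : {linear H -> fc_type C \ox H} := tmap pi idfun \o comul.

Lemma right_coactE h : right_coact h = sw h (fun a b => a \ot pi b).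
Proof. exact: tmap_tsum. Qed.

Lemma left_coactE h : left_coact h = sw h (fun a b => pi a \ot b).
Proof. exact: tmap_tsum. Qed.

Lemma fc_comul_tsum h : comul (pi h) = sw h (fun a b => pi a \ot pi b).
Proof. by rewrite [LHS]fc_comulE tmap_tsum. Qed.

Lemma fc_counit_pi h : counit (pi h) = counit h.
Proof. exact: fc_counitE. Qed.

Lemma right_coact_comodule : right_comodule right_coact.
Proof.
have lp := lin_fc_pi C; split=> h; rewrite right_coactE !linear_tsum.
  transitivity (sw h (fun a b => sw a (fun a1 a2 => a1 \ot (pi a2 \ot pi b)))).
    apply: eq_tsum => a b; rewrite -[LHS]/(tassoc (tmap right_coact idfun (a \ot pi b))).
    rewrite tmapE right_coactE tassoc_tsum tsum_tsum; try lin_tac.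
    by apply: eq_tsum => x y; rewrite tsum_ptens //; lin_tac.
  rewrite sw_coassoc; try lin_tac.
  by apply: eq_tsum => a b; rewrite [RHS]tmapE fc_comul_tsum ptens_tsumr.
rewrite -[RHS](sw_counitr (F := fun h => h)); last by lin_tac.
by apply: eq_tsum => a b; rewrite -[LHS]/(tunitr (tmap idfun counit (a \ot pi b))) tmapE tunitrE fc_counit_pi.
Qed.

Lemma left_coact_comodule : left_comodule left_coact.
Proof.
have lp := lin_fc_pi C; split=> h; rewrite left_coactE !linear_tsum.
  transitivity (sw h (fun a b => sw a (fun a1 a2 => pi a1 \ot (pi a2 \ot b)))).
    apply: eq_tsum => a b; rewrite -[LHS]/(tassoc (tmap comul idfun (pi a \ot b))).
    rewrite tmapE fc_comul_tsum tassoc_tsum tsum_tsum; try lin_tac.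
    by apply: eq_tsum => x y; rewrite tsum_ptens //; lin_tac.
  rewrite sw_coassoc; try lin_tac.
  by apply: eq_tsum => a b; rewrite [RHS]tmapE left_coactE ptens_tsumr.
rewrite -[RHS](sw_counitl (F := fun h => h)); last by lin_tac.
by apply: eq_tsum => a b; rewrite -[LHS]/(tunitl (tmap counit idfun (pi a \ot b))) tmapE tunitlE fc_counit_pi.
Qed.

Lemma left_lift_comb n (c : 'I_n -> 'I_n -> fc_type C) (a : 'I_n -> k) :
  left_liftable C -> comatrix c -> exists x : 'I_n -> H,
    (forall i, sw (x i) (fun a b => pi a \ot b) = \sum_j c i j \ot x j) /\
    (forall i, eps (x i) = a i).
Proof.
move=> lift cP; have [x xP] := choice (lift _ _ cP); have lp := lin_fc_pi C.
exists (fun i => \sum_l a l *: x l i); split=> i.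
  rewrite -left_coactE linear_sum.
  transitivity (\sum_l \sum_j a l *: (c i j \ot x l j)).
    apply: eq_bigr => l _; rewrite linearZ left_coactE; have [-> _] := xP l.
    by rewrite /= scaler_sumr.
  rewrite exchange_big; apply: eq_bigr => j _.
  by rewrite linear_sum; apply: eq_bigr => l _; rewrite linearZ.
rewrite linear_sum -[RHS](sum_delta i (fun l => a l : k^o)); apply: eq_bigr => l _.
by rewrite linearZ /=; have [_ ->] := xP l; exact: mulrC.
Qed.

Lemma right_lift_comb n (c : 'I_n -> 'I_n -> fc_type C) (a : 'I_n -> k) :
  right_liftable C -> comatrix c -> exists x : 'I_n -> H,
    (forall i, sw (x i) (fun a b => a \ot pi b) = \sum_j x j \ot c j i) /\
    (forall i, eps (x i) = a i).
Proof.
move=> lift cP; have [x xP] := choice (lift _ _ cP); have lp := lin_fc_pi C.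
exists (fun i => \sum_l a l *: x l i); split=> i.
  rewrite -right_coactE linear_sum.
  transitivity (\sum_l \sum_j a l *: (x l j \ot c j i)).
    apply: eq_bigr => l _; rewrite linearZ right_coactE; have [-> _] := xP l.
    by rewrite /= scaler_sumr.
  rewrite exchange_big; apply: eq_bigr => j _.
  rewrite (lin_sumE _ _ (lin_ptensl _ (@lin_id _ _))); apply: eq_bigr => l _.
  by rewrite ptensZl.
rewrite linear_sum -[RHS](sum_delta i (fun l => a l : k^o)); apply: eq_bigr => l _.
by rewrite linearZ /=; have [_ ->] := xP l; exact: mulrC.
Qed.

(** The kernel of [pi] is a right subcomodule of H, so h = sum_i a_i y_i with all y_i in it and
    eps(y_i) = 0. Liftings x_i with eps(x_i) = a_i reduce the element of [cotensor_aug] to -h. *)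
Lemma left_liftable_ker h : left_liftable C -> pi h = 0 -> span (aug_gen A) h.
Proof.
move=> lift h0; have lp := lin_fc_pi C.
have kp w : (pi : {linear H -> fc_type C}) w = 0 -> tmap pi idfun (right_coact w) = 0.
  move=> w0; transitivity (comul (pi w)); last by rewrite [pi w]w0 linear0.
  rewrite fc_comul_tsum right_coactE linear_tsum; apply: eq_tsum => a b.
  by rewrite /= tmapE.
have [n [y [c [a [cP y0 yc ->]]]]] := right_finiteness right_coact_comodule kp h0.
have [x [xc xa]] := left_lift_comb a lift cP.
have := @cotensor_aug k H C n y x c (fun i => etrans (esym (right_coactE _)) (yc i)) xc.
have -> : \sum_i (eps (y i) *: x i - eps (x i) *: y i) = - \sum_i a i *: y i.
  rewrite -sumrN; apply: eq_bigr => i _.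
  by rewrite -fc_counit_pi [pi _]y0 linear0 scale0r sub0r xa.
by move=> /(span_scale (-1)); rewrite scaleN1r opprK.
Qed.

(** As on the left, but the lifting is now the first factor of the cotensor element, and
    [cotensor_aug] returns h with a positive sign. *)
Lemma right_liftable_ker h : right_liftable C -> pi h = 0 -> span (aug_gen A) h.
Proof.
move=> lift h0; have lp := lin_fc_pi C.
have kp w : (pi : {linear H -> fc_type C}) w = 0 -> tmap idfun pi (left_coact w) = 0.
  move=> w0; transitivity (comul (pi w)); last by rewrite [pi w]w0 linear0.
  rewrite fc_comul_tsum left_coactE linear_tsum; apply: eq_tsum => a b.
  by rewrite /= tmapE.
have [n [y [c [a [cP y0 yc ->]]]]] := left_finiteness left_coact_comodule kp h0.
have [x [xc xa]] := right_lift_comb a lift cP.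
have := @cotensor_aug k H C n x y c xc (fun i => etrans (esym (left_coactE _)) (yc i)).
have -> // : \sum_i (eps (x i) *: y i - eps (y i) *: x i) = \sum_i a i *: y i.
apply: eq_bigr => i _.
by rewrite -[eps (y i)]fc_counit_pi [pi _]y0 linear0 scale0r subr0 xa.
Qed.

End Coactions.

(** * Linear relations over the coinvariants *)

Section EquationalCriteria.
Variables (k : fieldType) (H : hopfAlgType k) (C : factor_coalg H).
Local Notation eps h := (counit h : k).
Local Notation S := (@antipode k H).
Local Notation pi := (@fc_pi k H C).
Local Notation A := (coinvariants C).

(** Right multiplication by coinvariants commutes with the left coaction, so the solutions w of
    sum_j w_j b_j = 0 form a left subcomodule of the s-th power of H. Local finiteness writes g as
    sum_i a_i y_i with solutions y_i, and liftings x_i with eps(x_i) = a_i turn each coordinate into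
    an element of A (x) H. *)
Lemma right_equational s (b g : 'I_s -> H) : right_liftable C ->
  (forall j, b j \in rcs_pred A) -> \sum_j g j * b j = 0 ->
  exists m (d : 'I_s -> 'I_m -> H) (h : 'I_m -> H),
    [/\ forall j l, d j l \in rcs_pred A, forall j, g j = \sum_l h l * d j l &
        forall l, \sum_j d j l * b j = 0].
Proof.
move=> lift bA gb0; have lp := lin_fc_pi C; have ll := @lin_fc_lmulr k H C.
have Fi := @lin_ffinj k s H; have pj := @lin_ffproj k s H.
pose p (w : {ffun 'I_s -> H}) := \sum_j w j * b j.
have pl : lin p by rewrite /p; lin_tac.
have kp w : linear_of pl w = 0 -> tmap idfun (linear_of pl) (linear_of (lin_left_pow (left_coact C)) w) = 0.
  rewrite linear_ofE => pw; transitivity (left_coact C (p w)); last by rewrite pw linear0.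
  rewrite linear_ofE /left_pow /p !linear_sum; apply: eq_bigr => j _.
  rewrite left_coactE linear_tsum [left_coact C _]left_coactE tsum_tsum; try lin_tac.
  rewrite swM; try lin_tac.
  apply: eq_tsum => x y; rewrite tsum_ptens; try lin_tac.
  have -> : sw (b j) (fun c d => pi (x * c) \ot (y * d)) = pi x \ot (y * b j).
    transitivity (sw (b j) (fun u v => fc_lmul x (pi u) \ot (y * v))).
      by apply: eq_tsum => u v; rewrite fc_lmulE.
    rewrite (coinv_sw (F := fun u v => fc_lmul x u \ot (y * v))) //; try lin_tac.
    by rewrite fc_lmulE mulr1.
  rewrite /= tmapE /= linear_ofE /p; congr (_ \ot _).
  rewrite -[RHS](sum_delta j (fun i => y * b i)); apply: eq_bigr => i _.
  by rewrite ffinjE eq_sym scalerAl.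
have p0 : linear_of pl (finfun g) = 0.
  by rewrite linear_ofE /p -[RHS]gb0; apply: eq_bigr => j _; rewrite ffunE.
have [n [y [c [a [cP y0 yc ga]]]]] :=
  left_finiteness (left_pow_comodule s (left_coact_comodule C)) kp p0.
have [x [xc xa]] := right_lift_comb a lift cP.
have yjc j i : sw (y i j) (fun a b => pi a \ot b) = \sum_l c i l \ot y l j.
  rewrite -left_coactE -(left_pow_proj (left_coact C) j (y i)).
  rewrite -(linear_ofE (lin_left_pow (left_coact C))) yc tsum_sum; try lin_tac.
  by apply: eq_bigr => l _; rewrite tsum_ptens //; lin_tac.
(* The tensor for coordinate j is sum_i S(x_i2) y_ij (x) x_i1. Multiplying its legs in reverse order
   gives sum_i eps(x_i) y_ij = g_j; multiplying the first leg by b_j and summing over j gives 0,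
   since each y_i is a solution. *)
have [m [d [h [dA zd [f hf]]]]] := tens_sub_family (fun j => cotensor_coinv xc (yjc j)).
exists m, d, h; split=> // [j|l].
  have Gl : lin (fun t => tsum t (fun u v : H => v * u)) by lin_tac.
  transitivity (tsum (\sum_l d j l \ot h l) (fun u v => v * u)); last first.
    rewrite tsum_sum; try lin_tac.
    by apply: eq_bigr => l _; rewrite tsum_ptens //; lin_tac.
  rewrite -zd tsum_sum; try lin_tac.
  have -> : g j = (\sum_i a i *: y i) j by rewrite -ga ffunE.
  rewrite sum_ffunE; apply: eq_bigr => i _; rewrite ffunE.
  rewrite tsum_tsum; try lin_tac.
  rewrite -xa -[X in _ *: X]mul1r -(sw_antipoder (F := fun z => z * y i j)); try lin_tac.
  by apply: eq_tsum => u v; rewrite tsum_ptens ?mulrA //; lin_tac.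
rewrite -(slicer (fun l => \sum_j d j l * b j) l hf (@lin_id _ _)).
have -> : \sum_l (\sum_j d j l * b j) \ot h l = 0.
  transitivity (\sum_j tsum (\sum_l d j l \ot h l) (fun u v => (u * b j) \ot v)).
    under eq_bigr do rewrite (lin_sumE _ _ (lin_ptensl _ (@lin_id _ _))).
    rewrite exchange_big; apply: eq_bigr => j _; rewrite tsum_sum; try lin_tac.
    by apply: eq_bigr => i _; rewrite tsum_ptens //; lin_tac.
  transitivity (\sum_j \sum_i tsum (sw (x i) (fun u v => (S v * y i j) \ot u))
      (fun u v => (u * b j) \ot v)).
    by apply: eq_bigr => j _; rewrite -zd tsum_sum //; lin_tac.
  rewrite exchange_big big1 // => i _.
  transitivity (\sum_j sw (x i) (fun u v => (S v * y i j * b j) \ot u)).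
    apply: eq_bigr => j _; rewrite tsum_tsum; try lin_tac.
    by apply: eq_tsum => u v; rewrite tsum_ptens //; lin_tac.
  rewrite [LHS]exchange_big big1 // => q _.
  rewrite -(lin_sumE _ _ (lin_ptensl q.1 (@lin_id _ _))).
  under eq_bigr do rewrite -mulrA.
  have := y0 i; rewrite linear_ofE /p -mulr_sumr => ->.
  by rewrite mulr0 ptens0l.
by rewrite (lin0E (f := fun t => tsum t _)) //; lin_tac.
Qed.

Section Left.
Variable T : H -> H.
Hypotheses (ST : cancel T S) (TS : cancel S T).

(** In C the element T(a) [pi 1] equals T(a_2) [pi] (a_1) by coinvariance of a, and T(a_2) a_1 =
    eps(a). *)
Lemma coinv_antipodeV h a : a \in rcs_pred A -> pi (h * T a) = eps a *: pi h.
Proof.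
move=> aA; have Tl := lin_antipodeV ST TS; have lp := lin_fc_pi C.
have ll := @lin_fc_lmulr k H C; have lm := @lin_fc_lmul k H C.
transitivity (fc_lmul h (sw a (fun x y => fc_lmul (T y) (pi x)))).
  rewrite (coinv_sw (F := fun u v => fc_lmul (T v) u)) //; try lin_tac.
  by rewrite !fc_lmulE mulr1.
transitivity (fc_lmul h (sw a (fun x y => pi (T y * x)))).
  by congr fc_lmul; apply: eq_tsum => x y; rewrite fc_lmulE.
rewrite (sw_antipodeVl ST TS (F := fun z => pi z)); last by lin_tac.
by rewrite (linZE _ _ (ll h)) fc_lmulE mulr1.
Qed.

(** [T] carries b_j g_j to T(g_j) T(b_j), and [coinv_antipodeV] makes the solutions of sum_j w_j
    T(b_j) = 0 a right subcomodule. Local finiteness applies to the T(g_j), with [y] as the first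
    factor of the cotensor element and the lifting [x] as the second; [S] then leads back to g. *)
Lemma left_equational s (b g : 'I_s -> H) : left_liftable C ->
  (forall j, b j \in rcs_pred A) -> \sum_j b j * g j = 0 ->
  exists m (d : 'I_s -> 'I_m -> H) (h : 'I_m -> H),
    [/\ forall j l, d j l \in rcs_pred A, forall j, g j = \sum_l d j l * h l &
        forall l, \sum_j b j * d j l = 0].
Proof.
move=> lift bA gb0; have lp := lin_fc_pi C; have ll := @lin_fc_lmulr k H C.
have Fi := @lin_ffinj k s H; have pj := @lin_ffproj k s H; have Tl := lin_antipodeV ST TS.
pose p (w : {ffun 'I_s -> H}) := \sum_j w j * T (b j).
have pl : lin p by rewrite /p; lin_tac.
have kp w : linear_of pl w = 0 -> tmap (linear_of pl) idfun (linear_of (lin_right_pow (right_coact C)) w) = 0.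
  rewrite linear_ofE => pw; transitivity (right_coact C (p w)); last by rewrite pw linear0.
  rewrite linear_ofE /right_pow /p !linear_sum; apply: eq_bigr => j _.
  rewrite right_coactE linear_tsum [right_coact C _]right_coactE tsum_tsum; try lin_tac.
  rewrite swM; try lin_tac.
  apply: eq_tsum => x y; rewrite tsum_ptens; try lin_tac.
  have -> : sw (T (b j)) (fun c d => (x * c) \ot pi (y * d)) = (x * T (b j)) \ot pi y.
    rewrite (sw_antipodeV ST TS); try lin_tac.
    rewrite -[RHS](sw_counitl (F := fun d => (x * T d) \ot pi y)); try lin_tac.
    apply: (sw_coideal (A := A)) => //; try lin_tac.
    by move=> u v uA; rewrite coinv_antipodeV // linearZ.
  rewrite /= tmapE /= linear_ofE /p; congr (_ \ot _).
  rewrite -[RHS](sum_delta j (fun i => x * T (b i))); apply: eq_bigr => i _.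
  by rewrite ffinjE eq_sym scalerAl.
have p0 : linear_of pl [ffun j => T (g j)] = 0.
  transitivity (T (\sum_j b j * g j)); last by rewrite gb0 (lin0E Tl).
  rewrite linear_ofE /p (lin_sumE _ _ Tl).
  by apply: eq_bigr => j _; rewrite ffunE antipodeVM.
have [n [y [c [a [cP y0 yc ga]]]]] :=
  right_finiteness (right_pow_comodule s (right_coact_comodule C)) kp p0.
have [x [xc xa]] := left_lift_comb a lift cP.
have yjc j i : sw (y i j) (fun a b => a \ot pi b) = \sum_l y l j \ot c l i.
  rewrite -right_coactE -(right_pow_proj (right_coact C) j (y i)).
  rewrite -(linear_ofE (lin_right_pow (right_coact C))) yc tsum_sum; try lin_tac.
  by apply: eq_bigr => l _; rewrite tsum_ptens //; lin_tac.
(* [cotensor_coinv] gives S(r) x_i (x) q with q (x) r = comul (y_ij). The twist turns this into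
   S(r_2) x_i1 (x) q S(r_1) x_i2, where q S(r_1) cancels; S(y_ij) now stands undivided, ready to be
   multiplied by b_j. *)
pose z j := \sum_i sw (x i) (fun u v => (S (y i j) * u) \ot v).
have zA j : tens_sub [set` A] setT (z j).
  have := tens_sub_twist (cotensor_coinv (yjc j) xc).
  set t := (tsum _ _); have -> // : t = z j.
  rewrite /t tsum_sum; try lin_tac.
  apply: eq_bigr => i _; rewrite tsum_tsum; try lin_tac.
  transitivity (sw (y i j) (fun q r => sw r (fun r1 r2 => sw (x i) (fun u v =>
      (S r2 * u) \ot (q * S r1 * v))))).
    apply: eq_tsum => q r; rewrite tsum_ptens; try lin_tac.
    rewrite swM; try lin_tac.
    rewrite sw_antipode; try lin_tac.
    by apply: eq_tsum => r1 r2; apply: eq_tsum => u v; rewrite mulrA.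
  rewrite -(sw_coassoc (F := fun q r1 r2 => sw (x i) (fun u v =>
      (S r2 * u) \ot (q * S r1 * v)))); try lin_tac.
  rewrite -[RHS](sw_counitl (F := fun r => sw (x i) (fun u v => (S r * u) \ot v))); try lin_tac.
  apply: eq_tsum => q r.
  rewrite (sw_antipoder (F := fun w => sw (x i) (fun u v => (S r * u) \ot (w * v)))); try lin_tac.
  by congr (_ *: _); apply: eq_tsum => u v; rewrite mul1r.
have [m [d [h [dA zd [f hf]]]]] := tens_sub_family zA.
exists m, d, (fun l => S (h l)); split=> // [j|l].
  transitivity (tsum (z j) (fun u v => u * S v)); last first.
    rewrite zd tsum_sum; try lin_tac.
    by apply: eq_bigr => l _; rewrite tsum_ptens //; lin_tac.
  have -> : g j = S ((\sum_i a i *: y i) j) by rewrite -ga ffunE ST.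
  rewrite /z tsum_sum; try lin_tac.
  rewrite sum_ffunE linear_sum; apply: eq_bigr => i _; rewrite ffunE linearZ.
  rewrite tsum_tsum; try lin_tac.
  transitivity (sw (x i) (fun u v => S (y i j) * (u * S v))).
    by rewrite (sw_antipoder (F := fun z => S (y i j) * z)) ?mulr1 ?xa //; lin_tac.
  by apply: eq_tsum => u v; rewrite tsum_ptens ?mulrA //; lin_tac.
have yb i : \sum_j b j * S (y i j) = 0.
  transitivity (S (p (y i))).
    by rewrite /p linear_sum; apply: eq_bigr => j _; rewrite antipodeM ST.
  by rewrite -(linear_ofE pl) y0 linear0.
rewrite -(slicer (fun l => \sum_j b j * d j l) l hf (@lin_id _ _)).
have -> : \sum_l (\sum_j b j * d j l) \ot h l = 0.
  transitivity (\sum_j tsum (\sum_l d j l \ot h l) (fun u v => (b j * u) \ot v)).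
    under eq_bigr do rewrite (lin_sumE _ _ (lin_ptensl _ (@lin_id _ _))).
    rewrite exchange_big; apply: eq_bigr => j _; rewrite tsum_sum; try lin_tac.
    by apply: eq_bigr => i _; rewrite tsum_ptens //; lin_tac.
  transitivity (\sum_j \sum_i tsum (sw (x i) (fun u v => (S (y i j) * u) \ot v))
      (fun u v => (b j * u) \ot v)).
    by apply: eq_bigr => j _; rewrite -zd tsum_sum //; lin_tac.
  rewrite exchange_big big1 // => i _.
  transitivity (\sum_j sw (x i) (fun u v => (b j * S (y i j) * u) \ot v)).
    apply: eq_bigr => j _; rewrite tsum_tsum; try lin_tac.
    by apply: eq_tsum => u v; rewrite tsum_ptens ?mulrA //; lin_tac.
  rewrite [LHS]exchange_big big1 // => q _.
  rewrite -(lin_sumE _ _ (lin_ptensl q.2 (@lin_id _ _))).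
  by rewrite -mulr_suml yb mul0r ptens0l.
by rewrite (lin0E (f := fun t => tsum t _)) //; lin_tac.
Qed.
End Left.

End EquationalCriteria.

(** * Flatness and equations *)

Lemma morph_add_sum (U V : zmodType) (f : U -> V) (I : Type) (r : seq I) (P : pred I) (F : I -> U) :
  {morph f : x y / x + y} -> f (\sum_(i <- r | P i) F i) = \sum_(i <- r | P i) f (F i).
Proof.
by move=> fD; apply: big_morph => //; apply: (addrI (f 0)); rewrite -fD !addr0.
Qed.

Lemma big_keys (V : zmodType) (I : Type) (K : eqType) (r : seq I) (Z : seq K) (key : I -> K)
    (F : I -> V) : uniq Z -> all (fun i => key i \in Z) r ->
  \sum_(z <- Z) \sum_(i <- r | key i == z) F i = \sum_(i <- r) F i.
Proof.
move=> Zu; elim: r => [|i r IH] /=; first by rewrite big_nil big1 // => z _; rewrite big_nil.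
move=> /andP[iZ /IH rZ]; rewrite big_cons -rZ.
under eq_bigr do rewrite big_cons.
rewrite (bigD1_seq (key i)) //= [in RHS](bigD1_seq (key i)) //= eqxx addrA; congr (_ + _).
by apply: eq_bigr => z zi; rewrite eq_sym (negPf zi).
Qed.

Section EquationalFlatness.
Variables (R : nzRingType) (X : zmodType) (op : R -> {additive X -> X}).
Hypothesis opD : forall r s x, op (r + s) x = op r x + op s x.
Hypothesis opM : forall r s x, op (r * s) x = op s (op r x).
Hypothesis op1 : forall x, op 1 x = x.

Definition balanced (Y : lmodType R) (U : zmodType) (F : Y -> X -> U) : Prop :=
  [/\ forall y, {morph F y : x x' / x + x'}, forall x, {morph F^~ x : y y' / y + y'} &
      forall r y x, F (r *: y) x = F y (op r x)].

(** X is a right R-module given by operators. Left modules are covered by taking the converse ring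
    for R, so both flatness statements are instances of one argument. *)
Definition equational_criterion : Prop :=
  forall s (b : 'I_s -> R) (g : 'I_s -> X), \sum_j op (b j) (g j) = 0 ->
  exists m (d : 'I_s -> 'I_m -> R) (h : 'I_m -> X),
    (forall j, g j = \sum_l op (d j l) (h l)) /\ (forall l, \sum_j d j l * b j = 0).

Lemma op_suml (I : Type) (r : seq I) (P : pred I) (F : I -> R) x :
  op (\sum_(i <- r | P i) F i) x = \sum_(i <- r | P i) op (F i) x.
Proof. by apply: (morph_add_sum (f := fun a => op a x)) => a b; exact: opD. Qed.

Lemma op0 x : op 0 x = 0.
Proof. by apply: (addrI (op 0 x)); rewrite -opD !addr0. Qed.

Lemma opN r x : op (- r) x = - op r x.
Proof. by apply: (addrI (op r x)); rewrite -opD !subrr op0. Qed.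

(** Induction on the number of equations: a solution of the first q turns the last one into a single
    equation in the new generators [h]. Rows are indexed by [nat], so dropping the last one needs no
    reindexing; for q = 0 the identity matrix serves. *)
Lemma equational_system q s (b : nat -> 'I_s -> R) (g : 'I_s -> X) : equational_criterion ->
  (forall i, (i < q)%N -> \sum_j op (b i j) (g j) = 0) ->
  exists m (d : 'I_s -> 'I_m -> R) (h : 'I_m -> X),
    (forall j, g j = \sum_l op (d j l) (h l)) /\
    (forall i, (i < q)%N -> forall l, \sum_j d j l * b i j = 0).
Proof.
move=> EQ; elim: q => [|q IH] bg.
  exists s, (fun j l => (j == l)%:R), g; split=> // j.
  rewrite (bigD1 j) //= eqxx op1 big1 ?addr0 // => l lj.
  by rewrite eq_sym (negPf lj); rewrite op0.
have [i iq|m [d [h [gd db]]]] := IH; first by apply: bg; exact: ltnW.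
have [|m' [d' [h' [hd' db']]]] := EQ _ (fun l => \sum_j d j l * b q j) h.
  rewrite -[RHS](bg q) //; under eq_bigr do rewrite op_suml.
  rewrite exchange_big; apply: eq_bigr => j _; rewrite [in RHS]gd raddf_sum.
  by apply: eq_bigr => l _; rewrite opM.
exists m', (fun j p => \sum_l d' l p * d j l), h'; split=> [j|i].
  rewrite gd; under [RHS]eq_bigr do rewrite op_suml.
  rewrite exchange_big; apply: eq_bigr => l _; rewrite [in LHS]hd' raddf_sum.
  by apply: eq_bigr => p _; rewrite opM.
rewrite ltnS leq_eqVlt => /orP[/eqP -> p|iq p]; last first.
  under eq_bigr do rewrite mulr_suml.
  rewrite exchange_big big1 // => l _.
  under eq_bigr do rewrite -mulrA.
  by rewrite -mulr_sumr db ?mulr0.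
rewrite -[RHS](db' p); under eq_bigr do rewrite mulr_suml.
rewrite exchange_big; apply: eq_bigr => l _; rewrite mulr_sumr.
by apply: eq_bigr => j _; rewrite mulrA.
Qed.

Section Relations.
Variable Y : lmodType R.

(** The tensor of y and x is modelled by a function supported at y, so that vanishing modulo
    [relations] yields an equation in X at every point of Y. [zmodule] provides the integer module
    structure that [qmod] asks for. *)
Definition delta_fun (y : Y) (x : X) : zmodule (Y -> X) := fun z => if y == z then x else 0.

(* The functions [Y -> X] of finite support that vanish in the tensor product of
   [Y] and [X] because of a single relation between elements of [Y]. *)
Definition relation_fun (rho : seq (R * Y)) (n : X) : zmodule (Y -> X) :=
  fun z => \sum_(p <- rho | p.2 == z) op p.1 n.

Definition relations : set (zmodule (Y -> X)) :=
  [set u | exists rho n, \sum_(p <- rho) p.1 *: p.2 = 0 /\ u = relation_fun rho n].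

Definition delta_class (y : Y) (x : X) : qmod relations := qpi relations (delta_fun y x).

Lemma delta_class_balanced : balanced delta_class.
Proof.
split=> [y x x'|x y y'|r y x]; rewrite /delta_class.
- rewrite -qpiD; congr qpi; apply/funext => z.
  by rewrite /delta_fun [RHS]/GRing.add /=; case: eqP; rewrite ?addr0.
- rewrite -qpiD; apply/qpiP/span_sub.
  exists [:: (1, y + y'); (-1, y); (-1, y')], x; split.
    by rewrite !big_cons big_nil /= scale1r !scaleN1r addr0 -opprD subrr.
  apply/funext => z; rewrite /relation_fun !big_cons big_nil /=.
  rewrite /delta_fun -[LHS]/((if y + y' == z then x else 0) - ((if y == z then x else 0) + (if y' == z then x else 0))).
  by rewrite !opN !op1; do !case: eqP => _; rewrite ?addr0 ?sub0r ?opprD ?oppr0 ?addr0 ?add0r.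
- apply/qpiP/span_sub; exists [:: (1, r *: y); (-r, y)], x; split.
    by rewrite !big_cons big_nil /= scale1r scaleNr addr0 subrr.
  apply/funext => z; rewrite /relation_fun !big_cons big_nil /=.
  rewrite /delta_fun -[LHS]/((if r *: y == z then x else 0) - (if y == z then op r x else 0)).
  by rewrite op1 opN; do !case: eqP => _; rewrite ?addr0 ?sub0r ?oppr0 ?addr0 ?add0r.
Qed.

Lemma relations_span u : span relations u ->
  exists t (rho : 'I_t -> seq (R * Y)) (n : 'I_t -> X),
    (forall i, \sum_(p <- rho i) p.1 *: p.2 = 0) /\
    forall z, u z = \sum_i relation_fun (rho i) (n i) z.
Proof.
elim=> [|a _ v [rho [n [rho0 ->]]] _ [t [rho' [n' [rho'0 vE]]]]].
  exists 0, (fun=> [::]), (fun=> 0); split=> [i|z]; first by rewrite big_nil.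
  by rewrite big_ord0.
exists t.+1, (fun i => if unlift ord0 i is Some j then rho' j else rho),
  (fun i => if unlift ord0 i is Some j then n' j else n *~ a).
split=> [i|z]; first by case: unliftP => [j|] _.
rewrite big_ord_recl unlift_none; congr (_ + _); last first.
  by rewrite vE; apply: eq_bigr => j _; rewrite liftK.
rewrite /relation_fun.
transitivity ((\sum_(p <- rho | p.2 == z) op p.1 n) *~ a); last first.
  rewrite (morph_add_sum (f := fun x => x *~ a)); first by apply: eq_bigr => p _; rewrite raddfMz.
  by move=> x y; rewrite mulrzDl.
have nE (f : Y -> X) m : (f *+ m) z = f z *+ m.
  by elim: m => // m IH; rewrite !mulrS -IH.
by case: a => m; [exact: nE|exact: (congr1 -%R (nE (relation_fun rho n) m.+1))].
Qed.

End Relations.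

Lemma balanced_sumr (Y : lmodType R) (U : zmodType) (F : Y -> X -> U) (I : Type) (r : seq I)
    (P : pred I) (f : I -> X) y : balanced F ->
  F y (\sum_(i <- r | P i) f i) = \sum_(i <- r | P i) F y (f i).
Proof. by case=> FD _ _; exact: morph_add_sum (FD y). Qed.

Lemma balanced_suml (Y : lmodType R) (U : zmodType) (F : Y -> X -> U) (I : Type) (r : seq I)
    (P : pred I) (f : I -> Y) x : balanced F ->
  F (\sum_(i <- r | P i) f i) x = \sum_(i <- r | P i) F (f i) x.
Proof. by case=> _ FD _; apply: (morph_add_sum (f := F^~ x)); exact: FD. Qed.

(** The vanishing of sum f(y) (x) x says that, at each point z, the sum of the x with f(y) = z
    equals sum_i op(c_i(z)) n_i. Solving the equations at the points outside the image rewrites sum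
    F(y, x) as sum_l F(v_l, h_l) with f(v_l) = 0, and injectivity gives v_l = 0. *)
Lemma equational_injective (Y Y' : lmodType R) (f : {linear Y -> Y'}) (ys : seq (Y * X)) :
  equational_criterion -> injective f ->
  \sum_(p <- ys) delta_class (f p.1) p.2 = 0 ->
  forall (U : zmodType) (F : Y -> X -> U), balanced F -> \sum_(p <- ys) F p.1 p.2 = 0.
Proof.
move=> EQ fI ys0 U F bF.
have [t [rho [n [rho0 ysE]]]] :
    exists t (rho : 'I_t -> seq (R * Y')) (n : 'I_t -> X),
    (forall i, \sum_(p <- rho i) p.1 *: p.2 = 0) /\
    forall z, \sum_(p <- ys | f p.1 == z) p.2 = \sum_i relation_fun (rho i) (n i) z.
  have : span (@relations Y') (\sum_(p <- ys) delta_fun (f p.1) p.2 - 0).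
    apply/qpiP; rewrite linear0 -[RHS]ys0 linear_sum.
    by apply: eq_bigr.
  rewrite subr0 => /relations_span[t [rho [n [rho0 nE]]]].
  exists t, rho, n; split=> // z; rewrite -nE.
  rewrite (morph_add_sum (f := fun u : zmodule (Y' -> X) => u z)) //.
  by rewrite big_mkcond.
pose c i z := \sum_(q <- rho i | q.2 == z) q.1.
have cE z : \sum_(p <- ys | f p.1 == z) p.2 = \sum_i op (c i z) (n i).
  by rewrite ysE; apply: eq_bigr => i _; rewrite /relation_fun /c op_suml.
(* [Q] lists the first components occurring in [ys], and [L] the points of the relations outside
   f(Q). No x sits over a point of [L], so these points give homogeneous equations for the n_i. *)
pose Q := undup [seq p.1 | p <- ys].
pose L := undup [seq z <- flatten [seq [seq q.2 | q <- rho i] | i <- enum 'I_t] |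
                   z \notin [seq f y | y <- Q]].
have [|m [d [h [nd dL]]]] := equational_system (q := size L) (b := fun j i => c i (nth 0 L j)) (g := n) EQ.
  move=> j jL; rewrite -cE big_seq_cond big_pred0 // => p.
  apply/negP => /andP[pys /eqP fp].
  have : nth 0 L j \in L by exact: mem_nth.
  rewrite mem_undup mem_filter => /andP[/negP + _]; apply.
  by rewrite -fp map_f // mem_undup map_f.
pose v l := \sum_(y <- Q) (\sum_i d i l * c i (f y)) *: y.
have v0 l : v l = 0.
  apply: (fI); rewrite linear0 /v linear_sum.
  pose kap z := \sum_i d i l * c i z.
  (* [kap] vanishes on [L] by the solved system, so the points of [L] may be added to the sum.
     Regrouped by i, it then consists of multiples of the full relations rho_i, which are 0. *)
  transitivity (\sum_(z <- [seq f y | y <- Q] ++ L) kap z *: z).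
    rewrite big_cat /= big_map [X in _ = _ + X]big_seq [X in _ = _ + X]big1 ?addr0 => [|z zL].
      by apply: eq_bigr => y _; rewrite linearZ.
    by rewrite /kap -(nth_index 0 zL) dL ?scale0r // index_mem.
  under eq_bigr do rewrite scaler_suml.
  rewrite exchange_big big1 // => i _.
  under eq_bigr do rewrite -scalerA.
  rewrite -scaler_sumr -[RHS](scaler0 _ (d i l)); congr (_ *: _); rewrite -[RHS](rho0 i).
  rewrite -[RHS](big_keys (Z := [seq f y | y <- Q] ++ L) (key := snd)).
  - apply: eq_bigr => z _; rewrite /c scaler_suml.
    by apply: eq_bigr => q /eqP ->.
  - rewrite cat_uniq (map_inj_uniq fI) /Q /L !undup_uniq /= andbT.
    apply/hasPn => z; rewrite mem_undup mem_filter => /andP[+ _].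
    by [].
  - apply/allP => q qi; rewrite mem_cat mem_undup mem_filter.
    case: (boolP (_ \in _)) => //= _.
    by apply/flatten_mapP; exists i; rewrite ?mem_enum // map_f.
rewrite -(big_keys (Z := Q) (key := fst)); try exact: undup_uniq; last first.
  by apply/allP => p pys; rewrite mem_undup map_f.
transitivity (\sum_(y <- Q) F y (\sum_i op (c i (f y)) (n i))).
  apply: eq_bigr => y _; rewrite -cE.
  under [X in F y X]eq_bigl do rewrite (inj_eq fI).
  by rewrite (balanced_sumr _ _ _ _ bF); apply: eq_bigr => p /eqP ->.
transitivity (\sum_l F (v l) (h l)); last first.
  by apply: big1 => l _; rewrite v0; case: bF => _ FD _; apply: (addrI (F 0 (h l))); rewrite -FD !addr0.
under [RHS]eq_bigr do rewrite (balanced_suml _ _ _ _ bF).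
rewrite exchange_big; apply: eq_bigr => y _.
have [_ _ Fb] := bF.
transitivity (\sum_l F y (op (\sum_i d i l * c i (f y)) (h l))); last by apply: eq_bigr => l _; rewrite Fb.
rewrite -(balanced_sumr _ _ _ _ bF); congr (F y _).
under [RHS]eq_bigr do rewrite op_suml.
rewrite exchange_big; apply: eq_bigr => i _; rewrite [in LHS]nd raddf_sum.
by apply: eq_bigr => l _; rewrite opM.
Qed.

End EquationalFlatness.

(** * Balanced tensor products *)

Lemma morph_addMz (U V : zmodType) (f : U -> V) x (a : int) :
  {morph f : x y / x + y} -> f (x *~ a) = f x *~ a.
Proof.
move=> fD; have f0 : f 0 = 0 by apply: (addrI (f 0)); rewrite -fD !addr0.
have fn n : f (x *+ n) = f x *+ n by elim: n => [|n IH]; rewrite ?mulr0n // !mulrS fD IH.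
case: a => n; first exact: fn.
by apply: (addrI (f (x *+ n.+1))); rewrite -fD subrr f0 fn subrr.
Qed.

Section BalancedTensors.
Variables (R : nzRingType) (M : lmodType R^c) (N : lmodType R).
Implicit Types (m : M) (n : N) (r : R).

Local Notation bt := (qmod (@btens_rel R M N)).

Lemma bptensDl m m' n : bptens (m + m') n = bptens m n + bptens m' n :> bt.
Proof. by rewrite -qpiD; apply/qpiP/span_sub/btens_rel_addl. Qed.

Lemma bptensDr m n n' : bptens m (n + n') = bptens m n + bptens m n' :> bt.
Proof. by rewrite -qpiD; apply/qpiP/span_sub/btens_rel_addr. Qed.

Lemma bptens_bal m r n : bptens ((r : R^c) *: m) n = bptens m (r *: n) :> bt.
Proof. exact/qpiP/span_sub/btens_rel_bal. Qed.

Lemma btens_sum (t : bt) : exists s : seq (M * N), t = \sum_(p <- s) (bptens p.1 p.2 : bt).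
Proof.
rewrite -[t]qreprK -[qrepr t]freeg_sumE raddf_sum /=.
elim: (dom _) => [|[m n] s [s' IH]]; first by exists [::]; rewrite !big_nil.
exists ((m *~ coeff (m, n) (qrepr t), n) :: s').
rewrite !big_cons IH; congr (_ + _); set a := coeff _ _.
rewrite (morph_addMz (f := fun m => bptens m n : bt)); last by move=> *; exact: bptensDl.
have -> : << a *g (m, n) >> = a *: (bgen m n).
  by apply/eqP/freeg_eqP => z; rewrite coeffZ !coeffU mul1r.
by rewrite linearZ /= -[X in X *: _]intz scaler_int.
Qed.

Section Lift.
Variables (U : lmodType int) (F : M -> N -> U).
Hypotheses (FDl : forall n, {morph F^~ n : m m' / m + m'})
  (FDr : forall m, {morph F m : n n' / n + n'})
  (Fb : forall m r n, F ((r : R^c) *: m) n = F m (r *: n)).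

Definition btlift : bt -> U := qlift (fglift (fun p : M * N => F p.1 p.2)).

Lemma btlift_rel : forall s, btens_rel s -> fglift (fun p : M * N => F p.1 p.2) s = 0.
Proof.
move=> s [m m' n|m n n'|m r n]; rewrite linearB ?linearD /= !liftU !scale1r /=.
- by rewrite FDl -opprD subrr.
- by rewrite FDr -opprD subrr.
- by rewrite Fb subrr.
Qed.

Lemma btliftE m n : btlift (bptens m n) = F m n.
Proof. by rewrite /btlift qliftE; [rewrite /= liftU scale1r|exact: btlift_rel]. Qed.

Lemma btlift_is_linear : linear btlift.
Proof. by apply: qlift_is_linear; exact: btlift_rel. Qed.
HB.instance Definition _ := GRing.isLinear.Build int bt U *:%R btlift btlift_is_linear.

Lemma btlift_sum (I : Type) (r : seq I) (f : I -> bt) :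
  btlift (\sum_(i <- r) f i) = \sum_(i <- r) btlift (f i).
Proof. exact: linear_sum. Qed.

Lemma btliftB x y : btlift (x - y) = btlift x - btlift y.
Proof. exact: linearB. Qed.

End Lift.
End BalancedTensors.

Section Btmap.
Variables (R : nzRingType) (M M' : lmodType R^c) (N N' : lmodType R).
Variables (f : {linear M -> M'}) (g : {linear N -> N'}).

Let F (m : M) (n : N) : qmod (@btens_rel R M' N') := bptens (f m) (g n).
Let FDl n : {morph F^~ n : m m' / m + m'}.
Proof. by move=> m m'; rewrite /F linearD bptensDl. Qed.
Let FDr m : {morph F m : n n' / n + n'}.
Proof. by move=> n n'; rewrite /F linearD bptensDr. Qed.
Let Fb (m : M) (r : R) (n : N) : F ((r : R^c) *: m) n = F m (r *: n).
Proof. by rewrite /F !linearZ; exact: bptens_bal. Qed.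

Lemma btmapE m n : btmap f g (bptens m n) = bptens (f m) (g n).
Proof. exact: btliftE FDl FDr Fb _ _. Qed.

Lemma btmap_sum (I : Type) (r : seq I) (h : I -> qmod (@btens_rel R M N)) :
  btmap f g (\sum_(i <- r) h i) = \sum_(i <- r) (btmap f g (h i) : qmod _).
Proof. exact: (btlift_sum FDl FDr Fb). Qed.

Lemma btmapB (x y : qmod (@btens_rel R M N)) :
  btmap f g (x - y) = (btmap f g x : qmod _) - (btmap f g y : qmod _).
Proof. exact: (btliftB FDl FDr Fb). Qed.

Lemma btmap_injective :
  (forall s : seq (M * N), \sum_(p <- s) (bptens (f p.1) (g p.2) : qmod _) = 0 ->
    \sum_(p <- s) (bptens p.1 p.2 : qmod _) = 0) -> injective (btmap f g).
Proof.
move=> inj x y xy; apply/eqP; rewrite -subr_eq0; apply/eqP.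
have [s xyE] := btens_sum (x - y).
rewrite xyE; apply: inj.
have := btmapB x y; rewrite xy subrr xyE btmap_sum => E.
by rewrite -[RHS]E; apply: eq_bigr => p _; rewrite btmapE.
Qed.

End Btmap.

Section FlatEquational.
Variable R : nzRingType.

Definition left_op (N : lmodType R) (r : R^c) : {additive N -> N} := *:%R (r : R).
Definition right_op (M : lmodType R^c) (r : R) : {additive M -> M} := *:%R (r : R^c).

Lemma left_opD N (r r' : R^c) x : left_op N (r + r') x = left_op N r x + left_op N r' x.
Proof. exact: scalerDl. Qed.
Lemma left_opM N (r r' : R^c) x : left_op N (r * r') x = left_op N r' (left_op N r x).
Proof. by rewrite /left_op /= scalerA. Qed.
Lemma left_op1 N x : left_op N 1 x = x.
Proof. exact: scale1r. Qed.

Lemma right_opD M (r r' : R) x : right_op M (r + r') x = right_op M r x + right_op M r' x.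
Proof. exact: (scalerDl (x : M) (r : R^c) (r' : R^c)). Qed.
Lemma right_opM M (r r' : R) x : right_op M (r * r') x = right_op M r' (right_op M r x).
Proof. by rewrite /right_op /= scalerA. Qed.
Lemma right_op1 M x : right_op M 1 x = x.
Proof. exact: (scale1r (x : M)). Qed.

(** [delta_class] is balanced, so it carries the hypothesis from the presented tensor product to the
    function model, where [equational_injective] applies with the canonical pairing as [F]. *)
Lemma flat_left_equational (N : lmodType R) :
  equational_criterion (left_op N) -> flat_left_module N.
Proof.
move=> EQ M M' f fI; apply: btmap_injective => s s0.
have [Dr Dl B] := delta_class_balanced (@left_opD N) (@left_op1 N) M'.
apply: (@equational_injective R^c N (left_op N) (@left_opD N) (@left_opM N) (@left_op1 N)
  M M' f s EQ fI _ _ (fun m n => bptens m n : qmod (@btens_rel R M N))).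
  transitivity (btlift (delta_class (left_op N) (Y := M'))
     (\sum_(p <- s) (bptens (f p.1) p.2 : qmod (@btens_rel R M' N)))).
    by rewrite btlift_sum //; apply: eq_bigr => p _; rewrite btliftE.
  have /= -> := s0.
  by rewrite -[X in btlift _ X](subrr 0) btliftB // subrr.
split=> [m n n'|n m m'|r m n] /=; [exact: bptensDr|exact: bptensDl|exact: bptens_bal].
Qed.

Lemma flat_right_equational (M : lmodType R^c) :
  equational_criterion (right_op M) -> flat_right_module M.
Proof.
move=> EQ N N' g gI; apply: btmap_injective => s s0.
have [Dr Dl B] := delta_class_balanced (@right_opD M) (@right_op1 M) N'.
pose D (m : M) (n : N') := delta_class (right_op M) n m.
have Db m (r : R) n : D ((r : R^c) *: m) n = D m (r *: n) by rewrite /D B.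
have := @equational_injective R M (right_op M) (@right_opD M) (@right_opM M) (@right_op1 M)
  N N' g [seq (p.2, p.1) | p <- s] EQ gI _ _ (fun n m => bptens m n : qmod (@btens_rel R M N)).
rewrite !big_map /=; apply.
  transitivity (btlift D (\sum_(p <- s) (bptens p.1 (g p.2) : qmod (@btens_rel R M N')))).
    by rewrite btlift_sum //; apply: eq_bigr => p _; rewrite btliftE.
  have /= -> := s0.
  by rewrite -[X in btlift _ X](subrr 0) btliftB // subrr.
split=> [n m m'|m n n'|r n m] /=; [exact: bptensDl|exact: bptensDr|exact/esym/bptens_bal].
Qed.

End FlatEquational.

Section FlatTransfer.
Variables (k : fieldType) (H : hopfAlgType k) (A : rcoideal_subalg H).

Lemma left_flat_equational :
  (forall s (b g : 'I_s -> H), (forall j, b j \in rcs_pred A) -> \sum_j b j * g j = 0 ->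
   exists m (d : 'I_s -> 'I_m -> H) (h : 'I_m -> H),
    [/\ forall j l, d j l \in rcs_pred A, forall j, g j = \sum_l d j l * h l &
        forall l, \sum_j b j * d j l = 0]) -> left_flat A.
Proof.
move=> EQ; apply: flat_left_equational => s b g bg.
have [m [d [h [dA gd bd]]]] := EQ s (fun j => val (b j : rcs_type A)) g (fun j => valP (b j)) bg.
exists m, (fun j l => Sub (d j l) (dA j l) : rcs_type A), h; split=> [j|l].
  by rewrite [LHS]gd; apply: eq_bigr => l _; rewrite /= /left_act.
apply: (@val_inj _ _ (rcs_type A)); rewrite /= -[RHS](bd l).
transitivity (\sum_j val ((b j : rcs_type A) * Sub (d j l) (dA j l) : rcs_type A)).
  by apply: (@morph_add_sum (rcs_type A) H val) => x y; exact: rmorphD.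
by apply: eq_bigr => j _; rewrite rmorphM.
Qed.

Lemma right_flat_equational :
  (forall s (b g : 'I_s -> H), (forall j, b j \in rcs_pred A) -> \sum_j g j * b j = 0 ->
   exists m (d : 'I_s -> 'I_m -> H) (h : 'I_m -> H),
    [/\ forall j l, d j l \in rcs_pred A, forall j, g j = \sum_l h l * d j l &
        forall l, \sum_j d j l * b j = 0]) -> right_flat A.
Proof.
move=> EQ; apply: flat_right_equational => s b g bg.
have [m [d [h [dA gd bd]]]] := EQ s (fun j => val (b j : rcs_type A)) g (fun j => valP (b j)) bg.
exists m, (fun j l => Sub (d j l) (dA j l) : rcs_type A), h; split=> [j|l].
  by rewrite [LHS]gd; apply: eq_bigr => l _; rewrite /= /right_act.
apply: (@val_inj _ _ (rcs_type A)); rewrite /= -[RHS](bd l).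
transitivity (\sum_j val (Sub (d j l) (dA j l) * (b j : rcs_type A) : rcs_type A)).
  by apply: (@morph_add_sum (rcs_type A) H val) => x y; exact: rmorphD.
by apply: eq_bigr => j _; rewrite rmorphM.
Qed.

End FlatTransfer.

(** * Flat modules and kernels of linear maps *)

Section FlatKernel.
Variable R : nzRingType.

Lemma ker_span (S : nzRingType) (M M' : lmodType S) (phi : {linear M -> M'}) :
  span [set m | phi m = 0] = [set m | phi m = 0].
Proof.
apply: span_id => [|a u v u0 v0]; first exact: linear0.
by rewrite /= linearP u0 v0 scaler0 addr0.
Qed.

Lemma ker_qlift (S : nzRingType) (M M' : lmodType S) (phi : {linear M -> M'}) :
  exists g : {linear qmod [set m | phi m = 0] -> M'},
    injective g /\ forall m, g (qpi _ m) = phi m.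
Proof.
have k0 s : [set m | phi m = 0] s -> phi s = 0 by [].
pose gl := GRing.isLinear.Build S _ M' *:%R (qlift phi) (qlift_is_linear k0).
pose g : {linear qmod [set m | phi m = 0] -> M'} := HB.pack (qlift phi) gl.
have gE m : g (qpi _ m) = phi m by exact: (qliftE k0).
exists g; split=> // x y; rewrite -[x]qreprK -[y]qreprK !gE => xy.
by apply/qpiP/span_sub; rewrite /= linearB xy subrr.
Qed.

(** [phi] induces an injection of M / ker phi into M', which flatness preserves, and [theta]
    descends to M / ker phi. Testing with [theta] takes the place of identifying the kernel of the
    tensored map. *)
Lemma flat_left_ker (M M' : lmodType R^c) (N : lmodType R) (phi : {linear M -> M'})
    (U : zmodType) (theta : M -> N -> U) (s : seq (M * N)) : flat_left_module N ->
  (forall n, {morph theta^~ n : m m' / m + m'}) ->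
  (forall m, {morph theta m : n n' / n + n'}) ->
  (forall m (r : R) n, theta ((r : R^c) *: m) n = theta m (r *: n)) ->
  (forall m n, phi m = 0 -> theta m n = 0) ->
  \sum_(p <- s) (bptens (phi p.1) p.2 : qmod (@btens_rel R M' N)) = 0 ->
  \sum_(p <- s) theta p.1 p.2 = 0.
Proof.
move=> fl Dl Dr B t0 s0; have [g [gI gE]] := ker_qlift phi.
pose th (x : qmod [set m | phi m = 0]) n : zmodule U := theta (qrepr x) n.
have thE m n : th (qpi _ m) n = theta m n.
  have := qreprP [set m | phi m = 0] m; rewrite ker_span /= => q0.
  by rewrite /th -[X in theta X n](subrK m) Dl t0 ?add0r.
have thl n : {morph th^~ n : x y / x + y}.
  by move=> x y /=; rewrite -[x]qreprK -[y]qreprK -qpiD !thE Dl.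
have thr m : {morph th m : x y / x + y} by move=> x y; exact: Dr.
have thb m (r : R) n : th ((r : R^c) *: m) n = th m (r *: n).
  by rewrite -[m]qreprK -linearZ !thE B.
transitivity (btlift th (\sum_(p <- s) (bptens (qpi _ p.1) p.2 : qmod _))).
  by rewrite btlift_sum //; apply: eq_bigr => p _; rewrite btliftE // thE.
have -> : \sum_(p <- s) (bptens (qpi _ p.1) p.2 : qmod (@btens_rel R (qmod [set m | phi m = 0]) N)) = 0.
  apply: (fl _ _ g gI); transitivity (0 : qmod (@btens_rel R M' N)).
    by rewrite -[RHS]s0 btmap_sum; apply: eq_bigr => p _; rewrite btmapE gE.
  by rewrite -[X in btmap _ _ X](subrr 0) btmapB subrr.
by rewrite -[X in btlift _ X](subrr 0) btliftB // subrr.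
Qed.

Lemma flat_right_ker (M : lmodType R^c) (N N' : lmodType R) (phi : {linear N -> N'})
    (U : zmodType) (theta : M -> N -> U) (s : seq (M * N)) : flat_right_module M ->
  (forall n, {morph theta^~ n : m m' / m + m'}) ->
  (forall m, {morph theta m : n n' / n + n'}) ->
  (forall m (r : R) n, theta ((r : R^c) *: m) n = theta m (r *: n)) ->
  (forall m n, phi n = 0 -> theta m n = 0) ->
  \sum_(p <- s) (bptens p.1 (phi p.2) : qmod (@btens_rel R M N')) = 0 ->
  \sum_(p <- s) theta p.1 p.2 = 0.
Proof.
move=> fl Dl Dr B t0 s0; have [g [gI gE]] := ker_qlift phi.
pose th m (x : qmod [set n | phi n = 0]) : zmodule U := theta m (qrepr x).
have thE m n : th m (qpi _ n) = theta m n.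
  have := qreprP [set n | phi n = 0] n; rewrite ker_span /= => q0.
  by rewrite /th -[X in theta m X](subrK n) Dr t0 ?add0r.
have thl n : {morph th^~ n : x y / x + y} by move=> x y; exact: Dl.
have thr m : {morph th m : x y / x + y}.
  by move=> x y /=; rewrite -[x]qreprK -[y]qreprK -qpiD !thE Dr.
have thb m (r : R) n : th ((r : R^c) *: m) n = th m (r *: n).
  by rewrite -[n]qreprK -linearZ !thE B.
transitivity (btlift th (\sum_(p <- s) (bptens p.1 (qpi _ p.2) : qmod _))).
  by rewrite btlift_sum //; apply: eq_bigr => p _; rewrite btliftE // thE.
have -> : \sum_(p <- s) (bptens p.1 (qpi _ p.2) : qmod (@btens_rel R M (qmod [set n | phi n = 0]))) = 0.
  apply: (fl _ _ g gI); transitivity (0 : qmod (@btens_rel R M N')).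
    by rewrite -[RHS]s0 btmap_sum; apply: eq_bigr => p _; rewrite btmapE gE.
  by rewrite -[X in btmap _ _ X](subrr 0) btmapB subrr.
by rewrite -[X in btlift _ X](subrr 0) btliftB // subrr.
Qed.

End FlatKernel.

(** * The vector space structure of a tensor product over a k-algebra *)

Section KBtens.
Variables (k : fieldType) (R : algType k) (M : lmodType R^c) (N : lmodType R).

(** The scalars of R are central, so they act on M by R-linear maps and hence on the tensor product.
    This turns an abelian group into a k-space, in which Sweedler sums make sense. *)
Definition cscale (c : k) (m : M) : M := ((c%:A : R) : R^c) *: m.

Lemma cscale_is_linear c : linear (cscale c).
Proof.
move=> r u v; rewrite /cscale scalerDr !scalerA; congr (_ *: _ + _).
by rewrite -[LHS]/((r : R) * c%:A) -[RHS]/(c%:A * (r : R)) mulr_algl mulr_algr.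
Qed.
HB.instance Definition _ c :=
  GRing.isLinear.Build R^c M M *:%R (cscale c) (cscale_is_linear c).

Definition kbt : Type := qmod (@btens_rel R M N).
HB.instance Definition _ := GRing.Zmodule.on kbt.

Definition kptens (m : M) (n : N) : kbt := bptens m n.

Definition kscale (c : k) (t : kbt) : kbt := btmap (cscale c) idfun t.

Lemma kbt_sum (t : kbt) : exists s : seq (M * N), t = \sum_(p <- s) kptens p.1 p.2.
Proof. exact: btens_sum. Qed.

Lemma kscale_sum c (s : seq (M * N)) :
  kscale c (\sum_(p <- s) kptens p.1 p.2) = \sum_(p <- s) kptens (cscale c p.1) p.2.
Proof. by rewrite [LHS]btmap_sum; apply: eq_bigr => p _; exact: btmapE. Qed.

Lemma kscaleA a b x : kscale a (kscale b x) = kscale (a * b) x.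
Proof.
have [s ->] := kbt_sum x; rewrite !kscale_sum.
have := kscale_sum a [seq (cscale b p.1, p.2) | p <- s]; rewrite !big_map /= => ->.
apply: eq_bigr => p _; congr kptens; rewrite /cscale scalerA; congr (_ *: _).
by rewrite -[LHS]/((b%:A : R) * a%:A) mulr_algl scalerA mulrC.
Qed.

Lemma kscale1 : left_id 1 kscale.
Proof.
move=> x; have [s ->] := kbt_sum x; rewrite !kscale_sum.
by apply: eq_bigr => p _; rewrite /cscale scale1r (scale1r (p.1 : M)).
Qed.

Lemma kscaleDr : right_distributive kscale +%R.
Proof.
move=> c x y; have [s ->] := kbt_sum x; have [s' ->] := kbt_sum y.
by rewrite -big_cat !kscale_sum big_cat.
Qed.

Lemma kscaleDl x : {morph kscale^~ x : a b / a + b}.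
Proof.
move=> a b /=; have [s ->] := kbt_sum x; rewrite !kscale_sum -big_split.
by apply: eq_bigr => p _ /=; rewrite /cscale scalerDl (scalerDl (p.1 : M)); exact: bptensDl.
Qed.

HB.instance Definition _ := GRing.Zmodule_isLmodule.Build k kbt
  kscaleA kscale1 kscaleDr kscaleDl.

Lemma kptensZl c m n : kptens (((c%:A : R) : R^c) *: m) n = c *: kptens m n.
Proof. exact/esym/btmapE. Qed.

Lemma kptens_bal (m : M) (r : R) (n : N) : kptens ((r : R^c) *: m) n = kptens m (r *: n).
Proof. exact: bptens_bal. Qed.

End KBtens.

Section Pairing.
Variables (k : fieldType) (H : hopfAlgType k) (A : rcoideal_subalg H).
Local Notation S := (@antipode k H).
Local Notation C := (quotient_coalg A).
Local Notation pi := (@fc_pi k H C).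
Local Notation eps h := (counit h : k).

Lemma quot_pi h a : a \in rcs_pred A -> pi (h * a) = eps a *: pi h.
Proof.
move=> aA; rewrite -linearZ; apply/fc_pi_eq; apply/asboolP; exact: aug_gen_span.
Qed.

Section Beta.
Variables (K : lmodType k) (kap : H -> H -> K).
Hypotheses (kl : forall y, lin (kap^~ y)) (kr : forall x, lin (kap x)).
Hypothesis kb : forall x a y, a \in rcs_pred A -> kap (x * a) y = kap x (a * y).

Lemma beta_lin : lin (fun h => sw h (fun x y => kap x (S y))).
Proof. lin_tac. Qed.

(** The translation map pi(h) |-> h_1 (x)_A S(h_2), composed with the map induced by the balanced
    [kap]. *)
Definition beta (c : fc_type C) : K := qlift (linear_of beta_lin) c.

(** At h a, the legs a_1 in A move across [kap], which leaves kap(h_1, a_1 S(a_2) S(h_2)) = eps(a)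
    kap(h_1, S(h_2)); this is 0 for a in A^+. *)
Lemma beta_ker s : [set` fc_ker C] s -> linear_of beta_lin s = 0.
Proof.
move=> /asboolP; apply: (@span_ind_linear _ _ _ (fun s => linear_of beta_lin s = 0)).
- exact: linear0.
- by move=> a u v u0 v0; rewrite linearP u0 v0 scaler0 addr0.
move=> _ [h [a [aA a0 ->]]]; rewrite linear_ofE swM; try lin_tac.
transitivity (sw h (fun x y => (eps a : k) *: kap x (S y))); last first.
  by rewrite a0; apply: big1 => p _; rewrite scale0r.
apply: eq_tsum => x y.
rewrite (sw_coideal (A := A) (G := fun u v => kap x (u * S (y * v)))) //; try lin_tac; last first.
  by move=> u v uA; rewrite kb.
transitivity (sw a (fun u v => kap x (u * S v * S y))).
  by apply: eq_tsum => u v; rewrite antipodeM mulrA.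
by rewrite (sw_antipoder (F := fun z => kap x (z * S y))) ?mul1r //; lin_tac.
Qed.

Lemma betaE h : beta (pi h) = sw h (fun x y => kap x (S y)).
Proof. by rewrite /beta [qlift _ _](qliftE beta_ker) linear_ofE. Qed.

Lemma lin_beta : lin beta.
Proof. exact: qlift_is_linear beta_ker. Qed.
End Beta.

End Pairing.

(** [rext] and [lext] are two names for W (x) H, so that right and left multiplication by A on the
    factor H can be separate canonical module structures. The parameter [A] records the acting
    algebra. *)
Definition rext (k : fieldType) (H : hopfAlgType k) (A : rcoideal_subalg H)
  (W : lmodType k) : Type := W \ox H.
Definition lext (k : fieldType) (H : hopfAlgType k) (A : rcoideal_subalg H)
  (W : lmodType k) : Type := W \ox H.

Section Extension.
Variables (k : fieldType) (H : hopfAlgType k) (A : rcoideal_subalg H) (W : lmodType k).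
Local Notation rext := (@rext k H A W).
Local Notation lext := (@lext k H A W).

HB.instance Definition _ := GRing.Zmodule.on rext.
HB.instance Definition _ := GRing.Zmodule.on lext.

Definition rext_act (a : (rcs_type A)^c) (t : rext) : rext :=
  tmap idfun (rmul (val (a : rcs_type A))) t.
Definition lext_act (a : rcs_type A) (t : lext) : lext := tmap idfun (lmul (val a)) t.

Lemma rext_actA a b t : rext_act a (rext_act b t) = rext_act (a * b) t.
Proof.
move: t; apply: lin_ext; rewrite /rext_act; try lin_tac.
by move=> w h; rewrite !tmapE; congr (_ \ot _); exact/esym/mulrA.
Qed.
Lemma rext_act1 : left_id 1 rext_act.
Proof.
apply: lin_ext; rewrite /rext_act; try lin_tac.
by move=> w h; rewrite !tmapE; congr (_ \ot _); exact: mulr1.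
Qed.
Lemma rext_actDr : right_distributive rext_act +%R.
Proof. by move=> a x y; exact: linearD. Qed.
Lemma rext_actDl t : {morph rext_act^~ t : a b / a + b}.
Proof.
move=> a b; move: t; apply: lin_ext; rewrite /rext_act; try lin_tac.
by move=> w h; rewrite !tmapE -linearD; congr (_ \ot _); exact: mulrDr.
Qed.
HB.instance Definition _ := GRing.Zmodule_isLmodule.Build (rcs_type A)^c rext
  rext_actA rext_act1 rext_actDr rext_actDl.

Lemma lext_actA a b t : lext_act a (lext_act b t) = lext_act (a * b) t.
Proof.
move: t; apply: lin_ext; rewrite /lext_act; try lin_tac.
by move=> w h; rewrite !tmapE; congr (_ \ot _); exact: mulrA.
Qed.
Lemma lext_act1 : left_id 1 lext_act.
Proof.
apply: lin_ext; rewrite /lext_act; try lin_tac.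
by move=> w h; rewrite !tmapE; congr (_ \ot _); exact: mul1r.
Qed.
Lemma lext_actDr : right_distributive lext_act +%R.
Proof. by move=> a x y; exact: linearD. Qed.
Lemma lext_actDl t : {morph lext_act^~ t : a b / a + b}.
Proof.
move=> a b; move: t; apply: lin_ext; rewrite /lext_act; try lin_tac.
by move=> w h; rewrite !tmapE -linearD; congr (_ \ot _); exact: mulrDl.
Qed.
HB.instance Definition _ := GRing.Zmodule_isLmodule.Build (rcs_type A) lext
  lext_actA lext_act1 lext_actDr lext_actDl.

End Extension.

(** * Dominions and coinvariants *)

Section Pairings.
Variables (k : fieldType) (H : hopfAlgType k) (A : rcoideal_subalg H).
Local Notation S := (@antipode k H).
Local Notation C := (quotient_coalg A).
Local Notation pi := (@fc_pi k H C).
Local Notation eps h := (counit h : k).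
Local Notation AR := (as_right_module A).
Local Notation AL := (as_left_module A).
Local Notation R := (rcs_type A).

Lemma scale_left_module c (h : H) : ((c%:A : R) *: (h : AL) : AL) = c *: h :> H.
Proof. by rewrite -[LHS]/(c%:A * h) mulr_algl. Qed.

Lemma scale_right_module c (h : H) : (((c%:A : R) : R^c) *: (h : AR) : AR) = c *: h :> H.
Proof. by rewrite -[LHS]/(h * c%:A) mulr_algr. Qed.

Lemma scale_rext (W : lmodType k) c (t : W \ox H) :
  (((c%:A : R) : R^c) *: (t : @rext k H A W) : @rext k H A W) = c *: t :> W \ox H.
Proof.
rewrite -[LHS]/(tmap idfun (rmul (c%:A : H)) t).
move: t; apply: lin_ext; try lin_tac.
by move=> w h; rewrite tmapE /= /rmul mulr_algr linearZ.
Qed.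

Lemma scale_lext (W : lmodType k) c (t : W \ox H) :
  ((c%:A : R) *: (t : @lext k H A W) : @lext k H A W) = c *: t :> W \ox H.
Proof.
rewrite -[LHS]/(tmap idfun (lmul (c%:A : H)) t).
move: t; apply: lin_ext; try lin_tac.
by move=> w h; rewrite tmapE /= /lmul mulr_algl linearZ.
Qed.

Definition mod_pair (x y : H) : kbt AR AL :=
  kptens (x : AR) (y : AL).
Definition rext_pair (W : lmodType k) (t : W \ox H) (y : H) : kbt (@rext k H A W) AL :=
  kptens (t : @rext k H A W) (y : AL).
Definition lext_pair (W : lmodType k) (x : H) (t : W \ox H) : kbt AR (@lext k H A W) :=
  kptens (x : AR) (t : @lext k H A W).

Lemma lin_mod_pairl y : lin (mod_pair^~ y).
Proof.
by move=> c u v; rewrite /mod_pair -scale_right_module -kptensZl; exact: bptensDl.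
Qed.
Lemma lin_mod_pairr x : lin (mod_pair x).
Proof.
move=> c u v; rewrite /mod_pair -scale_left_module -kptensZl kptens_bal; exact: bptensDr.
Qed.
Lemma mod_pair_bal a x y : a \in rcs_pred A -> mod_pair (x * a) y = mod_pair x (a * y).
Proof. by move=> aA; exact: (kptens_bal (x : AR) (Sub a aA : R) (y : AL)). Qed.

Lemma lin_rext_pairl (W : lmodType k) y : lin (fun t : W \ox H => rext_pair t y).
Proof. by move=> c u v; rewrite /rext_pair -scale_rext -kptensZl; exact: bptensDl. Qed.
Lemma lin_rext_pairr (W : lmodType k) (t : W \ox H) : lin (rext_pair t).
Proof.
move=> c u v; rewrite /rext_pair -scale_left_module -kptensZl kptens_bal; exact: bptensDr.
Qed.
Lemma rext_pair_bal (W : lmodType k) (w : W) a x y :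
  a \in rcs_pred A -> rext_pair (w \ot (x * a)) y = rext_pair (w \ot x) (a * y).
Proof.
move=> aA; rewrite -[RHS](kptens_bal (w \ot x : @rext k H A W) (Sub a aA : R) (y : AL)).
by rewrite /rext_pair; congr kptens; exact/esym/(tmapE idfun (rmul a) w x).
Qed.

Lemma lin_lext_pairl (W : lmodType k) (t : W \ox H) : lin (fun x => lext_pair x t).
Proof. by move=> c u v; rewrite /lext_pair -scale_right_module -kptensZl; exact: bptensDl. Qed.
Lemma lin_lext_pairr (W : lmodType k) x : lin (fun t : W \ox H => lext_pair x t).
Proof.
move=> c u v; rewrite /lext_pair -scale_lext -kptensZl kptens_bal; exact: bptensDr.
Qed.
Lemma lext_pair_bal (W : lmodType k) (w : W) a x y :
  a \in rcs_pred A -> lext_pair (x * a) (w \ot y) = lext_pair x (w \ot (a * y)).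
Proof.
move=> aA; rewrite [LHS](kptens_bal (x : AR) (Sub a aA : R) (w \ot y : @lext k H A W)).
by rewrite /lext_pair; congr kptens; exact: (tmapE idfun (lmul a) w y).
Qed.

Lemma dominion_coinv : dominion A = [set` coinvariants C].
Proof.
have lk1 := lin_mod_pairl; have lk2 := lin_mod_pairr; have lp := lin_fc_pi C.
apply/seteqP; split=> h.
  move=> hd; apply/coinvP.
  pose F (x : AR) (y : AL) : zmodule (fc_type C \ox H) := sw x (fun a b => pi a \ot (b * (y : H))).
  have Fx y : lin (fun x => F x y) by rewrite /F; lin_tac.
  have Fy x : lin (F x) by rewrite /F; lin_tac.
  have Dl y : {morph F^~ y : x x' / x + x'} by move=> x x'; have := Fx y 1 x x'; rewrite !scale1r.
  have Dr x : {morph F x : y y' / y + y'} by move=> y y'; have := Fy x 1 y y'; rewrite !scale1r.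
  have B x (r : R) y : F ((r : R^c) *: x) y = F x (r *: y).
    rewrite -[LHS]/(sw ((x : H) * val r) (fun a b => pi a \ot (b * (y : H)))).
    rewrite -[RHS]/(sw (x : H) (fun a b => pi a \ot (b * (val r * (y : H))))).
    rewrite swM; try lin_tac.
    apply: eq_tsum => a b.
    (* The first legs of the comultiplication of [val r] lie in A, so [pi] absorbs them through the
       counit. *)
    rewrite (sw_coideal (A := A) (G := fun u v => eps u *: (pi a \ot (b * v * (y : H))))).
    - by rewrite (sw_counitl (F := fun v => pi a \ot (b * v * (y : H)))) ?mulrA //; lin_tac.
    - lin_tac.
    - lin_tac.
    - lin_tac.
    - lin_tac.
    - by move=> u v uA; rewrite quot_pi // ptensZl.
    - exact: valP.
  have := congr1 (btlift F) hd; rewrite /to_btens !btliftE // /F => E.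
  transitivity (sw h (fun a b => pi a \ot (b * 1))); first by apply: eq_tsum => a b; rewrite mulr1.
  by rewrite [LHS]E sw1 ?mul1r //; lin_tac.
move=> hC; suff E : mod_pair h 1 = mod_pair 1 h by exact: E.
have kb x z y a : a \in rcs_pred A -> mod_pair (x * a) (z * y) = mod_pair x (a * z * y).
  by move=> aA; rewrite mod_pair_bal // mulrA.
have k1 y z : lin (fun x => mod_pair x (z * y)) by lin_tac.
have k2 y x : lin (fun z => mod_pair x (z * y)) by lin_tac.
(* [B] sends pi(x) (x) y to x_1 (x)_A S(x_2) y. On the two sides of the coinvariance equation of h
   it gives h_1 (x)_A S(h_2) h_3 = h (x)_A 1 and 1 (x)_A h. *)
pose B (c : fc_type C) y := beta (k1 y) (k2 y) c.
have BE x y : B (pi x) y = sw x (fun a b => mod_pair a (S b * y)).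
  by rewrite /B betaE // => ? ? ? ?; exact: kb.
have B1 y : lin (fun c => B c y) by apply: lin_beta => ? ? ? ?; exact: kb.
have B2 c : lin (B c).
  have [x ->] := fc_pi_surj c.
  have -> : B (pi x) = fun y => sw x (fun a b => mod_pair a (S b * y)) by apply/funext => y; rewrite BE.
  lin_tac.
have := coinv_sw B1 B2 hC; rewrite BE sw1 ?antipode1 ?mul1r //; try lin_tac.
move=> <-.
transitivity (sw h (fun x y => sw x (fun a b => mod_pair a (S b * y)))); last first.
  by apply: eq_tsum => x y; rewrite BE.
rewrite (sw_coassoc (F := fun a b y => mod_pair a (S b * y))); try lin_tac.
rewrite -[LHS](sw_counitr (F := fun a => mod_pair a 1)); last by lin_tac.
by apply: eq_tsum => a z; rewrite (sw_antipodel (F := fun z => mod_pair a z)) //; lin_tac.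
Qed.

End Pairings.

(** * From flatness to liftings *)

Section FlatSolve.
Variables (k : fieldType) (H : hopfAlgType k) (A : rcoideal_subalg H).
Local Notation S := (@antipode k H).
Local Notation C := (quotient_coalg A).
Local Notation pi := (@fc_pi k H C).
Local Notation eps h := (counit h : k).
Local Notation AR := (as_right_module A).
Local Notation AL := (as_left_module A).
Local Notation R := (rcs_type A).
Variables (V : lmodType k) (rho : {linear V -> V \ox fc_type C}).
Hypothesis rho1 : forall v, tsum (rho v) (fun w c => (counit c : k) *: w) = v.

Definition eps_part (z : V \ox H) : V := tsum z (fun v h => eps h *: v).

Lemma lin_eps_part : lin eps_part.
Proof. by rewrite /eps_part; lin_tac. Qed.

Lemma eps_part_ptens v h : eps_part (v \ot h) = eps h *: v.
Proof.
have lc : lin (@counit k H) by exact: lin_linear.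
by rewrite /eps_part tsum_ptens //; lin_tac.
Qed.

Section Phi.
Variable lam : {linear H -> fc_type C \ox H}.

(* Its kernel is the cotensor product of [V] and [H]. *)
Definition cotens (z : V \ox H) : (V \ox fc_type C) \ox H :=
  tmap rho idfun z - tsum z (fun v h => tsum (lam h) (fun c x => v \ot c \ot x)).

Lemma lin_cotens : lin cotens.
Proof. by rewrite /cotens; lin_tac. Qed.

Lemma cotens_ptens v h :
  cotens (v \ot h) = rho v \ot h - tsum (lam h) (fun c x => v \ot c \ot x).
Proof. by rewrite /cotens tmapE tsum_ptens //; lin_tac. Qed.

Lemma cotens_rmul a : (forall h, lam (h * a) = tmap idfun (rmul a) (lam h)) ->
  forall z, cotens (tmap idfun (rmul a) z) = tmap idfun (rmul a) (cotens z).
Proof.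
move=> lama; have cl := lin_cotens; apply: lin_ext; try lin_tac.
move=> w h; rewrite tmapE !cotens_ptens linearB /= tmapE; congr (_ - _).
rewrite linear_tsum /= /rmul lama tmap_tsum tsum_tsum; try lin_tac.
by apply: eq_tsum => c x; rewrite tsum_ptens ?tmapE //; lin_tac.
Qed.

Lemma cotens_lmul a : (forall h, lam (a * h) = tmap idfun (lmul a) (lam h)) ->
  forall z, cotens (tmap idfun (lmul a) z) = tmap idfun (lmul a) (cotens z).
Proof.
move=> lama; have cl := lin_cotens; apply: lin_ext; try lin_tac.
move=> w h; rewrite tmapE !cotens_ptens linearB /= tmapE; congr (_ - _).
rewrite linear_tsum /= /lmul lama tmap_tsum tsum_tsum; try lin_tac.
by apply: eq_tsum => c x; rewrite tsum_ptens ?tmapE //; lin_tac.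
Qed.

Hypothesis solve : forall chi : {linear V -> k^o},
  (forall z, cotens z = 0 -> chi (eps_part z) = 0) -> forall v, chi v = 0.

(** The attained vectors form a subspace. A vector outside it would be separated from it by a
    functional with value 1 there, which [solve] excludes. *)
Lemma cotens_surj v : exists2 z, cotens z = 0 & eps_part z = v.
Proof.
pose V0 : set V := [set u | exists2 z, cotens z = 0 & eps_part z = u].
have V0E : span V0 = V0.
  apply: span_id => [|a u w [z z0 <-] [z' z'0 <-]].
    by exists 0; [exact: lin0E lin_cotens|exact: lin0E lin_eps_part].
  exists (a *: z + z'); last by rewrite lin_eps_part.
  by rewrite lin_cotens z0 z'0 scaler0 addr0.
have [//|nv] := pselect (V0 v).
have [|chi chiv chi0] := @span_functional _ _ V0 v; first by rewrite V0E.
have := solve (chi := chi) _ v; rewrite chiv => /(_ _)/eqP.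
rewrite (oner_eq0 k) => H0; have // : false.
by apply: H0 => z z0; apply: chi0; exists z.
Qed.
End Phi.

Section Left.
Hypothesis rhoA : forall (U : lmodType k) (F : V -> fc_type C -> fc_type C -> U) v,
  (forall b d, lin (fun a => F a b d)) -> (forall a d, lin (fun b => F a b d)) ->
  (forall a b, lin (F a b)) ->
  tsum (rho v) (fun w c => tsum (rho w) (fun w' c' => F w' c' c)) =
  tsum (rho v) (fun w c => sw c (F w)).
Local Notation lam := (left_coact C).
Local Notation M := (@rext k H A V).
Local Notation M' := (@rext k H A (V \ox fc_type C)).

(** Right multiplication by A commutes with the left coaction, because the first legs of an element
    of A lie in A and [quot_pi] turns them into counits. *)
Lemma cotens_rext : linear (cotens lam : M -> M').
Proof.
have lp := lin_fc_pi C.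
move=> r u v; rewrite -[LHS]/(cotens lam ((r *: u : M) + v)).
have := lin_cotens lam 1 (r *: u : M) v; rewrite !scale1r => ->.
congr (_ + _).
rewrite -[LHS]/(cotens lam (tmap idfun (rmul (val (r : R))) u)).
rewrite -[RHS]/(tmap idfun (rmul (val (r : R))) (cotens lam u)).
apply: cotens_rmul => h; move: (val (r : R)) (valP (r : R)) => a aA.
rewrite !left_coactE linear_tsum swM; try lin_tac.
apply: eq_tsum => x y.
rewrite (sw_coideal (A := A) (G := fun c d => eps c *: (pi x \ot (y * d)))) //; try lin_tac.
- rewrite (sw_counitl (F := fun d => pi x \ot (y * d))); try lin_tac.
  by rewrite /= tmapE.
- by move=> c d cA; rewrite quot_pi ?ptensZl.
Qed.

(** [theta] tensors chi after [eps_part] with eps; it is balanced because eps is multiplicative, and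
    it kills the kernel of [cotens] by the choice of chi. It is evaluated at the sum of w (x) h_1
    (x)_A S(h_2), where w (x) pi(h) runs through rho(v). *)
Lemma left_flat_solve : left_flat A -> forall v, exists2 z, cotens lam z = 0 & eps_part z = v.
Proof.
move=> flat v; apply: cotens_surj => chi chi0 {}v.
have lp := lin_fc_pi C; have lc : lin (@counit k H) by exact: lin_linear.
have le := lin_eps_part; have k1 := lin_rext_pairl A; have k2 := lin_rext_pairr A.
pose phi : {linear M -> M'} := HB.pack (cotens lam : M -> M')
  (GRing.isLinear.Build R^c M M' *:%R (cotens lam : M -> M') cotens_rext).
pose theta (m : M) (n : AL) : k := chi (eps_part m) * eps n.
have Dl n : {morph theta^~ n : m m' / m + m'}.
  move=> m m'; rewrite /theta -mulrDl -linearD; congr (chi _ * _).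
  by have := le 1 m m'; rewrite !scale1r.
have Dr m : {morph theta m : n n' / n + n'}.
  by move=> n n'; rewrite /theta -mulrDr -linearD.
have B m (r : R) n : theta ((r : R^c) *: m) n = theta m (r *: n).
  rewrite /theta -[eps (r *: n)]/(eps (val r * (n : H))) counitM mulrA; congr (_ * _).
  rewrite -[eps_part _]/(eps_part (tmap idfun (rmul (val r)) m)).
  rewrite mulrC -[RHS]linearZ /=; congr (chi _).
  move: (m : V \ox H); apply: lin_ext; try lin_tac.
  by move=> w h; rewrite tmapE !eps_part_ptens /= /rmul counitM scalerA mulrC.
(* Arbitrary representatives: the map [Gam] below depends only on the class in C. *)
pose rep (c : fc_type C) : H := qrepr c.
have repK c : pi (rep c) = c by exact: qreprK.
pose s := [seq (p.1 \ot q.1 : M, S q.2 : AL) | p <- tseq (rho v), q <- tseq (comul (rep p.2))].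
have sE (U : zmodType) (F : M -> AL -> U) : \sum_(p <- s) F p.1 p.2 =
    \sum_(p <- tseq (rho v)) \sum_(q <- tseq (comul (rep p.2))) F (p.1 \ot q.1) (S q.2).
  by rewrite /s big_allpairs_dep.
have := @flat_left_ker R M M' AL phi k theta s flat Dl Dr B.
rewrite (sE _ theta) => E.
have {E} : tsum (rho v) (fun w c => sw (rep c) (fun x y => theta (w \ot x) (S y) : k^o)) = 0.
  apply: E => [m n m0|]; first by rewrite /theta chi0 ?mul0r.
  suff E0 : tsum (rho v) (fun w c => sw (rep c) (fun x y => rext_pair A (cotens lam (w \ot x)) (S y))) = 0
    by rewrite (sE (qmod (@btens_rel R M' AL)) (fun m n => bptens (phi m) n)); exact: E0.
  have ka u y : lin (fun x => rext_pair A (u \ot x : (V \ox fc_type C) \ox H) y) by lin_tac.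
  have kb u x : lin (rext_pair A (u \ot x : (V \ox fc_type C) \ox H)) by exact: k2.
  (* [Gam u (pi h)] is (u (x) h_1) (x)_A S(h_2). In these terms the image of the test element is
     Gam(rho w, c) - Gam(w (x) c_1, c_2) summed over rho(v), which vanishes by coassociativity. *)
  pose Gam (u : V \ox fc_type C) (c : fc_type C) := beta (ka u) (kb u) c.
  have GE u h : Gam u (pi h) = sw h (fun x y => rext_pair A (u \ot x) (S y)).
    by rewrite /Gam betaE // => ? ? ? ?; exact: rext_pair_bal.
  have G2 u : lin (Gam u) by apply: lin_beta => ? ? ? ?; exact: rext_pair_bal.
  have G1 c : lin (fun u => Gam u c).
    have [h ->] := fc_pi_surj c.
    have -> : (fun u => Gam u (pi h)) = fun u => sw h (fun x y => rext_pair A (u \ot x) (S y)).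
      by apply/funext => u; rewrite GE.
    lin_tac.
  transitivity (tsum (rho v) (fun w c => Gam (rho w) c) -
      tsum (rho v) (fun w c => sw c (fun c1 c2 => Gam (w \ot c1) c2))).
    rewrite -sumrB; apply: eq_bigr => p _; move: p.1 p.2 => w c {p}.
    rewrite -{2 3}(repK c); move: (rep c) => h.
    rewrite GE fc_comul_tsum tsum_tsum; try lin_tac.
    transitivity (sw h (fun x y => rext_pair A (rho w \ot x) (S y)) -
        sw h (fun x y => sw x (fun a b => rext_pair A (w \ot pi a \ot b) (S y)))).
      rewrite -sumrB; apply: eq_bigr => p _; rewrite cotens_ptens (linBE _ _ (k1 _ _)).
      rewrite left_coactE tsum_tsum; try lin_tac.
      rewrite (lin_tsumE _ _ (k1 _ _)); congr (_ - _); apply: eq_tsum => a b.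
      by rewrite tsum_ptens //; lin_tac.
    congr (_ - _); rewrite (sw_coassoc (F := fun a b y => rext_pair A (w \ot pi a \ot b) (S y))); try lin_tac.
    by apply: eq_tsum => a z; rewrite tsum_ptens ?GE //; lin_tac.
  apply/eqP; rewrite subr_eq0; apply/eqP.
  rewrite -(rhoA (F := fun w c' c => Gam (w \ot c') c)); try lin_tac.
  apply: eq_tsum => w c; rewrite -{1}[rho w]tsumK.
  exact: (lin_tsumE _ _ (G1 c)).
(* The value of [theta] at the test element is the sum of eps(h_1) eps(S(h_2)) chi(w) = eps(h)
   chi(w), that is chi(v). *)
move=> <-; rewrite -{1}(rho1 v) linear_tsum; apply: eq_tsum => w c.
rewrite linearZ /= -{1}(repK c) fc_counit_pi; move: (rep c) => h.
rewrite -[LHS](sw_counitl (F := fun h => (eps h : k) *: (chi w : k^o))); last by lin_tac.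
apply: eq_tsum => x y; rewrite /theta eps_part_ptens counit_antipode.
have -> : chi (eps x *: w) = eps x * chi w :> k by exact: (linZE (eps x) w (lin_linear chi)).
by rewrite -[RHS]mulrA [chi w * _]mulrC.
Qed.

End Left.
End FlatSolve.

Section FlatSolveRight.
Variables (k : fieldType) (H : hopfAlgType k) (A : rcoideal_subalg H).
Local Notation S := (@antipode k H).
Local Notation C := (quotient_coalg A).
Local Notation pi := (@fc_pi k H C).
Local Notation eps h := (counit h : k).
Local Notation AR := (as_right_module A).
Local Notation R := (rcs_type A).
Variables (T : H -> H).
Hypotheses (ST : cancel T S) (TS : cancel S T).
Variables (V : lmodType k) (rho : {linear V -> V \ox fc_type C}).
Hypothesis rho1 : forall v, tsum (rho v) (fun w c => (counit c : k) *: w) = v.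
Hypothesis rhoA : forall (U : lmodType k) (F : V -> fc_type C -> fc_type C -> U) v,
  (forall b d, lin (fun a => F a b d)) -> (forall a d, lin (fun b => F a b d)) ->
  (forall a b, lin (F a b)) ->
  tsum (rho v) (fun w c => tsum (rho w) (fun w' c' => F w' c' c)) =
  tsum (rho v) (fun w c => sw c (fun c1 c2 => F w c2 c1)).
Local Notation N := (@lext k H A V).
Local Notation N' := (@lext k H A (V \ox fc_type C)).

Lemma lin_twisted_coact : lin (fun h => sw h (fun a b => pi (T a) \ot b)).
Proof. by have lp := lin_fc_pi C; have lT := lin_antipodeV ST TS; lin_tac. Qed.

(** A coaction of the co-opposite of C, which is why the hypothesis [rhoA] interchanges c_1 and c_2.
    As [T] reverses products, left multiplication by a puts T(a_1) on the right inside [pi], where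
    it is absorbed; so the coaction commutes with left multiplication by A. *)
Definition twisted_coact : {linear H -> fc_type C \ox H} := linear_of lin_twisted_coact.
Local Notation lam := twisted_coact.

Lemma twisted_coactE h : lam h = sw h (fun a b => pi (T a) \ot b).
Proof. exact: linear_ofE. Qed.

Lemma sub_coinv a : a \in rcs_pred A -> a \in coinvariants C.
Proof.
move=> aA; have lp := lin_fc_pi C; apply/coinvP.
rewrite (sw_coideal (A := A) (G := fun x y => eps x *: (pi 1 \ot y))) //; try lin_tac.
  by rewrite (sw_counitl (F := fun y => pi 1 \ot y)) //; lin_tac.
by move=> x y xA; rewrite -[x]mul1r quot_pi // mul1r ptensZl.
Qed.

Lemma cotens_lext : linear (cotens rho lam : N -> N').
Proof.
have lp := lin_fc_pi C; have lT := lin_antipodeV ST TS.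
move=> r u v; rewrite -[LHS]/(cotens rho lam ((r *: u : N) + v)).
have := lin_cotens rho lam 1 (r *: u : N) v; rewrite !scale1r => ->.
congr (_ + _).
rewrite -[LHS]/(cotens rho lam (tmap idfun (lmul (val (r : R))) u)).
rewrite -[RHS]/(tmap idfun (lmul (val (r : R))) (cotens rho lam u)).
apply: cotens_lmul => h; move: (val (r : R)) (valP (r : R)) => a aA.
rewrite !twisted_coactE linear_tsum swM; try lin_tac.
rewrite tsum_exchange; apply: eq_tsum => x y.
rewrite (sw_coideal (A := A) (G := fun c d => eps c *: (pi (T x) \ot (d * y)))) //; try lin_tac.
- rewrite (sw_counitl (F := fun d => pi (T x) \ot (d * y))); try lin_tac.
  by rewrite /= tmapE.
- by move=> c d cA; rewrite (antipodeVM ST TS) (coinv_antipodeV ST TS) ?ptensZl // sub_coinv.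
Qed.

(** The test element is now h_1 (x)_A (w (x) S(h_2)). The twisted coaction of S(h_2) has C-leg
    pi(T(S(h_3))) = pi(h_3), so the second term is Gam(w (x) c_2, c_1), which matches the
    co-opposite form of coassociativity. *)
Lemma right_flat_solve : right_flat A -> forall v, exists2 z, cotens rho lam z = 0 & eps_part z = v.
Proof.
move=> flat v; apply: cotens_surj => chi chi0 {}v.
have lp := lin_fc_pi C; have lc : lin (@counit k H) by exact: lin_linear.
have lT := lin_antipodeV ST TS.
have le := @lin_eps_part k H V; have k1 := lin_lext_pairl A; have k2 := lin_lext_pairr A.
pose phi : {linear N -> N'} := HB.pack (cotens rho lam : N -> N')
  (GRing.isLinear.Build R N N' *:%R (cotens rho lam : N -> N') cotens_lext).
pose theta (m : AR) (n : N) : k := eps m * chi (eps_part n).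
have Dl n : {morph theta^~ n : m m' / m + m'}.
  by move=> m m'; rewrite /theta -mulrDl -linearD.
have Dr m : {morph theta m : n n' / n + n'}.
  move=> n n'; rewrite /theta -mulrDr -linearD; congr (_ * chi _).
  by have := le 1 n n'; rewrite !scale1r.
have B m (r : R) n : theta ((r : R^c) *: m) n = theta m (r *: n).
  rewrite /theta -[eps ((r : R^c) *: m)]/(eps ((m : H) * val r)) counitM -mulrA; congr (_ * _).
  rewrite -[eps_part (r *: n)]/(eps_part (tmap idfun (lmul (val r)) n)).
  rewrite -[LHS]linearZ /=; congr (chi _).
  move: (n : V \ox H); apply: lin_ext; try lin_tac.
  by move=> w h; rewrite tmapE !eps_part_ptens /= /lmul counitM scalerA.
pose rep (c : fc_type C) : H := qrepr c.
have repK c : pi (rep c) = c by exact: qreprK.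
pose s := [seq (q.1 : AR, p.1 \ot S q.2 : N) | p <- tseq (rho v), q <- tseq (comul (rep p.2))].
have sE (U : zmodType) (F : AR -> N -> U) : \sum_(p <- s) F p.1 p.2 =
    \sum_(p <- tseq (rho v)) \sum_(q <- tseq (comul (rep p.2))) F q.1 (p.1 \ot S q.2).
  by rewrite /s big_allpairs_dep.
have := @flat_right_ker R AR N N' phi k theta s flat Dl Dr B.
rewrite (sE _ theta) => E.
have {E} : tsum (rho v) (fun w c => sw (rep c) (fun x y => theta x (w \ot S y) : k^o)) = 0.
  apply: E => [m n m0|]; first by rewrite /theta chi0 ?mulr0.
  suff E0 : tsum (rho v) (fun w c => sw (rep c) (fun x y => lext_pair A x (cotens rho lam (w \ot S y)))) = 0
    by rewrite (sE (qmod (@btens_rel R AR N')) (fun m n => bptens m (phi n))); exact: E0.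
  have ka u y : lin (fun x => lext_pair A x (u \ot y : (V \ox fc_type C) \ox H)) by lin_tac.
  have kb u x : lin (fun y => lext_pair A x (u \ot y : (V \ox fc_type C) \ox H)) by lin_tac.
  pose Gam (u : V \ox fc_type C) (c : fc_type C) := beta (ka u) (kb u) c.
  have GE u h : Gam u (pi h) = sw h (fun x y => lext_pair A x (u \ot S y)).
    by rewrite /Gam betaE // => ? ? ? ?; exact: lext_pair_bal.
  have G2 u : lin (Gam u) by apply: lin_beta => ? ? ? ?; exact: lext_pair_bal.
  have G1 c : lin (fun u => Gam u c).
    have [h ->] := fc_pi_surj c.
    have -> : (fun u => Gam u (pi h)) = fun u => sw h (fun x y => lext_pair A x (u \ot S y)).
      by apply/funext => u; rewrite GE.
    lin_tac.
  transitivity (tsum (rho v) (fun w c => Gam (rho w) c) -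
      tsum (rho v) (fun w c => sw c (fun c1 c2 => Gam (w \ot c2) c1))).
    rewrite -sumrB; apply: eq_bigr => p _; move: p.1 p.2 => w c {p}.
    rewrite -{2 3}(repK c); move: (rep c) => h.
    rewrite GE fc_comul_tsum tsum_tsum; try lin_tac.
    transitivity (sw h (fun x y => lext_pair A x (rho w \ot S y)) -
        sw h (fun x y => sw y (fun a b => lext_pair A x (w \ot pi b \ot S a)))).
      rewrite -sumrB; apply: eq_bigr => p _; rewrite cotens_ptens (linBE _ _ (k2 _ _)).
      rewrite twisted_coactE tsum_tsum; try lin_tac.
      rewrite (lin_tsumE _ _ (k2 _ _)); congr (_ - _).
      rewrite sw_antipode; try lin_tac.
      by apply: eq_tsum => a b; rewrite TS tsum_ptens //; lin_tac.
    congr (_ - _); rewrite -(sw_coassoc (F := fun x a b => lext_pair A x (w \ot pi b \ot S a))); try lin_tac.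
    by apply: eq_tsum => a z; rewrite tsum_ptens ?GE //; lin_tac.
  apply/eqP; rewrite subr_eq0; apply/eqP.
  rewrite -(rhoA (F := fun w c' c => Gam (w \ot c') c)); try lin_tac.
  apply: eq_tsum => w c; rewrite -{1}[rho w]tsumK.
  exact: (lin_tsumE _ _ (G1 c)).
move=> <-; rewrite -{1}(rho1 v) linear_tsum; apply: eq_tsum => w c.
rewrite linearZ /= -{1}(repK c) fc_counit_pi; move: (rep c) => h.
rewrite -[LHS](sw_counitl (F := fun h => (eps h : k) *: (chi w : k^o))); last by lin_tac.
apply: eq_tsum => x y; rewrite /theta eps_part_ptens counit_antipode.
by have -> : chi (eps y *: w) = eps y * chi w :> k by exact: (linZE (eps y) w (lin_linear chi)).
Qed.

End FlatSolveRight.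

Section FlatLiftable.
Variables (k : fieldType) (H : hopfAlgType k) (A : rcoideal_subalg H).
Local Notation S := (@antipode k H).
Local Notation C := (quotient_coalg A).
Local Notation pi := (@fc_pi k H C).

Section Coaction.
Variables (n : nat) (d : 'I_n -> 'I_n -> fc_type C).
Local Notation V := 'rV[k]_n.
Local Notation e i := (delta_mx 0 i : V).

Definition row_coact (v : V) : V \ox fc_type C := \sum_j v 0 j *: \sum_i e i \ot d i j.

Lemma lin_row_coact : lin row_coact.
Proof. by apply: lin_sum => j; exact: lin_coord. Qed.
Local Notation rho := (linear_of lin_row_coact).

Lemma row_coactE j : rho (e j) = \sum_i e i \ot d i j.
Proof. by rewrite linear_ofE /row_coact coord_delta. Qed.

Lemma lin_row_entry i : lin (fun v : V => v 0 i : k^o).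
Proof. by move=> a u v; rewrite !mxE. Qed.

Lemma row_coact_counit v : (forall i j, (counit (d i j) : k) = (i == j)%:R) ->
  tsum (rho v) (fun w c => (counit c : k) *: w) = v.
Proof.
move=> d1; move: v; apply: row_linext; try lin_tac.
move=> j; rewrite row_coactE tsum_sum; try lin_tac.
rewrite -[RHS](sum_delta j (fun i => e i)); apply: eq_bigr => i _.
rewrite tsum_ptens; try lin_tac.
by rewrite d1 eq_sym.
Qed.

Lemma row_coact_coord i v :
  tsum (rho v) (fun w c => (w 0 i : k) *: c) = \sum_j v 0 j *: d i j.
Proof.
have le := lin_row_entry; move: v; apply: row_linext; try lin_tac.
move=> j; rewrite row_coactE coord_delta tsum_sum; try lin_tac.
rewrite -[RHS](sum_delta i (fun m => d m j)); apply: eq_bigr => m _.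
rewrite tsum_ptens; try lin_tac.
by rewrite mxE eqxx.
Qed.

(** The kernel equation read in the i-th coordinate of V: the entries of [z] satisfy the comatrix
    equations for [lam]. *)
Lemma cotens_coord (lam : {linear H -> fc_type C \ox H}) z i : cotens rho lam z = 0 ->
  lam (tsum z (fun v h => (v 0 i : k) *: h)) =
  \sum_j d i j \ot tsum z (fun v h => (v 0 j : k) *: h).
Proof.
move=> z0; have le := lin_row_entry.
pose G (t : (V \ox fc_type C) \ox H) := tsum t (fun u h => tsum u (fun w c => (w 0 i : k) *: c) \ot h).
have Gl : lin G by rewrite /G; lin_tac.
have := lin0E Gl; rewrite -[X in G X]z0 (linBE _ _ Gl) => /eqP.
rewrite subr_eq0 => /eqP E.
transitivity (G (tsum z (fun v h => tsum (lam h) (fun c x => v \ot c \ot x)))).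
  rewrite linear_tsum (lin_tsumE _ _ Gl); apply: eq_tsum => v h.
  rewrite linearZ (lin_tsumE _ _ Gl) -{1}[lam h]tsumK.
  rewrite [LHS](lin_tsumE _ _ (lin_scale _ (@lin_id _ _))); apply: eq_tsum => c x.
  rewrite /G tsum_ptens; try lin_tac.
  rewrite tsum_ptens; try lin_tac.
  by rewrite ptensZl.
rewrite -E tmap_tsum (lin_tsumE _ _ Gl).
transitivity (tsum z (fun v h => \sum_j (v 0 j : k) *: (d i j \ot h))).
  apply: eq_tsum => v h; rewrite /G tsum_ptens; try lin_tac.
  rewrite row_coact_coord (lin_sumE _ _ (lin_ptensl h (@lin_id _ _))).
  by apply: eq_bigr => j _; rewrite ptensZl.
rewrite [LHS]exchange_big; apply: eq_bigr => j _; rewrite ptens_tsumr.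
by apply: eq_bigr => p _; rewrite linearZ.
Qed.

Lemma eps_part_coord (z : V \ox H) i :
  (counit (tsum z (fun v h => (v 0 i : k) *: h)) : k) = eps_part z 0 i.
Proof.
rewrite /eps_part (lin_tsumE _ _ (lin_row_entry i)) (lin_tsumE _ _ (lin_linear counit)).
apply: eq_bigr => p _; rewrite mxE linearZ; exact: mulrC.
Qed.

End Coaction.

Lemma left_flat_liftable : left_flat A -> left_liftable C.
Proof.
move=> flat n c [cA c1] l.
pose rho := linear_of (lin_row_coact c).
have [|U F v F1 F2 F3|z z0 ze] := left_flat_solve (rho := rho) _ _ flat (delta_mx 0 l).
- by move=> v; exact: row_coact_counit.
- move: v; apply: row_linext; try lin_tac.
  move=> j; rewrite row_coactE !tsum_sum; try lin_tac.
  transitivity (\sum_i \sum_m F (delta_mx 0 m) (c m i) (c i j)).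
    apply: eq_bigr => i _; rewrite tsum_ptens; try lin_tac.
    rewrite row_coactE tsum_sum; try lin_tac.
    by apply: eq_bigr => m _; rewrite tsum_ptens //; lin_tac.
  rewrite exchange_big; apply: eq_bigr => m _; rewrite tsum_ptens; try lin_tac.
  rewrite cA tsum_sum; try lin_tac.
  by apply: eq_bigr => i _; rewrite tsum_ptens //; lin_tac.
exists (fun i => tsum z (fun v h => (v 0 i : k) *: h)); split=> i.
  by rewrite -left_coactE (cotens_coord _ z0).
by rewrite eps_part_coord ze mxE eqxx.
Qed.

Lemma right_flat_liftable (T : H -> H) : cancel T S -> cancel S T ->
  right_flat A -> right_liftable C.
Proof.
move=> ST TS flat n c [cA c1] l; have lT := lin_antipodeV ST TS.
have lp := lin_fc_pi C.
(* The transposed matrix is a comatrix for the co-opposite comultiplication, the one that goes with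
   the twisted coaction. *)
pose rho := linear_of (lin_row_coact (fun i j => c j i)).
have [|U F v F1 F2 F3|z z0 ze] := right_flat_solve (rho := rho) ST TS _ _ flat (delta_mx 0 l).
- by move=> v; apply: row_coact_counit => i j; rewrite c1 eq_sym.
- move: v; apply: row_linext; try lin_tac.
  move=> j; rewrite row_coactE !tsum_sum; try lin_tac.
  transitivity (\sum_i \sum_m F (delta_mx 0 m) (c i m) (c j i)).
    apply: eq_bigr => i _; rewrite tsum_ptens; try lin_tac.
    rewrite row_coactE tsum_sum; try lin_tac.
    by apply: eq_bigr => m _; rewrite tsum_ptens //; lin_tac.
  rewrite exchange_big; apply: eq_bigr => m _; rewrite tsum_ptens; try lin_tac.
  rewrite cA tsum_sum; try lin_tac.
  by apply: eq_bigr => i _; rewrite tsum_ptens //; lin_tac.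
pose y i := tsum z (fun v h => (v 0 i : k) *: h).
(* The y_i satisfy equations for pi(T(y_1)) (x) y_2. Since comul (T y) = T(y_2) (x) T(y_1), applying
   [T] to the H-leg and flipping gives the right coaction of T(y_i). *)
exists (fun i => T (y i)); split=> i; last first.
  by rewrite (counit_antipodeV ST) eps_part_coord ze mxE eqxx.
have := congr1 (fun t => tsum t (fun c h => T h \ot c)) (cotens_coord i z0).
cbv beta; rewrite twisted_coactE tsum_tsum; try lin_tac.
rewrite tsum_sum; try lin_tac.
move=> E; rewrite sw_antipodeV //; try lin_tac.
transitivity (sw (y i) (fun a b => tsum (pi (T a) \ot b) (fun c h => T h \ot c))).
  by apply: eq_tsum => a b; rewrite tsum_ptens //; lin_tac.
by rewrite [LHS]E; apply: eq_bigr => j _; rewrite tsum_ptens //; lin_tac.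
Qed.

End FlatLiftable.

(** * The two assignments as mutually inverse bijections *)

Section Correspondence.
Variables (k : fieldType) (H : hopfAlgType k).
Implicit Types (A : rcoideal_subalg H) (C : factor_coalg H).

Lemma coinvariants_quotient A : dominion_subalgebra A -> coinvariants (quotient_coalg A) = A.
Proof.
move=> dA; apply: rcs_eq => h; apply/idP/idP => hA.
  have : dominion A h by rewrite dominion_coinv.
  by rewrite dA.
have : dominion A h by rewrite dA.
by rewrite dominion_coinv.
Qed.

(** Coinvariants act through eps in C by [coinv_pi], so H A^+ always lies in the kernel of [pi]; the
    hypothesis is the reverse inclusion. *)
Lemma quotient_coinvariants C :
  (forall h, fc_pi C h = 0 -> Defs.span (aug_gen (coinvariants C)) h) ->
  quotient_coalg (coinvariants C) = C.
Proof.
move=> kerC; apply: fc_eq => h; apply/idP/idP => [/asboolP|hC].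
  have [C0 CD] := fc_left_ideal C.
  have CZ c x : x \in fc_ker C -> c *: x \in fc_ker C.
    by move=> Cx; rewrite -[x]mul1r scalerAl -[_ * _]addr0; exact: CD.
  apply: (@span_ind_linear _ _ _ (fun h => h \in fc_ker C)) => //.
    by move=> a u v Cu Cv; rewrite -[u]mul1r scalerAl; exact: CD.
  move=> _ [g [a [aA a0 ->]]].
  have := coinv_pi g aA; rewrite a0 scale0r -[RHS](linear0 (fc_pi C)).
  by move/fc_pi_eq; rewrite subr0.
by apply/asboolP; apply: kerC; exact: fc_pi_eq0.
Qed.

Lemma inverse_bijections (X : set (rcoideal_subalg H)) (Y : set (factor_coalg H)) :
  (forall A, X A -> Y (quotient_coalg A)) -> (forall C, Y C -> X (coinvariants C)) ->
  (forall A, X A -> coinvariants (quotient_coalg A) = A) ->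
  (forall C, Y C -> quotient_coalg (coinvariants C) = C) ->
  mutually_inverse_bijections X Y (@quotient_coalg k H) (@coinvariants k H).
Proof.
move=> XY YX XK YK; split; last 2 first.
- by move=> A; rewrite inE => XA; exact: XK.
- by move=> C; rewrite inE => YC; exact: YK.
- split=> [A XA|A B|C YC]; first exact: XY.
    by rewrite !inE => XA XB AB; rewrite -(XK A) // AB XK.
  by exists (coinvariants C); [exact: YX|exact: YK].
- split=> [C YC|C D|A XA]; first exact: YX.
    by rewrite !inE => YC YD CD; rewrite -(YK C) // CD YK.
  by exists (quotient_coalg A); [exact: XY|exact: XK].
Qed.

(** By [dominion_coinv] the dominion is the algebra of coinvariants of the quotient by H A^+, and
    [QC] identifies that quotient with C. *)
Lemma coinvariants_dominion C :
  quotient_coalg (coinvariants C) = C -> dominion_subalgebra (coinvariants C).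
Proof. by move=> QC; rewrite /dominion_subalgebra dominion_coinv QC. Qed.

End Correspondence.

Theorem theorem4p6 (k : fieldType) (H : hopfAlgType k)
    (antipode_bij : bijective (antipode : H -> H)) :
  mutually_inverse_bijections
    [set A : rcoideal_subalg H | dominion_subalgebra A /\ left_flat A]
    [set C : factor_coalg H | left_comodules_embed C]
    (@quotient_coalg k H) (@coinvariants k H)
  /\
  mutually_inverse_bijections
    [set A : rcoideal_subalg H | dominion_subalgebra A /\ right_flat A]
    [set C : factor_coalg H | right_comodules_embed C]
    (@quotient_coalg k H) (@coinvariants k H).
Proof.
case: antipode_bij => T TS ST.
have QL C : left_comodules_embed C -> quotient_coalg (coinvariants C) = C.
  by move=> /left_embed_liftable lift; apply: quotient_coinvariants => h; exact: left_liftable_ker.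
have QR C : right_comodules_embed C -> quotient_coalg (coinvariants C) = C.
  by move=> /right_embed_liftable lift; apply: quotient_coinvariants => h; exact: right_liftable_ker.
split; apply: inverse_bijections => [A [dA flat]|C emb|A [dA _]|C emb].
- exact/left_liftable_embed/left_flat_liftable.
- split; first exact/coinvariants_dominion/QL.
  apply: left_flat_equational => s b g; apply: (left_equational ST TS).
  exact: left_embed_liftable.
- exact: coinvariants_quotient.
- exact: QL.
- exact/right_liftable_embed/(right_flat_liftable ST TS).
- split; first exact/coinvariants_dominion/QR.
  apply: right_flat_equational => s b g; apply: right_equational.
  exact: right_embed_liftable.
- exact: coinvariants_quotient.
- exact: QR.
Qed.
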